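(* In the regime $\mathcal A_{\mathrm{boussi}}$, the Castro-Lannes system is consistent at order $\mathcal O(\mu^2)$ with the Boussinesq-Coriolis equations: for any smooth solution $(\zeta,\mathbf U_{/\!/},\boldsymbol\omega)$ of the Castro-Lannes system with parameters $(\mu,\epsilon,\gamma,\mathrm{Ro})\in\mathcal A_{\mathrm{boussi}}$, the pair $(\zeta,\overline{\mathbf V})$ with $\overline{\mathbf V}=\overline{\mathbf V}[\epsilon\zeta](\mathbf U_{/\!/},\boldsymbol\omega)$ satisfies $$\begin{cases}\partial_t\zeta+\nabla^\gamma\cdot([1+\epsilon\zeta]\overline{\mathbf V})=\mathcal O(\mu^2),\\ \big(1-\frac\mu3\nabla^\gamma\nabla^\gamma\cdot\big)\partial_t\overline{\mathbf V}+\nabla^\gamma\zeta+\epsilon\overline{\mathbf V}\cdot\nabla^\gamma\overline{\mathbf V}+\frac{\epsilon}{\mathrm{Ro}}\overline{\mathbf V}^\perp=\mathcal O(\mu^2).\end{cases}$$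
   Context: Notation: $X=(x,y)\in\mathbb R^2$, $z\in\mathbb R$; $(u,v)^\perp=(-v,u)$. $\nabla^\gamma=(\partial_x,\gamma\partial_y)^t$, $\nabla^{\gamma\perp}=(-\gamma\partial_y,\partial_x)^t$, $\nabla^{\mu,\gamma}_{X,z}=(\sqrt\mu\nabla^\gamma,\partial_z)^t$, $\mathrm{curl}^{\mu,\gamma}=\nabla^{\mu,\gamma}_{X,z}\times$, $\mathrm{div}^{\mu,\gamma}=\nabla^{\mu,\gamma}_{X,z}\cdot$. Regime: for fixed $\mu_0>0$ and a fixed constant $M$, $\mathcal A_{\mathrm{boussi}}$ is the set of positive parameters $(\mu,\epsilon,\gamma,\mathrm{Ro})$ with $\mu\le\mu_0$, $\epsilon\le M\mu$, $\gamma\le1$, $\frac{\epsilon}{\mathrm{Ro}}\le M\sqrt\mu$. Castro-Lannes system. $\zeta(t,X)$ is the surface elevation, with $h=1+\epsilon\zeta\ge h_{\min}>0$; $\Omega_t=\{-1<z<\epsilon\zeta(t,X)\}$, $\mathbf U_{/\!/}(t,X)\in\mathbb R^2$, $\boldsymbol\omega(t,X,z)\in\mathbb R^3$ on $\Omega_t$. The field $\mathbf U^\mu=(\sqrt\mu\mathbf V,\mathrm w)^t=\mathbf U^\mu[\epsilon\zeta](\mathbf U_{/\!/},\boldsymbol\omega)$ is the unique solution in $H^1(\Omega_t)$ of $$\mathrm{curl}^{\mu,\gamma}\mathbf U^\mu=\mu\boldsymbol\omega,\quad \mathrm{div}^{\mu,\gamma}\mathbf U^\mu=0\ \text{in }\Omega_t,\quad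 \underline{\mathbf V}+\epsilon\underline{\mathrm w}\nabla^\gamma\zeta=\mathbf U_{/\!/},\quad \mathrm w_{|z=-1}=0,$$ where underlining denotes the trace at $z=\epsilon\zeta$. With $\mathbf N^{\mu,\gamma}=(-\epsilon\sqrt\mu\nabla^\gamma\zeta,1)^t$ the system is $$\begin{cases}\partial_t\zeta-\frac1\mu\underline{\mathbf U}^\mu\cdot\mathbf N^{\mu,\gamma}=0,\\ \partial_t\mathbf U_{/\!/}+\nabla^\gamma\zeta+\frac\epsilon2\nabla^\gamma|\mathbf U_{/\!/}|^2-\frac{\epsilon}{2\mu}\nabla^\gamma\big[(1+\epsilon^2\mu|\nabla^\gamma\zeta|^2)\underline{\mathrm w}^2\big]+\epsilon(\nabla^{\gamma\perp}\cdot\mathbf U_{/\!/})\underline{\mathbf V}^\perp+\frac{\epsilon}{\mathrm{Ro}}\underline{\mathbf V}^\perp=0,\\ \partial_t\boldsymbol\omega+\frac\epsilon\mu(\mathbf U^\mu\cdot\nabla^{\mu,\gamma}_{X,z})\boldsymbol\omega=\frac\epsilon\mu(\boldsymbol\omega\cdot\nabla^{\mu,\gamma}_{X,z})\mathbf U^\mu+\frac{\epsilon}{\mu\mathrm{Ro}}\partial_z\mathbf U^\mu\ \text{in }\Omega_t.\end{cases}$$ Averaged velocity: $\overline{\mathbf V}[\epsilon\zeta](\mathbf U_{/\!/},\boldsymbol\omega)=\frac1h\int_{-1}^{\epsilon\zeta}\mathbf V\,dz$. Meaning of $\mathcal O(\mu^a)$: the solutions considered are smooth on a time interval, and $\zeta,\mathbf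 U_{/\!/},\boldsymbol\omega,\overline{\mathbf V},\mathbf U=(\mathbf V,\mathrm w),\partial_t\zeta,\partial_t\mathbf U_{/\!/},\partial_t\boldsymbol\omega,\partial_t\mathbf U$ are bounded there uniformly with respect to the parameters. Precisely, $R=\mathcal O(\mu^a)$ means: for every integer $s\ge0$ there are an integer $n$ and a nondecreasing function $C(\cdot)$, independent of the parameters and of the solution, such that if the $H^n$ norms (over $\mathbb R^2$ or $\Omega_t$) of all these quantities are at most $A$ on the time interval, then $|R|_{H^s}\le C(A,\mu_0,\frac1{h_{\min}},M)\,\mu^a$ on that interval. *)

(* Defs.v *)
From HB Require Import structures.
From mathcomp Require Import all_boot all_order all_algebra.
From mathcomp Require Import all_classical all_reals all_analysis.

Set Implicit Arguments.
Unset Strict Implicit.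
Unset Printing Implicit Defensive.

Import Order.TTheory GRing.Theory Num.Theory numFieldNormedType.Exports.

Local Open Scope classical_set_scope.
Local Open Scope ring_scope.

(* Points and vectors.  X = (x, y) has type [vec2 R], (X, z) = ((x, y), z) has
   type [vec3 R]; so a 3-vector is literally (horizontal part, vertical part).
   Time is the first component of [sp2 R] (surface) and [sp3 R] (fluid). *)
Notation vec2 R := (R * R)%type.
Notation vec3 R := ((R * R) * R)%type.
Notation sp2 R := (R * vec2 R)%type.
Notation sp3 R := (R * vec3 R)%type.

Definition perp {R : realType} (u : vec2 R) : vec2 R := (- u.2, u.1).

(* Squared Euclidean norms; the canonical norm of a product type is the
   maximum norm. *)
Definition sq1 {R : realType} (a : R) : R := a ^+ 2.
Definition sq2 {R : realType} (u : vec2 R) : R := u.1 ^+ 2 + u.2 ^+ 2.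
Definition sq3 {R : realType} (u : vec3 R) : R := sq2 u.1 + u.2 ^+ 2.

Definition dot3 {R : realType} (u v : vec3 R) : R :=
  u.1.1 * v.1.1 + u.1.2 * v.1.2 + u.2 * v.2.

Definition dt2 {R : realType} {W : normedModType R} (f : sp2 R -> W) :
  sp2 R -> W := 'D_((1, (0, 0)) : sp2 R) f.
Definition dx2 {R : realType} {W : normedModType R} (f : sp2 R -> W) :
  sp2 R -> W := 'D_((0, (1, 0)) : sp2 R) f.
Definition dy2 {R : realType} {W : normedModType R} (f : sp2 R -> W) :
  sp2 R -> W := 'D_((0, (0, 1)) : sp2 R) f.

Definition dt3 {R : realType} {W : normedModType R} (f : sp3 R -> W) :
  sp3 R -> W := 'D_((1, ((0, 0), 0)) : sp3 R) f.
Definition dx3 {R : realType} {W : normedModType R} (f : sp3 R -> W) :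
  sp3 R -> W := 'D_((0, ((1, 0), 0)) : sp3 R) f.
Definition dy3 {R : realType} {W : normedModType R} (f : sp3 R -> W) :
  sp3 R -> W := 'D_((0, ((0, 1), 0)) : sp3 R) f.
Definition dz3 {R : realType} {W : normedModType R} (f : sp3 R -> W) :
  sp3 R -> W := 'D_((0, ((0, 0), 1)) : sp3 R) f.

(* C^infinity on a neighbourhood of [D]: for a domain with boundary this is
   smoothness up to the boundary, the field being extended past [D]. *)
Definition smooth_on {R : realType} {E W : normedModType R}
    (D : set E) (f : E -> W) : Prop :=
  exists O : set E, [/\ open O, D `<=` O &
    forall (vs : seq E) (p : E), O p ->
      differentiable (foldr (fun v (g : E -> W) => 'D_v g) f vs) p].

(* H^n norms at time t over R^2 and over Om (infinite outside H^n), q being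
   the squared Euclidean norm of the values. *)
Definition Hnorm2 {R : realType} {W : normedModType R} (q : W -> R) (n : nat)
    (f : sp2 R -> W) (t : R) : \bar R :=
  sqrte (\sum_(a < n.+1) \sum_(b < n.+1 | (a + b <= n)%N)
    \int[lebesgue_measure \x lebesgue_measure]_(X in [set: vec2 R])
      (q (iter a dx2 (iter b dy2 f) (t, X)))%:E)%E.

Definition Hnorm3 {R : realType} {W : normedModType R} (q : W -> R) (n : nat)
    (Om : set (vec3 R)) (f : sp3 R -> W) (t : R) : \bar R :=
  sqrte (\sum_(a < n.+1) \sum_(b < n.+1) \sum_(c < n.+1 | (a + b + c <= n)%N)
    \int[(lebesgue_measure \x lebesgue_measure) \x lebesgue_measure]_(Q in Om)
      (q (iter a dx3 (iter b dy3 (iter c dz3 f)) (t, Q)))%:E)%E.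

Definition grad {R : realType} (g : R) (f : sp2 R -> R) (p : sp2 R) : vec2 R :=
  (dx2 f p, g * dy2 f p).
Definition divg {R : realType} (g : R) (F : sp2 R -> vec2 R) (p : sp2 R) : R :=
  (dx2 F p).1 + g * (dy2 F p).2.
(* nabla^{gamma perp} . F *)
Definition rotg {R : realType} (g : R) (F : sp2 R -> vec2 R) (p : sp2 R) : R :=
  - g * (dy2 F p).1 + (dx2 F p).2.
(* (F . nabla^gamma) G *)
Definition adv2 {R : realType} (g : R) (F G : sp2 R -> vec2 R) (p : sp2 R) :
  vec2 R := (F p).1 *: dx2 G p + (g * (F p).2) *: dy2 G p.

(* Components of nabla^{mu,gamma}_{X,z} *)
Definition D1 {R : realType} {W : normedModType R} (m g : R) (f : sp3 R -> W)
  (p : sp3 R) : W := Num.sqrt m *: dx3 f p.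
Definition D2 {R : realType} {W : normedModType R} (m g : R) (f : sp3 R -> W)
  (p : sp3 R) : W := (Num.sqrt m * g) *: dy3 f p.
Definition D3 {R : realType} {W : normedModType R} (m g : R) (f : sp3 R -> W)
  (p : sp3 R) : W := dz3 f p.

Definition curl {R : realType} (m g : R) (F : sp3 R -> vec3 R) (p : sp3 R) :
    vec3 R :=
  (((D2 m g F p).2 - (D3 m g F p).1.2, (D3 m g F p).1.1 - (D1 m g F p).2),
   (D1 m g F p).1.2 - (D2 m g F p).1.1).
Definition div3 {R : realType} (m g : R) (F : sp3 R -> vec3 R) (p : sp3 R) :
  R := (D1 m g F p).1.1 + (D2 m g F p).1.2 + (D3 m g F p).2.
(* (F . nabla^{mu,gamma}_{X,z}) G *)
Definition adv3 {R : realType} (m g : R) (F G : sp3 R -> vec3 R) (p : sp3 R) :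
    vec3 R :=
  (F p).1.1 *: D1 m g G p + (F p).1.2 *: D2 m g G p + (F p).2 *: D3 m g G p.

Record params (R : realType) :=
  Params { mu : R ; eps : R ; gam : R ; Ro : R }.

Definition A_boussi {R : realType} (mu0 M : R) (P : params R) : Prop :=
  [/\ 0 < mu P, 0 < eps P, 0 < gam P & 0 < Ro P] /\
  [/\ mu P <= mu0, eps P <= M * mu P, gam P <= 1
    & eps P / Ro P <= M * Num.sqrt (mu P)].

Record flow (R : realType) := Flow {
  zeta : sp2 R -> R ;
  Upar : sp2 R -> vec2 R ;
  omega : sp3 R -> vec3 R ;
  velV : sp3 R -> vec2 R ;
  velw : sp3 R -> R
}.

Definition velU {R : realType} (S : flow R) (p : sp3 R) : vec3 R :=
  (velV S p, velw S p).
Definition Umu {R : realType} (P : params R) (S : flow R) (p : sp3 R) :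
  vec3 R := (Num.sqrt (mu P) *: velV S p, velw S p).

Definition depth {R : realType} (P : params R) (S : flow R) (p : sp2 R) : R :=
  1 + eps P * zeta S p.

Definition Omega {R : realType} (P : params R) (S : flow R) (t : R) :
  set (vec3 R) := [set Q | -1 < Q.2 /\ Q.2 < eps P * zeta S (t, Q.1)].

Definition trace {R : realType} {W : Type} (P : params R) (S : flow R)
    (f : sp3 R -> W) (p : sp2 R) : W :=
  f (p.1, (p.2, eps P * zeta S p)).

Definition normalN {R : realType} (P : params R) (S : flow R) (p : sp2 R) :
  vec3 R :=
  (- (eps P * Num.sqrt (mu P)) *: grad (gam P) (zeta S) p, 1).

Definition Vbar {R : realType} (P : params R) (S : flow R) (p : sp2 R) :
    vec2 R :=
  (depth P S p)^-1 *:
  (\int[lebesgue_measure]_(z in `[-1, eps P * zeta S p])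
     (velV S (p.1, (p.2, z))).1,
   \int[lebesgue_measure]_(z in `[-1, eps P * zeta S p])
     (velV S (p.1, (p.2, z))).2).

(* The functional U^mu[eps zeta](Upar, omega) enters through its defining
   problem: U^mu is part of the flow and solves it in H^1. *)
Definition div_curl_problem {R : realType} (P : params R) (S : flow R) (t : R) :
    Prop :=
  [/\ (Hnorm3 sq3 1 (Omega P S t) (Umu P S) t < +oo)%E,
      forall Q, Omega P S t Q ->
        curl (mu P) (gam P) (Umu P S) (t, Q) = mu P *: omega S (t, Q),
      forall Q, Omega P S t Q -> div3 (mu P) (gam P) (Umu P S) (t, Q) = 0,
      forall X, trace P S (velV S) (t, X)
        + (eps P * trace P S (velw S) (t, X)) *: grad (gam P) (zeta S) (t, X)
        = Upar S (t, X)
    & forall X, velw S (t, (X, -1)) = 0].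

Definition kinematic_eq {R : realType} (P : params R) (S : flow R)
    (p : sp2 R) : Prop :=
  dt2 (zeta S) p - (mu P)^-1 * dot3 (trace P S (Umu P S) p) (normalN P S p) = 0.

Definition momentum_eq {R : realType} (P : params R) (S : flow R)
    (p : sp2 R) : Prop :=
  let g := gam P in
  let V := trace P S (velV S) in
  let w := trace P S (velw S) in
  dt2 (Upar S) p + grad g (zeta S) p
  + (eps P / 2) *: grad g (fun r => sq2 (Upar S r)) p
  - (eps P / (2 * mu P)) *:
      grad g (fun r => (1 + eps P ^+ 2 * mu P * sq2 (grad g (zeta S) r))
                       * w r ^+ 2) p
  + (eps P * rotg g (Upar S) p) *: perp (V p)
  + (eps P / Ro P) *: perp (V p) = 0.

Definition vorticity_eq {R : realType} (P : params R) (S : flow R)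
    (p : sp3 R) : Prop :=
  dt3 (omega S) p
  + (eps P / mu P) *: adv3 (mu P) (gam P) (Umu P S) (omega S) p
  = (eps P / mu P) *: adv3 (mu P) (gam P) (omega S) (Umu P S) p
    + (eps P / (mu P * Ro P)) *: dz3 (Umu P S) p.

Definition fluid_closure {R : realType} (P : params R) (S : flow R)
    (I : set R) : set (sp3 R) :=
  [set p | I p.1 /\ -1 <= p.2.2 /\ p.2.2 <= eps P * zeta S (p.1, p.2.1)].

Definition castro_lannes {R : realType} (hmin : R) (I : set R) (P : params R)
    (S : flow R) : Prop :=
  [/\ smooth_on (I `*` [set: vec2 R]) (zeta S),
      smooth_on (I `*` [set: vec2 R]) (Upar S),
      smooth_on (fluid_closure P S I) (omega S),
      smooth_on (fluid_closure P S I) (velV S)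
    & smooth_on (fluid_closure P S I) (velw S)] /\
  forall t, I t ->
    [/\ forall X, hmin <= depth P S (t, X),
        div_curl_problem P S t,
        forall X, kinematic_eq P S (t, X),
        forall X, momentum_eq P S (t, X)
      & forall Q, Omega P S t Q -> vorticity_eq P S (t, Q)].

Definition bounded_by {R : realType} (n : nat) (A : R) (I : set R)
    (P : params R) (S : flow R) : Prop :=
  forall t, I t ->
    [/\ (Hnorm2 sq1 n (zeta S) t <= A%:E)%E,
        (Hnorm2 sq2 n (Upar S) t <= A%:E)%E,
        (Hnorm3 sq3 n (Omega P S t) (omega S) t <= A%:E)%E,
        (Hnorm2 sq2 n (Vbar P S) t <= A%:E)%E
      & (Hnorm3 sq3 n (Omega P S t) (velU S) t <= A%:E)%E] /\
    [/\ (Hnorm2 sq1 n (dt2 (zeta S)) t <= A%:E)%E,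
        (Hnorm2 sq2 n (dt2 (Upar S)) t <= A%:E)%E,
        (Hnorm3 sq3 n (Omega P S t) (dt3 (omega S)) t <= A%:E)%E
      & (Hnorm3 sq3 n (Omega P S t) (dt3 (velU S)) t <= A%:E)%E].

Definition nondecreasing4 {R : realType} (C : R -> R -> R -> R -> R) : Prop :=
  forall a a' b b' c c' d d', a <= a' -> b <= b' -> c <= c' -> d <= d' ->
    C a b c d <= C a' b' c' d'.

(* Res = O(mu^a): n and C depend only on s and on the expression Res.  The time
   interval may be open or closed, but is not reduced to a point. *)
Definition isO_boussi {R : realType} {W : normedModType R} (q : W -> R)
    (a : nat) (Res : params R -> flow R -> sp2 R -> W) : Prop :=
  forall s : nat, exists (n : nat) (C : R -> R -> R -> R -> R),
    nondecreasing4 C /\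
    forall (mu0 M hmin A : R) (I : set R) (P : params R) (S : flow R),
      0 < mu0 -> 0 < hmin ->
      is_interval I -> (exists t1 t2, [/\ I t1, I t2 & t1 < t2]) ->
      A_boussi mu0 M P -> castro_lannes hmin I P S ->
      bounded_by n A I P S ->
      forall t, I t ->
        (Hnorm2 q s (Res P S) t <= (C A mu0 hmin^-1 M * mu P ^+ a)%:E)%E.

Definition boussinesq_mass {R : realType} (P : params R) (z : sp2 R -> R)
    (V : sp2 R -> vec2 R) (p : sp2 R) : R :=
  dt2 z p + divg (gam P) (fun r => (1 + eps P * z r) *: V r) p.

Definition boussinesq_momentum {R : realType} (P : params R) (z : sp2 R -> R)
    (V : sp2 R -> vec2 R) (p : sp2 R) : vec2 R :=
  (dt2 V p - (mu P / 3) *: grad (gam P) (divg (gam P) (dt2 V)) p)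
  + grad (gam P) z p + eps P *: adv2 (gam P) V V p
  + (eps P / Ro P) *: perp (V p).

(* Main.v *)
Require Import Defs.
From HB Require Import structures.
From mathcomp Require Import all_boot all_order all_algebra.
From mathcomp Require Import all_classical all_reals all_analysis.
From mathcomp Require Import measurable_realfun ring lra.

Set Implicit Arguments.
Unset Strict Implicit.
Unset Printing Implicit Defensive.

Import Order.TTheory GRing.Theory Num.Theory numFieldNormedType.Exports.

Local Open Scope classical_set_scope.
Local Open Scope ring_scope.

(* In the fluid the vorticity equation says that
     E = d_t V + eps V.grad V + (eps/mu) w d_z V + (eps/Ro) V^perp
   satisfies d_z E = grad (d_t w + eps V.grad w + (eps/mu) w d_z w), where grad
   stands for nabla^gamma, and the equation for U_// together with the kinematic
   condition says that E + grad zeta = O(mu^2) at the free surface.  Incompressibility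
   gives w = O(mu) and d_t w = - mu (z + 1) div (d_t Vbar) + O(mu^2), and the curl
   equations give d_z V = O(sqrt mu), hence V - Vbar = O(sqrt mu).  Integrating
   d_z E down from the surface and averaging over the depth produces the
   dispersive term (mu/3) grad div (d_t Vbar), the 1/3 being 1/2 - 1/6; the average of
   E itself is d_t Vbar + eps Vbar.grad Vbar + (eps/Ro) Vbar^perp up to eps times
   products of two quantities O(sqrt mu), that is O(mu^2).  The mass equation
   holds exactly.

   All estimates are made in the flattened coordinate th = (z + 1) / (1 + eps zeta),
   uniformly over all solutions, with nu = sqrt mu as the small parameter. *)

(** The delicate point is the accuracy of d_t w. With d_z V = O(sqrt mu) alone, d_t V would differ
    from its mean by O(sqrt mu), and the formula for d_t w would carry an error O(mu^(3/2)). The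
    gain comes from the vorticity equation: eps/mu and eps/(Ro sqrt mu) are bounded, w = O(mu) and
    d_z V = O(sqrt mu), so the horizontal part of d_t omega is O(sqrt mu). The curl equations
    differentiated in time then give d_t d_z V = O(mu), and the error in d_t w is O(mu^2).

    In the average of E, terms linear in V - Vbar have mean zero, and the vertical transport
    relative to the moving levels is eps d_z V times a quantity that vanishes when V does not depend
    on z.

    For uniformity, every quantity is a function of a record [data], and all constants are powers of
    one number [kap]. The class [O b k] is closed under sums, products, derivatives, averages and
    primitives, so the order of a remainder is read off its expression. The equations hold only
    inside the fluid and on a time interval that may be closed; identities are therefore
    differentiated along one-sided time steps and extended to the boundary levels by continuity. *)

Section Arith.
Variable R : realType.
Implicit Types x y z w e : R.
Lemma subr_exchange x y z w : x - y - (z - w) = x - z - (y - w).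
Proof. ring. Qed.
Lemma dist_half z x y e : `|x - z| <= e / 2 -> `|y - z| <= e / 2 -> `|x - y| <= e.
Proof.
move=> xz yz; have -> : x - y = (x - z) - (y - z) by ring.
by rewrite (le_trans (ler_normB _ _))// (le_trans (lerD xz yz))//; lra.
Qed.
End Arith.

(** * Mean values along lines and symmetry of mixed derivatives *)

Section Calculus.
Variables (R : realType) (E : normedModType R).
Implicit Types (f : E -> R) (p v : E).

Lemma is_derive_line f p v (c d : R) :
  is_derive (c *: v + p) v f d -> is_derive c 1 (fun r : R => f (r *: v + p)) d.
Proof.
move=> [df <-].
have e : (fun h : R => h^-1 *: (f ((h *: 1 + c) *: v + p) - f (c *: v + p)))
   = (fun h : R => h^-1 *: (f (h *: v + (c *: v + p)) - f (c *: v + p))).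
  by apply/funext => h; rewrite scalerDl [h *: 1]mulr1 addrA.
by apply: DeriveDef; rewrite /derivable /derive /= e.
Qed.

Lemma near_line p v (P : E -> Prop) : (\forall q \near p, P q) ->
  exists2 e : R, 0 < e & forall h, `|h| < e -> P (h *: v + p).
Proof.
(* The [+ 1] covers [v = 0]. *)
move=> /nbhs_ballP[e /= e0 Pe]; exists (e / (`|v| + 1)).
  by rewrite divr_gt0// ltr_wpDl.
move=> h he; apply: Pe; rewrite -ball_normE /= opprD addrCA subrr addr0 normrN normrZ.
move: he; rewrite ltr_pdivlMr ?ltr_wpDl// => /le_lt_trans; apply.
by rewrite ler_pM// lerDl.
Qed.

(** Restriction to the line through [p] gives the one-variable mean value theorem, on [[0, h]] or
    [[h, 0]]; bounding the absolute value of [c] states both signs of [h] at once. *)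
Lemma mvt_line f (D : E -> R) p v (h : R) :
  (forall c : R, `|c| <= `|h| -> is_derive (c *: v + p) v f (D (c *: v + p))) ->
  exists2 c : R, `|c| <= `|h| & f (h *: v + p) - f p = h * D (c *: v + p).
Proof.
move=> df; pose F r := f (r *: v + p).
have dF (c : R) : `|c| <= `|h| -> is_derive c 1 F (D (c *: v + p)).
  by move=> ch; apply: is_derive_line; exact: df.
have cF (c : R) : `|c| <= `|h| -> {for c, continuous F}.
  move=> /dF [dc _]; apply: differentiable_continuous.
  exact/derivable1_diffP.
have [h0|h0] := leP 0 h.
  have [c] : exists2 c : R, c \in `[0, h] & F h - F 0 = D (c *: v + p) * (h - 0).
    apply: (@MVT_segment _ F (fun c => D (c *: v + p))) => // [c|].
      rewrite in_itv/= => /andP[c0 ch]; apply: dF.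
      by rewrite !ger0_norm// ltW.
    apply: continuous_in_subspaceT => c; rewrite inE/= in_itv/= => /andP[c0 ch].
    by apply: cF; rewrite !ger0_norm.
  rewrite in_itv/= => /andP[c0 ch]; rewrite /F subr0 scale0r add0r => ->.
  by exists c; [rewrite !ger0_norm|rewrite mulrC].
have [c] : exists2 c : R, c \in `[h, 0] & F 0 - F h = D (c *: v + p) * (0 - h).
  apply: (@MVT_segment _ F (fun c => D (c *: v + p))); [exact: ltW|move=> c|].
    rewrite in_itv/= => /andP[c0 ch]; apply: dF.
    by rewrite !ler0_norm ?lerN2// ltW.
  apply: continuous_in_subspaceT => c; rewrite inE/= in_itv/= => /andP[c0 ch].
  by apply: cF; rewrite !ler0_norm ?lerN2// ltW.
rewrite in_itv/= => /andP[c0 ch] e; exists c.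
  by rewrite !ler0_norm ?lerN2// ltW.
by move: e; rewrite /F scale0r add0r; lra.
Qed.

(* Second differences equal [h^2] times a value of either mixed derivative. *)
Lemma second_difference f p (u v : E) (h : R) :
  (forall a b, `|a| <= `|h| -> `|b| <= `|h| ->
     derivable f (a *: u + (b *: v + p)) u /\
     derivable ('D_u f) (a *: u + (b *: v + p)) v) ->
  exists a b, [/\ `|a| <= `|h|, `|b| <= `|h| &
    f (h *: u + (h *: v + p)) - f (h *: v + p) - (f (h *: u + p) - f p)
    = h * h * 'D_v ('D_u f) (a *: u + (b *: v + p))].
Proof.
move=> H.
pose g q := f (h *: v + q) - f q.
have [a ah ga] : exists2 a, `|a| <= `|h| &
    g (h *: u + p) - g p =
    h * ('D_u f (h *: v + (a *: u + p)) - 'D_u f (a *: u + p)).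
  apply: (@mvt_line g (fun q => 'D_u f (h *: v + q) - 'D_u f q)) => a ah.
  have d0 : is_derive (a *: u + p) u f ('D_u f (a *: u + p)).
    have n0 : `|0 : R| <= `|h| by rewrite normr0.
    have [dd _] := H a 0 ah n0.
    by apply: derivableP; rewrite -[X in a *: u + X]add0r -[X in X + p](scale0r v).
  have d1 : is_derive (a *: u + p) u (fun q => f (h *: v + q))
      ('D_u f (h *: v + (a *: u + p))).
    have [+ _] := H a h ah (lexx _) => /derivableP [d e].
    have E1 : (fun k : R => k^-1 *: (f (h *: v + (k *: u + (a *: u + p)))
        - f (h *: v + (a *: u + p)))) =
      (fun k : R => k^-1 *: (f (k *: u + (a *: u + (h *: v + p)))
        - f (a *: u + (h *: v + p)))).
      by apply/funext => k; do !congr (_ *: (f _ - f _));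
         rewrite addrCA// (addrCA (h *: v)).
    apply: DeriveDef; first by rewrite /derivable /= E1; exact: d.
    by rewrite /derive /= E1 (addrCA (h *: v)).
  exact: is_deriveB.
have [b bh gb] : exists2 b, `|b| <= `|h| &
    'D_u f (h *: v + (a *: u + p)) - 'D_u f (a *: u + p)
      = h * 'D_v ('D_u f) (b *: v + (a *: u + p)).
  apply: (@mvt_line ('D_u f) ('D_v ('D_u f))) => b bh; apply: derivableP.
  by have [_] := H a b ah bh; rewrite addrCA.
exists a, b; split; [exact: ah|exact: bh|].
rewrite [a *: u + _]addrCA -mulrA -gb -ga /g (addrCA (h *: v)).
set A := f _; set B := f _; set C := f _; set D := f _.
lra.
Qed.

(** One and the same second difference, divided by [h * h], is a value of either mixed derivative,
    each at its own point near [p]; continuity at [p] then makes the two derivatives [e]-close for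
    every [e]. *)
Lemma schwarz f p (u v : E) :
  (\forall q \near p, [/\ derivable f q u, derivable f q v,
     derivable ('D_u f) q v & derivable ('D_v f) q u]) ->
  {for p, continuous ('D_v ('D_u f))} -> {for p, continuous ('D_u ('D_v f))} ->
  'D_v ('D_u f) p = 'D_u ('D_v f) p.
Proof.
move=> H c1 c2.
apply/eqP; rewrite -subr_eq0 -normr_le0; apply/ler_addgt0Pl => e e0; rewrite addr0.
have e2 : 0 < e / 2 by rewrite divr_gt0.
have [Q [Q0 QH]] : exists r : R, 0 < r /\ forall q, `|q| < r ->
   [/\ derivable f (q + p) u, derivable f (q + p) v,
     derivable ('D_u f) (q + p) v & derivable ('D_v f) (q + p) u] /\
   `|'D_v ('D_u f) p - 'D_v ('D_u f) (q + p)| <= e / 2 /\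
   `|'D_u ('D_v f) p - 'D_u ('D_v f) (q + p)| <= e / 2.
  have /nbhs_ballP[r /= r0 rH] : \forall q \near p,
   [/\ derivable f q u, derivable f q v,
     derivable ('D_u f) q v & derivable ('D_v f) q u] /\
   `|'D_v ('D_u f) p - 'D_v ('D_u f) q| <= e / 2 /\
   `|'D_u ('D_v f) p - 'D_u ('D_v f) q| <= e / 2.
    move/cvgrPdist_le : c1 => /(_ _ e2) c1; move/cvgrPdist_le : c2 => /(_ _ e2) c2.
    apply: filterS (filterI H (filterI c1 c2)) => q [h0 [h1 h2]].
    by split; [exact: h0|split; [exact: h1|exact: h2]].
  exists r; split; [exact: r0|move=> q qr; apply: rH].
  by rewrite -ball_normE /= opprD addrCA subrr addr0 normrN.
(* Small enough for every intermediate point of the second difference to stay in the ball of radius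
   [Q]; the half makes the inequality strict. *)
pose h := Q / (`|u| + `|v| + 1) / 2.
have uv0 : 0 < `|u| + `|v| + 1 by rewrite ltr_wpDl// addr_ge0.
have h0 : 0 < h by rewrite !divr_gt0.
have small a b : `|a| <= `|h| -> `|b| <= `|h| -> `|a *: u + b *: v| < Q.
  rewrite (gtr0_norm h0) => ah bh; apply: (le_lt_trans (ler_normD _ _)).
  rewrite !normrZ; apply: (@le_lt_trans _ _ (h * (`|u| + `|v| + 1))).
    rewrite mulrDr mulrDr mulr1 -addrA lerD// ?ler_wpM2r// -[leLHS]addr0 lerD// ?ler_wpM2r//.
    exact: ltW.
  by rewrite /h mulrAC divfK ?gt_eqF// ltr_pdivrMr// ltr_pMr// ltr1n.
clearbody h.
have [a [b [ah bh E1]]] : exists a b, [/\ `|a| <= `|h|, `|b| <= `|h| &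
    f (h *: u + (h *: v + p)) - f (h *: v + p) - (f (h *: u + p) - f p)
    = h * h * 'D_v ('D_u f) (a *: u + (b *: v + p))].
  apply: second_difference => a b ah bh.
  have [[d1 _ d2 _] _] := QH _ (small _ _ ah bh).
  by rewrite addrA; split; [exact: d1|exact: d2].
have [a' [b' [ah' bh' E2]]] : exists a b, [/\ `|a| <= `|h|, `|b| <= `|h| &
    f (h *: v + (h *: u + p)) - f (h *: u + p) - (f (h *: v + p) - f p)
    = h * h * 'D_u ('D_v f) (a *: v + (b *: u + p))].
  apply: second_difference => a' b' ah' bh'.
  have [[_ d1 _ d2] _] := QH _ (small _ _ bh' ah').
  by rewrite addrA [a' *: v + _]addrC; split; [exact: d1|exact: d2].
(* Exchanging [u] and [v] only swaps the two middle terms of the second difference. *)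
have E3 : 'D_v ('D_u f) (a *: u + (b *: v + p)) = 'D_u ('D_v f) (a' *: v + (b' *: u + p)).
  apply: (@mulfI _ (h * h)); first by rewrite mulf_neq0// gt_eqF.
  apply: etrans (esym E1) _; apply: etrans _ E2.
  by rewrite -(addrCA (h *: u)); exact: subr_exchange.
have [_ [A1 _]] := QH _ (small _ _ ah bh).
have [_ [_ A2]] := QH _ (small _ _ bh' ah').
have E4 : (b' *: u + a' *: v) + p = a' *: v + (b' *: u + p) by rewrite -addrA addrCA.
apply: (@dist_half R ('D_u ('D_v f) (a' *: v + (b' *: u + p)))).
  by rewrite -E3 addrA; exact: A1.
by rewrite -E4; exact: A2.
Qed.

End Calculus.

(** * Integrals over a segment and the one-dimensional Sobolev inequality *)

Section Segment.
Variable R : realType.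
Implicit Types (a b c : R) (f g : R -> R).

Definition J a b g : R := \int[lebesgue_measure]_(s in `[a, b]) g s.

Lemma J_integrable a b g : continuous g ->
  lebesgue_measure.-integrable `[a, b] (EFin \o g).
Proof.
move=> cg; apply: continuous_compact_integrable; first exact: segment_compact.
exact: continuous_subspaceT.
Qed.

Let meas a b : measurable (`[a, b]%classic : set (measurableTypeR R)).
Proof. exact: measurable_itv. Qed.

Lemma J_eq a b f g : (forall s, a <= s <= b -> f s = g s) -> J a b f = J a b g.
Proof. by move=> fg; apply: eq_Rintegral => s; rewrite inE/= in_itv/= => /fg. Qed.

Lemma JD a b f g : continuous f -> continuous g ->
  J a b (fun s => f s + g s) = J a b f + J a b g.
Proof. by move=> cf cg; rewrite /J RintegralD//; exact: J_integrable. Qed.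

Lemma JB a b f g : continuous f -> continuous g ->
  J a b (fun s => f s - g s) = J a b f - J a b g.
Proof. by move=> cf cg; rewrite /J RintegralB//; exact: J_integrable. Qed.

Lemma JZ a b k f : continuous f -> J a b (fun s => k * f s) = k * J a b f.
Proof. by move=> cf; rewrite /J RintegralZl//; exact: J_integrable. Qed.

Lemma J_cst a b k : a <= b -> J a b (fun=> k) = k * (b - a).
Proof.
rewrite le_eqVlt => /orP[/eqP->|ab].
  by rewrite /J set_itv1 Rintegral_set1 subrr mulr0.
by rewrite /J Rintegral_cst//= lebesgue_measure_itv/= lte_fin ab.
Qed.

Lemma J_le a b f g : continuous f -> continuous g ->
  (forall s, a <= s <= b -> f s <= g s) -> J a b f <= J a b g.
Proof.
move=> cf cg fg; apply: le_Rintegral => //; exact: J_integrable.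
Qed.

Lemma J_ge0 a b f : (forall s, a <= s <= b -> 0 <= f s) -> 0 <= J a b f.
Proof. by move=> f0; apply: Rintegral_ge0 => s; rewrite /= in_itv/=; exact: f0. Qed.

Lemma J_EFin a b f : continuous f ->
  (\int[lebesgue_measure]_(s in `[a, b]) (f s)%:E = (J a b f)%:E)%E.
Proof.
move=> cf; rewrite /J /Rintegral fineK//.
exact/integrable_fin_num/J_integrable.
Qed.

Lemma J_sub a b c e f : a <= c -> e <= b -> continuous f -> (forall s, 0 <= f s) ->
  J c e f <= J a b f.
Proof.
move=> ac eb cf f0; rewrite -lee_fin -!J_EFin//; apply: ge0_subset_integral => //.
- apply/measurable_EFinP; apply: measurable_funTS.
  exact: continuous_measurable_fun.
- by move=> s _; rewrite lee_fin.
by apply: subset_itvScc; rewrite bnd_simp.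
Qed.

(** The derivative is asked strictly inside only, because the clamped functions to which this is
    applied have corners at the end points. *)
Lemma J_FTC a b f g : a <= b -> continuous f -> continuous g ->
  (forall s, a < s < b -> is_derive s 1 f (g s)) -> J a b g = f b - f a.
Proof.
rewrite le_eqVlt => /orP[/eqP -> _ _ _|ab cf cg fg].
  by rewrite /J set_itv1 Rintegral_set1 subrr.
apply: EFin_inj; rewrite -J_EFin// EFinB.
apply: continuous_FTC2 => //; first exact: continuous_subspaceT.
  split.
  - by move=> s; rewrite in_itv/= => /fg [].
  - exact/cvg_at_right_filter/cf.
  - exact/cvg_at_left_filter/cf.
by move=> s; rewrite in_itv/= => /fg H; rewrite derive1E derive_val.
Qed.

Lemma cM (T : topologicalType) (f g : T -> R) :
  continuous f -> continuous g -> continuous (fun x => f x * g x).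
Proof. by move=> cf cg x; apply: cvgM; [exact: cf|exact: cg]. Qed.
Lemma cD (T : topologicalType) (f g : T -> R) :
  continuous f -> continuous g -> continuous (fun x => f x + g x).
Proof. by move=> cf cg x; apply: cvgD; [exact: cf|exact: cg]. Qed.
Lemma cC (T : topologicalType) (k : R) : continuous (fun _ : T => k).
Proof. by move=> x; exact: cvg_cst. Qed.

(** Cauchy-Schwarz against the constant 1: the integral of the square of [f] minus its mean is
    nonnegative. *)
Lemma J_sqr a b f : a <= b -> continuous f ->
  J a b f ^+ 2 <= (b - a) * J a b (fun s => f s ^+ 2).
Proof.
rewrite le_eqVlt => /orP[/eqP -> _|ab cf].
  by rewrite /J set_itv1 !Rintegral_set1 expr0n/= mulr0.
have l0 : 0 < b - a by rewrite subr_gt0.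
set m := J a b f.
have : 0 <= J a b (fun s => (f s * f s + (- (2 * m / (b - a))) * f s) + (m / (b - a)) ^+ 2).
  apply: J_ge0 => s _; have := sqr_ge0 (f s - m / (b - a)).
  by rewrite !expr2; lra.
have cff := cM cf cf; have cf2 : continuous (fun s => - (2 * m / (b - a)) * f s).
  exact: cM (@cC _ _) cf.
rewrite !JD//; [|exact: cD|exact: cC].
rewrite JZ// J_cst ?(ltW ab)// -/m => H.
have e : J a b (fun s => f s ^+ 2) = J a b (fun s => f s * f s).
  by apply: J_eq => s _; rewrite expr2.
move: (mulr_ge0 (ltW l0) H); rewrite {}e; move: (J a b _) => q.
have -> : (b - a) * (q + - (2 * m / (b - a)) * m + (m / (b - a)) ^+ 2 * (b - a)) =
   (b - a) * q - m ^+ 2 by field; rewrite gt_eqF.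
by rewrite subr_ge0.
Qed.

(** Integrating [2 f g] between [y] and [x] bounds [f x ^+ 2 - f y ^+ 2] by [J a b q]; averaging
    over [y] concludes. The 2 collects one [1 / (b - a)] from this average and one from Young's
    inequality. The dependence on the length is explicit because the segment will be a water
    column. *)
Lemma sobolev1 a b f g x : a < b -> continuous f -> continuous g ->
  (forall s, a < s < b -> is_derive s 1 f (g s)) -> a <= x <= b ->
  f x ^+ 2 <= 2 / (b - a) * J a b (fun s => f s ^+ 2)
     + (b - a) * J a b (fun s => g s ^+ 2).
Proof.
move=> ab cf cg fg /andP[ax xb].
have l0 : 0 < b - a by rewrite subr_gt0.
have li0 : 0 <= (b - a)^-1 by rewrite invr_ge0 (ltW l0).
(* Young's inequality with weights matched to the length, so that [q] dominates [2 f g] with either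
   sign. *)
pose q s := (b - a)^-1 * (f s * f s) + (b - a) * (g s * g s).
have cff := cM cf cf; have cgg := cM cg cg; have cfg := cM cf cg.
have cq1 := cM (@cC _ (b - a)^-1) cff; have cq2 := cM (@cC _ (b - a)) cgg.
have cq : continuous q := cD cq1 cq2.
have q0 s : 0 <= q s.
  rewrite addr_ge0//.
    by rewrite mulr_ge0// -expr2 sqr_ge0.
  by rewrite mulr_ge0 ?(ltW l0)// -expr2 sqr_ge0.
have c2fg : continuous (fun s => 2 * (f s * g s)) := cM (@cC _ 2) cfg.
have qfg s : - q s <= 2 * (f s * g s) <= q s.
  have K1 : 0 <= (b - a)^-1 * (f s + (b - a) * g s) ^+ 2 by rewrite mulr_ge0// sqr_ge0.
  have K2 : 0 <= (b - a)^-1 * (f s - (b - a) * g s) ^+ 2 by rewrite mulr_ge0// sqr_ge0.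
  have E1 : (b - a)^-1 * (f s + (b - a) * g s) ^+ 2 = q s + 2 * (f s * g s).
    by rewrite /q; field; rewrite gt_eqF.
  have E2 : (b - a)^-1 * (f s - (b - a) * g s) ^+ 2 = q s - 2 * (f s * g s).
    by rewrite /q; field; rewrite gt_eqF.
  by move: K1 K2; rewrite E1 E2; lra.
have dff s : a < s < b -> is_derive s 1 (fun s => f s * f s) (2 * (f s * g s)).
  move=> /fg d; have d2 : is_derive s 1 (f * f) (f s *: g s + f s *: g s) by exact: is_deriveM.
  by apply: is_derive_eq; rewrite ![_ *: _]mulrC; lra.
have H y : a <= y <= b -> f x * f x - f y * f y <= J a b q.
  move=> /andP[ay yb]; have [xy|/ltW yx] := leP x y.
    have e : J x y (fun s => 2 * (f s * g s)) = f y * f y - f x * f x.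
      apply: (@J_FTC x y (fun s => f s * f s)) => // s /andP[xs sy].
      by apply: dff; rewrite (le_lt_trans ax xs) (lt_le_trans sy yb).
    have : J x y (fun s => -1 * q s) <= J x y (fun s => 2 * (f s * g s)).
      apply: J_le => // [|s _]; first exact: cM (@cC _ _) cq.
      by have /andP[] := qfg s; rewrite mulN1r.
    rewrite (JZ _ _ (-1))// mulN1r e => h.
    by have := @J_sub a b x y q ax yb cq q0; lra.
  have e : J y x (fun s => 2 * (f s * g s)) = f x * f x - f y * f y.
    apply: (@J_FTC y x (fun s => f s * f s)) => // s /andP[xs sy].
    by apply: dff; rewrite (le_lt_trans ay xs) (lt_le_trans sy xb).
  have : J y x (fun s => 2 * (f s * g s)) <= J y x q.
    by apply: J_le => // s _; have /andP[] := qfg s.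
  by rewrite e => h; have := @J_sub a b y x q ay xb cq q0; lra.
have : J a b (fun s => f x * f x) <= J a b (fun s => f s * f s + J a b q).
  apply: J_le; [exact: cC|exact: cD (@cC _ _)|move=> s /H; lra].
rewrite JD//; last exact: cC.
rewrite !J_cst ?(ltW ab)// /q JD// !JZ// => K.
have sq h : J a b (fun s => h s ^+ 2) = J a b (fun s => h s * h s).
  by apply: J_eq => s _; rewrite expr2.
rewrite !sq; move: K; set X := J a b _; set Y := J a b _ => K.
rewrite -(ler_pM2r l0) expr2 (le_trans K)// le_eqVlt; apply/orP; left; apply/eqP.
by field; rewrite gt_eqF.
Qed.

End Segment.

(** * Integrals depending on a parameter *)

Section Param.
Variable R : realType.

(** Tube lemma: compactness of the segment yields one neighbourhood of [p] that is good for all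
    [s]. *)
Lemma near_segment (T : topologicalType) (P : R -> T -> Prop) (a b : R) (p : T) :
  (forall s, a <= s <= b -> \forall q \near (s, p), P q.1 q.2) ->
  \forall q \near p, forall s, a <= s <= b -> P s q.
Proof.
move=> H; have /compact_near_coveringP K := @segment_compact R a b.
have := K T (nbhs p) (fun q s => P s q) (nbhs_filter p).
have Hs s : `[a, b]%classic s -> \forall x \near s & q \near p, P x q.
  by rewrite /= in_itv/= => /H.
by move=> /(_ Hs); apply: filterS => q Hq s sab; apply: Hq; rewrite /= in_itv.
Qed.

Lemma near_dist (T : topologicalType) (G : R -> T -> R) (s : R) (p : T) (e : R) :
  0 < e -> {for (s, p), continuous (fun q : R * T => G q.1 q.2)} ->
  \forall q \near (s, p), `|G q.1 p - G q.1 q.2| < e.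
Proof.
move=> e0 /cvgrPdist_lt cG.
have e2 : 0 < e / 2 by rewrite divr_gt0.
have [[A B] /= [As Bp] AB] := cG _ e2.
exists (A, B) => // -[x q] /= [Ax Bq].
have h1 := AB (x, q) (conj Ax Bq); have h2 := AB (x, p) (conj Ax (nbhs_singleton Bp)).
rewrite /= in h1 h2; rewrite [ltRHS]splitr.
have -> : G x p - G x q = (G s p - G x q) - (G s p - G x p) by ring.
by rewrite (le_lt_trans (ler_normB _ _))// ltrD.
Qed.

Lemma near_unif (T : topologicalType) (G : R -> T -> R) (a b : R) (p : T) (e : R) :
  0 < e ->
  (forall s, a <= s <= b -> {for (s, p), continuous (fun q : R * T => G q.1 q.2)}) ->
  \forall q \near p, forall s, a <= s <= b -> `|G s p - G s q| < e.
Proof. by move=> e0 cG; apply: near_segment => s /cG; exact: near_dist. Qed.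

Lemma J_dist (a b e : R) (f g : R -> R) : a <= b -> continuous f -> continuous g ->
  (forall s, a <= s <= b -> `|f s - g s| <= e) -> `|J a b f - J a b g| <= e * (b - a).
Proof.
move=> ab cf cg fg; rewrite -JB// -J_cst// ler_norml.
have cB : continuous (fun s => f s - g s).
  by move=> s; apply: cvgB; [exact: cf|exact: cg].
have -> : - J a b (fun=> e) = J a b (fun=> - e) by rewrite !J_cst// mulNr.
apply/andP; split; (apply: J_le => //; first exact: cC) || (apply: J_le => //; last exact: cC).
all: by move=> s /fg; rewrite ler_norml => /andP[].
Qed.

Lemma J_continuous (T : topologicalType) (G : R -> T -> R) (a b : R) (p : T) :
  a <= b ->
  (forall s, a <= s <= b -> {for (s, p), continuous (fun q : R * T => G q.1 q.2)}) ->
  (\forall q \near p, continuous (G^~ q)) ->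
  {for p, continuous (fun q => J a b (G^~ q))}.
Proof.
move=> ab cG cs; apply/cvgrPdist_le => e e0.
have e1 : 0 < e / (b - a + 1) by rewrite divr_gt0// ltr_wpDl// subr_ge0.
have csp := nbhs_singleton cs.
apply: filterS (filterI cs (near_unif e1 cG)) => q [cq H].
apply: (@le_trans _ _ (e / (b - a + 1) * (b - a))).
  by apply: J_dist => // s /H/ltW.
rewrite mulrAC ler_pdivrMr ?ltr_wpDl ?subr_ge0//.
by rewrite ler_pM2l// lerDl.
Qed.

(** The mean value theorem turns the difference quotient into [D s] at a nearby point, and
    compactness makes this close to [D s p] uniformly in [s]; uniform convergence takes the place of
    domination. *)
Lemma J_is_derive (E : normedModType R) (G D : R -> E -> R) (a b : R) (p v : E) :
  a <= b ->
  (\forall q \near p, forall s, a <= s <= b -> is_derive q v (G s) (D s q)) ->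
  (\forall q \near p, continuous (G^~ q)) -> continuous (D^~ p) ->
  (forall s, a <= s <= b -> {for (s, p), continuous (fun q : R * E => D q.1 q.2)}) ->
  is_derive p v (fun q => J a b (G^~ q)) (J a b (D^~ p)).
Proof.
move=> ab dG cG cDp cD.
have H : h^-1 *: (J a b (G^~ (h *: v + p)) - J a b (G^~ p)) @[h --> 0^'] --> J a b (D^~ p).
  apply/cvgrPdist_le => e e0.
  have e1 : 0 < e / (b - a + 1) by rewrite divr_gt0// ltr_wpDl// subr_ge0.
  have [r r0 Hr] := near_line v (filterI cG (filterI dG (near_unif e1 cD))).
  have cGp := nbhs_singleton cG.
  have N : \forall h \near (0 : R)^', `|h| < r by exact: dnbhs0_lt.
  have N0 : \forall h \near (0 : R)^', h != 0 by exact: nbhs_dnbhs_neq.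
  apply: filterS (filterI N N0) => h [hr h0].
  have [cGh _] := Hr h hr.
  have cB : continuous (fun s => G s (h *: v + p) - G s p).
    by move=> s; apply: cvgB; [exact: cGh|exact: cGp].
  rewrite -JB// -[_ *: _]/(_ * _) -JZ//.
  apply: (@le_trans _ _ (e / (b - a + 1) * (b - a))).
    apply: J_dist => // [|s sab]; first exact: cM (@cC _ _ _) cB.
    have [c ch ->] : exists2 c : R, `|c| <= `|h| & G s (h *: v + p) - G s p = h * D s (c *: v + p).
      by apply: mvt_line => c ch; have [_ [+ _]] := Hr c (le_lt_trans ch hr); exact.
    rewrite mulKf//; have [_ [_ +]] := Hr c (le_lt_trans ch hr) => /(_ s sab).
    exact: ltW.
  rewrite mulrAC ler_pdivrMr ?ltr_wpDl ?subr_ge0//.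
  by rewrite ler_pM2l// lerDl.
apply: DeriveDef; first exact/cvgP/H.
exact/cvg_lim/H.
Qed.

Lemma near_all (T : topologicalType) (P : T -> Prop) (p : T) :
  (forall q, P q) -> \forall q \near p, P q.
Proof. by move=> H; exact: nearW. Qed.

Lemma cont_pair (T U V : topologicalType) (f : T -> U) (g : T -> V) (x : T) :
  {for x, continuous f} -> {for x, continuous g} -> {for x, continuous (fun y => (f y, g y))}.
Proof. by move=> cf cg; exact: (cvg_pair cf cg). Qed.

Lemma cont_comp2 (T U V W : topologicalType) (F : U -> V -> W) (f : T -> U) (g : T -> V) (x : T) :
  {for (f x, g x), continuous (fun p => F p.1 p.2)} ->
  {for x, continuous f} -> {for x, continuous g} ->
  {for x, continuous (fun y => F (f y) (g y))}.
Proof.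
move=> cF cf cg.
exact: (@continuous_comp _ _ _ (fun y => (f y, g y)) (fun p => F p.1 p.2) x (cont_pair cf cg)).
Qed.

Lemma cont_id (T : topologicalType) (x : T) : {for x, continuous (fun y : T => y)}.
Proof. exact: cvg_id. Qed.
Lemma cont_cst (T U : topologicalType) (u : U) (x : T) : {for x, continuous (fun=> u)}.
Proof. exact: cvg_cst. Qed.
Lemma cont_fst (T U : topologicalType) (x : T * U) : {for x, continuous (@fst T U)}.
Proof. exact: cvg_fst. Qed.
Lemma cont_snd (T U : topologicalType) (x : T * U) : {for x, continuous (@snd T U)}.
Proof. exact: cvg_snd. Qed.

End Param.

(** * Open sets and continuous functions are measurable for the product sigma-algebra *)

Section Measurability.
Variable R : realType.

(** A countable network of measurable sets, whose members around [x] need not be open. This suffices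
    to write an open set as a countable union of measurable ones, which links the product topology
    to the product sigma-algebra. *)
Definition countably_based (T : topologicalType) (meas : set T -> Prop) :=
  exists B : nat -> set T, (forall n, meas (B n)) /\
    forall x U, nbhs x U -> exists n, B n x /\ B n `<=` U.

Lemma countably_based_real :
  @countably_based R (fun A => measurable (A : set (measurableTypeR R))).
Proof.
pose B n : set R := if unpickle n is Some (q1, q2) then
  `[ratr (q1 : rat), ratr (q2 : rat)]%classic else set0.
exists B; split=> [n|x U /nbhs_ballP[e /= e0 eU]].
  by rewrite /B; case: unpickle => [[q1 q2]|]; [exact: measurable_itv|exact: measurable0].
have [q1] := @rat_in_itvoo R (x - e) x ltac:(by rewrite ltrBlDr ltrDl).
rewrite in_itv/= => /andP[h1 h2].
have [q2] := @rat_in_itvoo R x (x + e) ltac:(by rewrite ltrDl).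
rewrite in_itv/= => /andP[h3 h4].
exists (pickle (q1, q2)); rewrite /B pickleK; split => /=.
  by rewrite in_itv/= !ltW.
move=> y; rewrite /= in_itv/= => /andP[h5 h6]; apply: eU.
rewrite -ball_normE /= ltr_norml.
by apply/andP; split; lra.
Qed.

Lemma countably_based_prod (T1 T2 : topologicalType) (m1 : set T1 -> Prop)
    (m2 : set T2 -> Prop) (m : set (T1 * T2) -> Prop) :
  (forall A B, m1 A -> m2 B -> m (A `*` B)) ->
  countably_based m1 -> countably_based m2 -> countably_based m.
Proof.
move=> mX [B1 [mB1 b1]] [B2 [mB2 b2]].
exists (fun n => if unpickle n is Some (i, j) then B1 i `*` B2 j else B1 0%N `*` B2 0%N).
split=> [n|[x y] U [[U1 U2] /= [xU1 yU2] UU]].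
  by case: unpickle => [[i j]|]; exact: mX.
have [i [Bi iU]] := b1 _ _ xU1; have [j [Bj jU]] := b2 _ _ yU2.
exists (pickle (i, j)); rewrite pickleK; split=> // -[a b] /= [Ba Bb].
by apply: UU; split; [exact: iU|exact: jU].
Qed.

Let mR2 : @countably_based (R * R)%type
  (fun A => measurable (A : set (measurableTypeR R * measurableTypeR R))).
Proof.
apply: (countably_based_prod _ countably_based_real countably_based_real).
by move=> A B mA mB; exact: measurableX.
Qed.

Let mR3 : @countably_based ((R * R) * R)%type
  (fun A => measurable (A : set ((measurableTypeR R * measurableTypeR R) * measurableTypeR R))).
Proof.
apply: (countably_based_prod _ mR2 countably_based_real).
by move=> A B mA mB; exact: measurableX.
Qed.

Lemma open_countable_union (T : topologicalType) (m : set T -> Prop) (U : set T) :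
  countably_based m -> m set0 -> open U ->
  exists2 F : nat -> set T, (forall n, m (F n)) & U = \bigcup_n F n.
Proof.
move=> [B [mB bB]] m0 oU.
exists (fun n => if pselect (B n `<=` U) then B n else set0).
  by move=> n; case: pselect => [?|?] /=; [exact: mB|exact: m0].
apply/seteqP; split => x.
  move=> Ux; have [n [Bn nU]] := bB _ _ (open_nbhs_nbhs (conj oU Ux)).
  by exists n => //; case: pselect => [?|] /=.
by move=> [n _]; case: pselect => [nU|?] /= => [/nU|].
Qed.

Lemma open_measurable2 (U : set (R * R)) : open U ->
  measurable (U : set (measurableTypeR R * measurableTypeR R)).
Proof.
by move=> /(open_countable_union mR2 measurable0)[F mF ->]; exact: bigcupT_measurable.
Qed.

Lemma open_measurable3 (U : set ((R * R) * R)) : open U ->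
  measurable (U : set ((measurableTypeR R * measurableTypeR R) * measurableTypeR R)).
Proof.
by move=> /(open_countable_union mR3 measurable0)[F mF ->]; exact: bigcupT_measurable.
Qed.

Lemma continuous_measurable2 (f : R * R -> R) : continuous f ->
  measurable_fun [set: measurableTypeR R * measurableTypeR R] f.
Proof.
move=> /continuousP cf; apply: (measurability _ (RGenOpens.measurableE R)).
move=> _ [_ [a [b ->] <-]]; rewrite setTI; apply: open_measurable2.
exact/cf/interval_open.
Qed.

Lemma continuous_measurable3 (f : (R * R) * R -> R) : continuous f ->
  measurable_fun [set: (measurableTypeR R * measurableTypeR R) * measurableTypeR R] f.
Proof.
move=> /continuousP cf; apply: (measurability _ (RGenOpens.measurableE R)).
move=> _ [_ [a [b ->] <-]]; rewrite setTI; apply: open_measurable3.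
exact/cf/interval_open.
Qed.

End Measurability.

(* The library keys the sigma-finite structure of a product measure on products
   of subprobabilities, hence this copy of the plane Lebesgue measure. *)
Definition lebesgue2 (R : realType) : set (measurableTypeR R * measurableTypeR R)%type -> \bar R :=
  (@lebesgue_measure R \x @lebesgue_measure R)%E.

HB.instance Definition _ (R : realType) := Measure.on (@lebesgue2 R).

Lemma sigma_finite_lebesgue2 (R : realType) : sigma_finite setT (@lebesgue2 R).
Proof.
have /sigma_finiteP[F [TF ndF Foo]] := sigma_finiteT (@lebesgue_measure R).
exists (fun n => F n `*` F n).
  rewrite -setXTT TF predeqE => -[x y]; split=> [[/= [n _ Fnx] [k _ Fky]]|].
    exists (maxn n k) => //; split.
    - by move: x Fnx; exact/subsetPset/ndF/leq_maxl.
    - by move: y Fky; exact/subsetPset/ndF/leq_maxr.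
  by move=> [n _ []/= ? ?]; split; exists n.
move=> k; have [mF Fk] := Foo k.
split; first exact: measurableX.
by rewrite /lebesgue2 product_measure1E// lte_mul_pinfty// ge0_fin_numE.
Qed.

HB.instance Definition _ (R : realType) :=
  Measure_isSigmaFinite.Build _ _ _ (@lebesgue2 R) (@sigma_finite_lebesgue2 R).

(** * L^2 norms over the plane *)

Section L2.
Variable R : realType.
Local Notation leb := (@lebesgue_measure R).
Local Notation leb2 := (@lebesgue2 R).
Local Notation leb3 := (@lebesgue2 R \x leb)%E.
Implicit Types (f g F : R * R -> R).

(** Squared and extended-valued, so that no integrability is carried along: finiteness is part of
    each bound. *)
Definition N2 f : \bar R := (\int[leb2]_X (f X ^+ 2)%R%:E)%E.

Lemma measurable_sqr2 f : continuous f ->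
  measurable_fun [set: measurableTypeR R * measurableTypeR R] (fun X => (f X ^+ 2)%R%:E).
Proof.
move=> cf; apply/measurable_EFinP; apply: (@continuous_measurable2 R (fun X => f X ^+ 2)).
by move=> X; apply: cvgM; exact: cf.
Qed.

Let sq0 (T : Type) (f : T -> R) (D : set T) : forall x, D x -> (0 <= (f x ^+ 2)%R%:E)%E.
Proof. by move=> x _; rewrite lee_fin sqr_ge0. Qed.

Lemma N2_mul f g B : continuous f -> continuous g -> (forall X, `|f X| <= B) ->
  (N2 (fun X => (f X * g X)%R) <= (B ^+ 2)%:E * N2 g)%E.
Proof.
move=> cf cg fB; have B2 : 0 <= B ^+ 2 by exact: sqr_ge0.
have cfg : continuous (fun X => f X * g X) by move=> X; apply: cvgM; [exact: cf|exact: cg].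
rewrite /N2 -ge0_integralZl_EFin//; last 2 first.
  exact: sq0.
  exact: measurable_sqr2.
apply: ge0_le_integral => //.
- exact: sq0.
- exact: measurable_sqr2.
- by apply: measurable_funeM; exact: measurable_sqr2.
move=> X _; rewrite -EFinM lee_fin exprMn ler_wpM2r ?sqr_ge0//.
by rewrite -[f X ^+ 2]real_normK ?num_real// lerXn2r ?nnegrE// (le_trans _ (fB X)).
Qed.

Lemma N2_add f g : continuous f -> continuous g ->
  (N2 (fun X => (f X + g X)%R) <= 2%:E * N2 f + 2%:E * N2 g)%E.
Proof.
move=> cf cg.
have cfg : continuous (fun X => f X + g X) by move=> X; apply: cvgD; [exact: cf|exact: cg].
have m2 (h : R * R -> R) : continuous h -> measurable_fun [set: measurableTypeR R * measurableTypeR R]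
     (fun X => (2%:E * (h X ^+ 2)%R%:E)%E).
  by move=> ch; apply: measurable_funeM; exact: measurable_sqr2.
have p2 (h : R * R -> R) X : (0 <= (2 : R)%:E * (h X ^+ 2)%R%:E)%E by rewrite -EFinM lee_fin mulr_ge0// sqr_ge0.
rewrite /N2 -!ge0_integralZl_EFin//; try exact: measurable_sqr2; try exact: sq0.
rewrite -ge0_integralD//; try exact: m2.
apply: ge0_le_integral => //.
- exact: sq0.
- exact: measurable_sqr2.
- by apply: emeasurable_funD; exact: m2.
move=> X _; rewrite -!EFinM -EFinD lee_fin.
have := sqr_ge0 (f X - g X); rewrite !expr2; move: (f X) (g X) => a b; lra.
Qed.

(** Cauchy-Schwarz in [s], then Tonelli, each contributing a factor [b - a]. This is how estimates
    made level by level pass to vertical averages. *)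
Lemma N2_J (F : R -> R * R -> R) (a b B : R) : a <= b -> 0 <= B ->
  continuous (fun p : R * (R * R) => F p.1 p.2) ->
  (forall s, (N2 (F s) <= B%:E)%E) ->
  (N2 (fun X => J a b (F^~ X)) <= (B * (b - a) ^+ 2)%:E)%E.
Proof.
move=> ab B0 cF FB; have ba0 : 0 <= b - a by rewrite subr_ge0.
have cFX X : continuous (F^~ X).
  by move=> s; exact: (@cont_comp2 _ R _ _ F id (fun=> X) s (cF _) (@cont_id _ _) (@cont_cst _ _ _ _)).
have cFs s : continuous (F s).
  by move=> X; exact: (@cont_comp2 _ R _ _ F (fun=> s) id X (cF _) (@cont_cst _ _ _ _) (@cont_id _ _)).
have cF2 X : continuous (fun s => F s X ^+ 2).
  by move=> s; apply: cvgM; exact: cFX.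
(* The indicator moves the restriction to the segment into the integrand, so that Tonelli applies on
   the whole product. *)
pose G (p : (R * R) * R) := (F p.2 p.1 ^+ 2 * \1_(`[a, b]) p.2)%:E.
have mG : measurable_fun [set: (measurableTypeR R * measurableTypeR R) * measurableTypeR R] G.
  apply/measurable_EFinP; apply: measurable_funM.
    apply: (@continuous_measurable3 R (fun p => F p.2 p.1 ^+ 2)) => p.
    have cp : {for p, continuous (fun p : (R * R) * R => F p.2 p.1)}.
      exact: (@cont_comp2 _ R _ _ F snd fst p (cF _) (@cont_snd _ _ _) (@cont_fst _ _ _)).
    by apply: cvgM; exact: cp.
  apply: (@measurableT_comp _ _ _ _ _ _ (\1_(`[a, b]) : measurableTypeR R -> R) _ snd) => //.
have G0 p : (0 <= G p)%E by rewrite lee_fin mulr_ge0// sqr_ge0.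
have GX X : (\int[leb]_s G (X, s) = (J a b (fun s => (F s X ^+ 2)%R))%:E)%E.
  rewrite -J_EFin// [RHS]integral_mkcond; apply: eq_integral => s _.
  by rewrite /G /= patchE indicE; case: ifPn => _; rewrite ?mulr1 ?mulr0.
have mi : measurable_fun [set: measurableTypeR R]
    (fun s => (\1_(`[a, b]%classic : set R) s : R)%:E).
  by apply/measurable_EFinP; exact: measurable_indic.
have Gs s : (\int[leb2]_X G (X, s) <= (B%:E * (\1_(`[a, b]) s)%:E))%E.
  rewrite /G /=; under eq_integral do rewrite EFinM muleC.
  rewrite ge0_integralZl_EFin//; last 2 first.
    exact: sq0.
    exact: measurable_sqr2.
  rewrite muleC; apply: lee_wpmul2r; rewrite ?lee_fin//; exact: FB.
have [cJ0|] := eqVneq a b.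
  rewrite cJ0 subrr expr0n/= mulr0 /N2; apply: (@le_trans _ _ (\int[leb2]_X (cst 0%E X))%E).
    rewrite le_eqVlt; apply/orP; left; apply/eqP; apply: eq_integral => X _.
    by rewrite /J set_itv1 Rintegral_set1 expr0n.
  by rewrite integral0.
move=> nab; have lab : a < b by rewrite lt_neqAle nab ab.
have cJ : continuous (fun X => J a b (F^~ X)).
  move=> X; apply: J_continuous => // [s _|]; first exact: cF.
  by apply: (@near_all (R * R)%type) => Y; exact: cFX.
have mJ : measurable_fun [set: measurableTypeR R * measurableTypeR R]
    (fun X => (J a b (fun s => (F s X ^+ 2)%R))%:E).
  rewrite (_ : (fun X => _) = fubini_F leb G); first exact: measurable_fun_fubini_tonelli_F.
  by apply/funext => X; rewrite /fubini_F GX.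
apply: (@le_trans _ _ (\int[leb2]_X ((b - a)%:E * (J a b (fun s => (F s X ^+ 2)%R))%:E))%E).
  apply: ge0_le_integral => //.
  - exact: sq0.
  - exact: measurable_sqr2.
  - exact: measurable_funeM.
  by move=> X _; rewrite -EFinM lee_fin; exact: J_sqr.
rewrite ge0_integralZl_EFin//; last first.
  by move=> X _; rewrite lee_fin; apply: J_ge0 => s _; exact: sqr_ge0.
rewrite expr2 mulrCA mulrC EFinM muleC; apply: lee_wpmul2r => //.
under eq_integral do rewrite -GX.
rewrite (@fubini_tonelli _ _ _ _ _ leb2 leb G mG G0).
apply: (@le_trans _ _ (\int[leb]_s (B%:E * (\1_(`[a, b]) s)%:E))%E).
  apply: ge0_le_integral => //.
  - by move=> s _; apply: integral_ge0.
  - exact: (@measurable_fun_fubini_tonelli_G _ _ _ _ _ leb2 G mG G0).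
  - exact: measurable_funeM.
rewrite ge0_integralZl_EFin//; first last.
by rewrite integral_indic// setIT /= lebesgue_measure_itv/= lte_fin lab EFinM.
Qed.

End L2.

(** * Pointwise bounds in the plane from L^2 bounds *)

Section Sobolev.
Variable R : realType.
Local Notation leb := (@lebesgue_measure R).
Local Notation leb2 := (@lebesgue2 R).
Local Notation leb3 := (@lebesgue2 R \x leb)%E.
Implicit Types (F : R * R -> R).

Lemma cont_slice1 F (y : R) : continuous F -> continuous (fun x => F (x, y)).
Proof.
move=> cF x; apply: (@continuous_comp _ _ _ (fun x => (x, y)) F x _ (cF _)).
exact: cont_pair (@cont_id _ _) (@cont_cst _ _ _ _).
Qed.

Lemma cont_slice2 F (x : R) : continuous F -> continuous (fun y => F (x, y)).
Proof.
move=> cF y; apply: (@continuous_comp _ _ _ (fun y => (x, y)) F y _ (cF _)).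
exact: cont_pair (@cont_cst _ _ _ _) (@cont_id _ _).
Qed.

Lemma csqr (T : topologicalType) (f : T -> R) : continuous f -> continuous (fun x => f x ^+ 2).
Proof. by move=> cf x; apply: cvgM; exact: cf. Qed.

(** The one-dimensional estimate on [[x, x + 1]] and then, for [F] and [F1], on [[y, y + 1]]; the 4
    is 2 times 2. The only second derivative that enters is the mixed one. *)
Lemma sobolev2 F F1 F2 F12 (x y : R) :
  continuous F -> continuous F1 -> continuous F2 -> continuous F12 ->
  (forall x y : R, is_derive x 1 (fun s => F (s, y)) (F1 (x, y))) ->
  (forall x y : R, is_derive y 1 (fun s => F (x, s)) (F2 (x, y))) ->
  (forall x y : R, is_derive y 1 (fun s => F1 (x, s)) (F12 (x, y))) ->
  ((F (x, y) ^+ 2)%R%:E <= 4%:E * (N2 F + N2 F1 + N2 F2 + N2 F12))%E.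
Proof.
move=> cF cF1 cF2 cF12 d1 d2 d12.
have lt1 z : z < z + 1 :> R by rewrite ltrDl.
have le1 z : z <= z + 1 :> R := ltW (lt1 z).
pose Q X := (F X ^+ 2 + F1 X ^+ 2) + (F2 X ^+ 2 + F12 X ^+ 2).
have cQ : continuous Q by exact: (cD (cD (csqr cF) (csqr cF1)) (cD (csqr cF2) (csqr cF12))).
have Q0 X : 0 <= Q X by rewrite !addr_ge0// sqr_ge0.
have mQ : measurable_fun [set: measurableTypeR R * measurableTypeR R]
    (fun X => (4 * Q X)%:E).
  apply/measurable_EFinP; apply: (@continuous_measurable2 R (fun X => 4 * Q X)).
  by apply: cM => //; exact: cC.
have Q40 X : (0 <= (4 * Q X)%:E)%E by rewrite lee_fin mulr_ge0.
pose h z := 2 * F (z, y) ^+ 2 + F1 (z, y) ^+ 2.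
have ch : continuous h.
  apply: cD; last by apply: csqr; exact: cont_slice1.
  by apply: cM; [exact: cC|apply: csqr; exact: cont_slice1].
have hQ z : ((h z)%:E <= \int[leb]_s (4 * Q (z, s))%:E)%E.
  have cFz := @cont_slice2 _ z cF; have cF1z := @cont_slice2 _ z cF1.
  have cF2z := @cont_slice2 _ z cF2; have cF12z := @cont_slice2 _ z cF12.
  have yy1 : y <= y <= y + 1 by rewrite lexx le1.
  have A := @sobolev1 R y (y + 1) (fun s => F (z, s)) (fun s => F2 (z, s)) y (lt1 y) cFz cF2z
     (fun s _ => d2 z s) yy1.
  have B := @sobolev1 R y (y + 1) (fun s => F1 (z, s)) (fun s => F12 (z, s)) y (lt1 y) cF1z cF12z
     (fun s _ => d12 z s) yy1.
  have cQz : continuous (fun s => 4 * Q (z, s)).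
    by apply: cM; [exact: cC|exact: cont_slice2].
  apply: (@le_trans _ _ (\int[leb]_(s in `[y, (y + 1)%R]) (4 * Q (z, s))%:E)%E); last first.
    apply: ge0_subset_integral => //.
    by apply/measurable_EFinP; exact: continuous_measurable_fun.
  rewrite J_EFin// lee_fin JZ; last exact: cont_slice2.
  have e1 : y + 1 - y = 1 by rewrite addrAC subrr add0r.
  rewrite e1 divr1 mul1r in A; rewrite e1 divr1 mul1r in B.
  rewrite /Q JD; [|by apply: cD; exact: csqr|by apply: cD; exact: csqr].
  rewrite !JD; try exact: csqr.
  rewrite /h.
  have P0 (f : R -> R) : 0 <= J y (y + 1) (fun s => f s ^+ 2).
    by apply: J_ge0 => s _; exact: sqr_ge0.
  move: A B (P0 (fun s => F (z, s))) (P0 (fun s => F1 (z, s))) (P0 (fun s => F2 (z, s)))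
    (P0 (fun s => F12 (z, s))).
  move: (J _ _ _) (J _ _ _) (J _ _ _) (J _ _ _) (F (z, y) ^+ 2) (F1 (z, y) ^+ 2).
  clear; move=> a b c d u v; lra.
have xx1 : x <= x <= x + 1 by rewrite lexx le1.
have := @sobolev1 R x (x + 1) (fun s => F (s, y)) (fun s => F1 (s, y)) x (lt1 x)
  (@cont_slice1 _ y cF) (@cont_slice1 _ y cF1) (fun s _ => d1 s y) xx1.
have -> : x + 1 - x = 1 by rewrite addrAC subrr add0r.
rewrite divr1 mul1r -JZ; last by apply: csqr; exact: cont_slice1.
rewrite -JD; [|by apply: cM; [exact: cC|apply: csqr; exact: cont_slice1]
              |by apply: csqr; exact: cont_slice1].
rewrite -lee_fin => /le_trans; apply.
rewrite -[X in (X%:E <= _)%E]/(J x (x + 1) h) -J_EFin//.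
have mh : measurable_fun [set: measurableTypeR R] (EFin \o h).
  by apply/measurable_EFinP; exact: continuous_measurable_fun.
have h0 z : (0 <= (h z)%:E)%E by rewrite lee_fin; apply: addr_ge0; [apply: mulr_ge0 => //|]; exact: sqr_ge0.
apply: (@le_trans _ _ (\int[leb]_z (h z)%:E)%E).
  by apply: ge0_subset_integral => //.
apply: (@le_trans _ _ (\int[leb]_z \int[leb]_s (4 * Q (z, s))%:E)%E).
  apply: ge0_le_integral => //.
  exact: (@measurable_fun_fubini_tonelli_F _ _ _ _ _ leb _ mQ).
rewrite -(@fubini_tonelli1 _ _ _ _ _ leb leb _ mQ)//.
rewrite -[X in (X <= _)%E]/(\int[leb2]_X (4 * Q X)%:E)%E.
under eq_integral do rewrite EFinM.
have m2 (f : R * R -> R) : continuous f -> measurable_fun [set: measurableTypeR R * measurableTypeR R]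
   (fun X => (f X ^+ 2)%:E).
  exact: measurable_sqr2.
have s0 (f : R * R -> R) (X : R * R) : (0 <= (f X ^+ 2)%:E)%E by rewrite lee_fin sqr_ge0.
rewrite ge0_integralZl_EFin//; last 2 first.
  by move=> X _; rewrite lee_fin.
  by apply/measurable_EFinP; exact: (@continuous_measurable2 R Q).
rewrite /Q; under eq_integral do rewrite !EFinD.
rewrite ge0_integralD//; last 4 first.
- by move=> X _; exact: adde_ge0.
- by apply: emeasurable_funD; exact: m2.
- by move=> X _; exact: adde_ge0.
- by apply: emeasurable_funD; exact: m2.
rewrite !ge0_integralD//; try exact: m2.
by rewrite /N2 !addeA.
Qed.

End Sobolev.

(** * Integrals over the fluid domain, column by column *)

Section Strip.
Variable R : realType.
Local Notation leb := (@lebesgue_measure R).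
Local Notation leb2 := (@lebesgue2 R).
Local Notation leb3 := (@lebesgue2 R \x leb)%E.
Local Notation R3 := ((R * R) * R)%type.
Local Notation m3 := ((measurableTypeR R * measurableTypeR R) * measurableTypeR R)%type.
Variable b : R * R -> R.
Hypothesis cb : continuous b.

Definition strip : set R3 := [set Q | -1 < Q.2 /\ Q.2 < b Q.1].

Lemma open_strip : open strip.
Proof.
have -> : strip = (snd @^-1` [set z : R | -1 < z]) `&`
    ((fun x : R3 => b x.1 - x.2) @^-1` [set z | 0 < z]).
  by apply/seteqP; split => x; rewrite /strip /= subr_gt0.
apply: openI; apply: open_comp; try exact: open_gt.
  by move=> p _; exact: cvg_snd.
move=> p _; have c1 : {for p, continuous (fun x : R3 => b x.1)}.
  exact: (@continuous_comp _ _ _ fst b p (@cont_fst _ _ p) (@cb _)).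
by apply: cvgB; [exact: c1|exact: cvg_snd].
Qed.

Lemma measurable_strip : measurable (strip : set m3).
Proof. exact: (open_measurable3 open_strip). Qed.

Variable g : R3 -> R.
Hypothesis cg : forall p, strip p -> {for p, continuous g}.

Let gs : m3 -> \bar R := (fun p => (g p ^+ 2)%:E) \_ strip.

Lemma measurable_strip_sqr : measurable_fun [set: m3] gs.
Proof.
apply/(measurable_restrict _ measurable_strip measurableT); rewrite setTI.
apply/measurable_EFinP; apply: (@measurable_funX _ _ _ (strip : set m3) g 2).
apply: (measurability _ (RGenOpens.measurableE R)).
move=> _ [_ [u [v ->] <-]]; apply: open_measurable3.
have oi : open (`]u, v[%classic : set R) by exact: interval_open.
rewrite openE => p [sp gp].
have h1 : nbhs p (g @^-1` `]u, v[) by apply: cg => //; apply: open_nbhs_nbhs.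
have h2 : nbhs p strip by apply: open_nbhs_nbhs; split => //; exact: open_strip.
by apply: filterS (filterI h2 h1).
Qed.

Lemma strip_sqr_ge0 p : (0 <= gs p)%E.
Proof. by rewrite /gs patchE; case: ifPn => // _; rewrite lee_fin sqr_ge0. Qed.

Lemma strip_integral :
  (\int[leb3]_(p in strip) (g p ^+ 2)%:E = \int[leb2]_X fubini_F leb gs X)%E.
Proof.
rewrite integral_mkcond.
exact: (@fubini_tonelli1 _ _ _ _ _ leb2 leb _ measurable_strip_sqr strip_sqr_ge0).
Qed.

(** [g] is controlled in the strip only, so its slice is replaced by a function [h] that is
    continuous on the whole line and agrees with it inside. *)
Lemma strip_slice (X : R * R) (h : R -> R) : continuous h ->
  (forall z, -1 < z < b X -> h z = g (X, z)) ->
  fubini_F leb gs X = (J (-1) (b X) (fun z => h z ^+ 2))%:E.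
Proof.
move=> ch hg; have ch2 : continuous (fun z => h z ^+ 2) := csqr ch.
rewrite -J_EFin// integral_itv_bndoo; last first.
  by apply/measurable_EFinP; apply: measurable_funTS; exact: continuous_measurable_fun.
rewrite /fubini_F [RHS]integral_mkcond; apply: eq_integral => z _.
rewrite /gs !patchE.
have -> : ((X, z) \in strip) = (z \in `]-1, (b X)[%classic).
  apply/idP/idP; rewrite !inE /strip /= in_itv/=; first by move=> [-> ->].
  by move=> /andP.
by case: ifPn => //; rewrite inE/= in_itv/= => /hg ->.
Qed.

End Strip.

(** Tonelli integrates over [X] an inequality valid on each vertical segment. With [gz] the vertical
    derivative of [g], this bounds a trace on a level by norms over the fluid. *)
Lemma N2_strip (R : realType) (b : R * R -> R) (F : R * R -> R) (g gz : (R * R) * R -> R) (c : R) :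
  continuous b -> continuous F -> 0 <= c ->
  (forall p, strip b p -> {for p, continuous g}) ->
  (forall p, strip b p -> {for p, continuous gz}) ->
  (forall X, exists h hz : R -> R, [/\ continuous h, continuous hz,
     (forall z, -1 < z < b X -> h z = g (X, z)),
     (forall z, -1 < z < b X -> hz z = gz (X, z)) &
     F X ^+ 2 <= c * (J (-1) (b X) (fun z => h z ^+ 2) + J (-1) (b X) (fun z => hz z ^+ 2))]) ->
  (N2 F <= c%:E * (\int[@lebesgue2 R \x @lebesgue_measure R]_(p in strip b) (g p ^+ 2)%R%:E +
                   \int[@lebesgue2 R \x @lebesgue_measure R]_(p in strip b) (gz p ^+ 2)%R%:E))%E.
Proof.
move=> cb cF c0 cg cgz H.
rewrite !strip_integral//.
set u := fubini_F _ _; set v := fubini_F _ _.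
have mu_ : measurable_fun setT u.
  exact: (@measurable_fun_fubini_tonelli_F _ _ _ _ _ _ _ (measurable_strip_sqr cb cg) (strip_sqr_ge0 _ _)).
have mv : measurable_fun setT v.
  exact: (@measurable_fun_fubini_tonelli_F _ _ _ _ _ _ _ (measurable_strip_sqr cb cgz) (strip_sqr_ge0 _ _)).
have u0 X : (0 <= u X)%E by apply: integral_ge0 => z _; exact: strip_sqr_ge0.
have v0 X : (0 <= v X)%E by apply: integral_ge0 => z _; exact: strip_sqr_ge0.
rewrite -ge0_integralD// -ge0_integralZl_EFin//; last 2 first.
  by move=> X _; exact: adde_ge0.
  exact: emeasurable_funD.
apply: ge0_le_integral => //.
- by move=> X _; rewrite lee_fin sqr_ge0.
- exact: measurable_sqr2.
- by apply: measurable_funeM; exact: emeasurable_funD.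
move=> X _; have [h [hz [ch chz hg hgz Fle]]] := H X.
by rewrite /u /v (strip_slice ch hg) (strip_slice chz hgz) -EFinD -EFinM lee_fin.
Qed.

(** Everything over which the estimates are uniform, at one time of the interval. The bounds on the
    solution stay outside, because their order [n] depends on the estimate. *)
Record data (R : realType) := Data {
  dmu0 : R ; dM : R ; dhmin : R ; dA : R ; dI : set R ;
  dP : params R ; dS : flow R ; dt : R ;
  mu0_gt0 : 0 < dmu0 ; hmin_gt0 : 0 < dhmin ;
  itv_dI : is_interval dI ;
  dI_nontrivial : exists t1 t2, [/\ dI t1, dI t2 & t1 < t2] ;
  regime : A_boussi dmu0 dM dP ;
  system : castro_lannes dhmin dI dP dS ;
  dI_dt : dI dt }.

(** Nondecreasing in each argument, above each of them whatever its sign, and at least 2, so that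
    its powers absorb sums. The 2 also leaves room for [1 + b]. *)
Definition size {R : realType} (a b c d : R) : R :=
  2 + Num.max a 0 + Num.max b 0 + Num.max c 0 + Num.max d 0.

Lemma size_nondecreasing (R : realType) m : nondecreasing4 (fun a b c d : R => size a b c d ^+ m).
Proof.
move=> a a' b b' c c' d d' aa bb cc dd.
have mx (x y : R) : x <= y -> Num.max x 0 <= Num.max y 0.
  by move=> xy; rewrite ge_max !le_max xy lexx orbT.
have m0 (x : R) : 0 <= Num.max x 0 by rewrite le_max lexx orbT.
by apply: lerXn2r; rewrite ?nnegrE ?addr_ge0 ?m0// /size !lerD// mx.
Qed.

Lemma le_size (R : realType) (a b c d : R) :
  [/\ a <= size a b c d, 1 + b <= size a b c d, c <= size a b c d & d <= size a b c d].
Proof.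
have le_max0 (x : R) : x <= Num.max x 0 by rewrite le_max lexx.
have max0 (x : R) : 0 <= Num.max x 0 by rewrite le_max lexx orbT.
rewrite /size.
move: (le_max0 a) (le_max0 b) (le_max0 c) (le_max0 d) (max0 a) (max0 b) (max0 c) (max0 d).
by move: (Num.max a 0) (Num.max b 0) (Num.max c 0) (Num.max d 0); clear;
  move=> *; split; lra.
Qed.

(** * The calculus of orders [O b k] *)

Section Classes.
Variable R : realType.
Local Notation data := (data R).
Implicit Types d : data.
Definition family := data -> R -> R * R -> R.
Implicit Types F G : family.

Definition kap d : R := size (dA d) (dmu0 d) (dhmin d)^-1 (dM d).
Definition nu d : R := Num.sqrt (mu (dP d)).
Definition bounded n d := bounded_by n (dA d) (dI d) (dP d) (dS d).

Lemma mu_gt0 d : 0 < mu (dP d). Proof. by have [[]] := regime d. Qed.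
Lemma nu_gt0 d : 0 < nu d. Proof. by rewrite sqrtr_gt0 mu_gt0. Qed.
Lemma nu2 d : nu d ^+ 2 = mu (dP d). Proof. by rewrite sqr_sqrtr// ltW// mu_gt0. Qed.

Let max0 (x : R) : 0 <= Num.max x 0. Proof. by rewrite le_max lexx orbT. Qed.

Lemma kap_ge2 d : 2 <= kap d.
Proof.
rewrite /kap /size; move: (max0 (dA d)) (max0 (dmu0 d)) (max0 (dhmin d)^-1) (max0 (dM d)).
by move: (Num.max _ _) (Num.max _ _) (Num.max _ _) (Num.max _ _); clear; move=> *; lra.
Qed.
Lemma kap_ge1 d : 1 <= kap d.
Proof. by rewrite (le_trans _ (kap_ge2 d))// ler1n. Qed.
Lemma kap_gt0 d : 0 < kap d.
Proof. by rewrite (lt_le_trans _ (kap_ge2 d)). Qed.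

Lemma le_kap d : [/\ dA d <= kap d, 1 + dmu0 d <= kap d, (dhmin d)^-1 <= kap d & dM d <= kap d].
Proof.
have [h1 h2 h3 h4] := le_size (dA d) (dmu0 d) (dhmin d)^-1 (dM d).
by split; [exact: h1|exact: h2|exact: h3|exact: h4].
Qed.

(** From [2 nu <= 1 + nu ^+ 2] and [mu <= mu0]. As [mu0] may exceed 1, dropping a power of [nu]
    costs a power of [kap]. *)
Lemma nu_le_kap d : nu d <= kap d.
Proof.
have [_ h _ _] := le_kap d; apply: le_trans h.
have mu1 : mu (dP d) <= dmu0 d by have [_ []] := regime d.
have := nu2 d; have := nu_gt0 d; have := sqr_ge0 (nu d - 1); rewrite expr2.
move: mu1; rewrite expr2; move: (nu d) (mu _) (dmu0 d); clear; move=> n m m0; nra.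
Qed.

(** Products of such bounds have the same form, and a sum costs a factor 2, that is at most one more
    [kap]. *)
Definition scale m k d : R := kap d ^+ m * nu d ^+ k.

Lemma scale_gt0 m k d : 0 < scale m k d.
Proof. by rewrite mulr_gt0// exprn_gt0 ?kap_gt0 ?nu_gt0. Qed.

Lemma scale_le m m' k d : (m <= m')%N -> scale m k d <= scale m' k d.
Proof.
by move=> mm; rewrite ler_wpM2r ?exprn_ge0 ?(ltW (nu_gt0 _))// ler_weXn2l// kap_ge1.
Qed.

Lemma scale_weaken m k k' d : (k' <= k)%N -> scale m k d <= scale (m + (k - k')) k' d.
Proof.
move=> kk; rewrite /scale exprD -mulrA ler_wpM2l ?exprn_ge0 ?(ltW (kap_gt0 _))//.
rewrite -{1}(subnK kk) exprD ler_wpM2r ?exprn_ge0 ?(ltW (nu_gt0 _))//.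
by rewrite lerXn2r ?nnegrE ?(ltW (kap_gt0 _)) ?(ltW (nu_gt0 _))// nu_le_kap.
Qed.

Lemma scale2 m k d : 2 * scale m k d <= scale m.+1 k d.
Proof.
by rewrite /scale exprS -mulrA ler_wpM2r ?(ltW (scale_gt0 _ _ _))// kap_ge2.
Qed.

Lemma scaleM m k m' k' d : scale m k d * scale m' k' d = scale (m + m') (k + k') d.
Proof. by rewrite /scale !exprD mulrACA. Qed.

Definition ex := (1, 0) : R * R.
Definition ey := (0, 1) : R * R.

Definition px F : family := fun d th => 'D_ex (F d th).
Definition py F : family := fun d th => 'D_ey (F d th).

(** Continuity is joint, for the sake of integration in the level; derivatives are taken in [X]
    only, as clamping creates corners in the level variable. *)
Definition reg F := forall d,
  [/\ continuous (fun p : R * (R * R) => F d p.1 p.2),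
      forall th X, derivable (F d th) X ex & forall th X, derivable (F d th) X ey].

(** [n] and [m] are chosen before [d]: this is the uniformity with respect to parameters and
    solutions. *)
Definition bnd (b : bool) k F := exists n m, forall d, bounded n d ->
  if b then forall th, (N2 (F d th) <= (scale m k d ^+ 2)%:E)%E
  else forall th X, `|F d th X| <= scale m k d.

Fixpoint cls b k s F : Prop :=
  [/\ reg F, bnd b k F & if s is s'.+1 then cls b k s' (px F) /\ cls b k s' (py F) else True].

(* [O b k F]: on bounded solutions all x- and y-derivatives of [F] are bounded
   by a power of [kap] times [nu^k = mu^(k/2)], in L^2 of each level [th] if [b],
   pointwise otherwise. *)
Definition O b k F := forall s, cls b k s F.

(** The offset [k] serves both norms: 0 on the surface, the number of [x]-derivatives in the
    fluid. *)
Lemma sum_triangle_le (T : nat -> nat -> \bar R) (k n n' : nat) :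
  (forall a b, 0 <= T a b)%E -> (n <= n')%N ->
  (\sum_(a < n.+1) \sum_(b < n.+1 | (k + a + b <= n)%N) T a b <=
   \sum_(a < n'.+1) \sum_(b < n'.+1 | (k + a + b <= n')%N) T a b)%E.
Proof.
move=> T0 nn; apply: (@le_trans _ _
  (\sum_(a < n.+1) \sum_(b < n'.+1 | (k + a + b <= n')%N) T a b)%E).
  apply: lee_sum => a _; apply: (@le_trans _ _
    (\sum_(b < n'.+1 | (k + a + b <= n)%N) T a b)%E).
    exact: (@lee_sum_nneg_ord _ (T a) (fun b => k + a + b <= n)%N _ n.+1 n'.+1).
  by apply: lee_sum_nneg_subset => // b; rewrite !unfold_in => /leq_trans; exact.
apply: (@lee_sum_nneg_ord _ (fun a => \sum_(b < n'.+1 | (k + a + b <= n')%N) T a b)%E xpredT) => //.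
by move=> a _; apply: sume_ge0.
Qed.

Lemma Hnorm2_le (W : normedModType R) (q : W -> R) n n' (f : sp2 R -> W) t :
  (forall w, 0 <= q w) -> (n <= n')%N -> (Hnorm2 q n f t <= Hnorm2 q n' f t)%E.
Proof.
move=> q0 nn.
pose T a b := (\int[lebesgue_measure \x lebesgue_measure]_(X in [set: vec2 R])
      (q (iter a dx2 (iter b dy2 f) (t, X)))%:E)%E.
have T0 a b : (0 <= T a b)%E by apply: integral_ge0 => X _; rewrite lee_fin.
rewrite /Hnorm2 lee_sqrt; first exact: (@sum_triangle_le T 0%N).
by do 2 apply: sume_ge0 => ? _; exact: T0.
Qed.

Lemma Hnorm3_le (W : normedModType R) (q : W -> R) n n' Om (f : sp3 R -> W) t :
  (forall w, 0 <= q w) -> (n <= n')%N -> (Hnorm3 q n Om f t <= Hnorm3 q n' Om f t)%E.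
Proof.
move=> q0 nn.
pose T a b c := (\int[(lebesgue_measure \x lebesgue_measure) \x lebesgue_measure]_(Q in Om)
      (q (iter a dx3 (iter b dy3 (iter c dz3 f)) (t, Q)))%:E)%E.
have T0 a b c : (0 <= T a b c)%E by apply: integral_ge0 => X _; rewrite lee_fin.
rewrite /Hnorm3 lee_sqrt; last by do 3 apply: sume_ge0 => ? _; exact: T0.
apply: (@le_trans _ _ (\sum_(a < n.+1) \sum_(b < n'.+1) \sum_(c < n'.+1 | (a + b + c <= n')%N) T a b c)%E).
  by apply: lee_sum => a _; exact: sum_triangle_le.
apply: (@lee_sum_nneg_ord _ (fun a => \sum_(b < n'.+1) \sum_(c < n'.+1 | (a + b + c <= n')%N) T a b c)%E xpredT) => //.
by move=> a _; apply: sume_ge0 => b _; apply: sume_ge0.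
Qed.

Lemma bounded_le n n' d : (n <= n')%N -> bounded n' d -> bounded n d.
Proof.
move=> nn B t It.
have q1 (w : R) : 0 <= sq1 w by exact: sqr_ge0.
have q2 (w : vec2 R) : 0 <= sq2 w by rewrite addr_ge0// sqr_ge0.
have q3 (w : vec3 R) : 0 <= sq3 w by rewrite addr_ge0// sqr_ge0.
have [[b1 b2 b3 b4 b5] [c1 c2 c3 c4]] := B t It; split; split.
- exact: le_trans (Hnorm2_le _ _ q1 nn) b1.
- exact: le_trans (Hnorm2_le _ _ q2 nn) b2.
- exact: le_trans (Hnorm3_le _ _ _ q3 nn) b3.
- exact: le_trans (Hnorm2_le _ _ q2 nn) b4.
- exact: le_trans (Hnorm3_le _ _ _ q3 nn) b5.
- exact: le_trans (Hnorm2_le _ _ q1 nn) c1.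
- exact: le_trans (Hnorm2_le _ _ q2 nn) c2.
- exact: le_trans (Hnorm3_le _ _ _ q3 nn) c3.
- exact: le_trans (Hnorm3_le _ _ _ q3 nn) c4.
Qed.

Lemma reg_cont F d th : reg F -> continuous (F d th).
Proof.
move=> rF X; have [cF _ _] := rF d.
exact: (@cont_comp2 _ R _ _ (F d) (fun=> th) id X (cF _) (@cont_cst _ _ _ _) (@cont_id _ _)).
Qed.

Lemma reg_cont1 F d X : reg F -> continuous (fun th => F d th X).
Proof.
move=> rF th; have [cF _ _] := rF d.
exact: (@cont_comp2 _ R _ _ (F d) id (fun=> X) th (cF _) (@cont_id _ _) (@cont_cst _ _ _ _)).
Qed.

Lemma reg_is_derive1 F d th (x y : R) : reg F ->
  is_derive x 1 (fun s => F d th (s, y)) (px F d th (x, y)).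
Proof.
move=> rF; have [_ dx _] := rF d.
have e (s : R) : s *: ex + (0, y) = (s, y).
  apply: injective_projections; first exact: (etrans (addr0 _) (mulr1 s)).
  exact: (etrans (congr1 (+%R^~ y) (mulr0 s)) (add0r y)).
have := @is_derive_line R (R * R)%type (F d th) (0, y) ex x (px F d th (x, y)).
rewrite e (_ : (fun r : R => F d th (r *: ex + (0, y))) = fun s => F d th (s, y)).
  by apply; exact: derivableP.
by apply/funext => s; rewrite e.
Qed.

Lemma reg_is_derive2 F d th (x y : R) : reg F ->
  is_derive y 1 (fun s => F d th (x, s)) (py F d th (x, y)).
Proof.
move=> rF; have [_ _ dy] := rF d.
have e (s : R) : s *: ey + (x, 0) = (x, s).
  apply: injective_projections; last exact: (etrans (addr0 _) (mulr1 s)).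
  exact: (etrans (congr1 (+%R^~ x) (mulr0 s)) (add0r x)).
have := @is_derive_line R (R * R)%type (F d th) (x, 0) ey y (py F d th (x, y)).
rewrite e (_ : (fun r : R => F d th (r *: ey + (x, 0))) = fun s => F d th (x, s)).
  by apply; exact: derivableP.
by apply/funext => s; rewrite e.
Qed.

Lemma reg_add F G : reg F -> reg G -> reg (fun d th X => F d th X + G d th X).
Proof.
move=> rF rG d; have [cF xF yF] := rF d; have [cG xG yG] := rG d; split.
- exact: (cD cF cG).
- by move=> th X; apply: derivableD.
- by move=> th X; apply: derivableD.
Qed.

Lemma px_add F G : reg F -> reg G ->
  px (fun d th X => F d th X + G d th X) = fun d th X => px F d th X + px G d th X.
Proof.
move=> rF rG; apply/funext => d; apply/funext => th; apply/funext => X.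
by have [_ xF _] := rF d; have [_ xG _] := rG d; rewrite /px deriveD.
Qed.

Lemma py_add F G : reg F -> reg G ->
  py (fun d th X => F d th X + G d th X) = fun d th X => py F d th X + py G d th X.
Proof.
move=> rF rG; apply/funext => d; apply/funext => th; apply/funext => X.
by have [_ _ yF] := rF d; have [_ _ yG] := rG d; rewrite /py deriveD.
Qed.

Lemma reg_mul F G : reg F -> reg G -> reg (fun d th X => F d th X * G d th X).
Proof.
move=> rF rG d; have [cF xF yF] := rF d; have [cG xG yG] := rG d; split.
- exact: (cM cF cG).
- by move=> th X; apply: derivableM.
- by move=> th X; apply: derivableM.
Qed.

Lemma px_mul F G : reg F -> reg G ->
  px (fun d th X => F d th X * G d th X) =
  fun d th X => F d th X * px G d th X + px F d th X * G d th X.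
Proof.
move=> rF rG; apply/funext => d; apply/funext => th; apply/funext => X.
have [_ xF _] := rF d; have [_ xG _] := rG d; rewrite /px deriveM//.
by congr (_ + _); exact: mulrC.
Qed.

Lemma py_mul F G : reg F -> reg G ->
  py (fun d th X => F d th X * G d th X) =
  fun d th X => F d th X * py G d th X + py F d th X * G d th X.
Proof.
move=> rF rG; apply/funext => d; apply/funext => th; apply/funext => X.
have [_ _ yF] := rF d; have [_ _ yG] := rG d; rewrite /py deriveM//.
by congr (_ + _); exact: mulrC.
Qed.

Lemma bnd_add b k F G : reg F -> reg G -> bnd b k F -> bnd b k G ->
  bnd b k (fun d th X => F d th X + G d th X).
Proof.
move=> rF rG [n1 [m1 h1]] [n2 [m2 h2]].
exists (maxn n1 n2), (maxn m1 m2).+1 => d B.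
have {}h1 := h1 d (bounded_le (leq_maxl _ _) B).
have {}h2 := h2 d (bounded_le (leq_maxr _ _) B).
have le1 := scale_le k d (leq_maxl m1 m2); have le2 := scale_le k d (leq_maxr m1 m2).
have l := scale2 (maxn m1 m2) k d.
case: b h1 h2 => h1 h2 th.
  apply: (le_trans (N2_add (reg_cont rF) (reg_cont rG))).
  apply: (@le_trans _ _ (2%:E * (scale m1 k d ^+ 2)%:E + 2%:E * (scale m2 k d ^+ 2)%:E)%E).
    by apply: leeD; apply: lee_wpmul2l.
  rewrite -!EFinM -EFinD lee_fin.
  have := scale_gt0 m1 k d; have := scale_gt0 m2 k d; have := scale_gt0 (maxn m1 m2) k d.
  move: le1 le2 l; rewrite !expr2.
  by move: (scale _ _ _) (scale _ _ _) (scale _ _ _) (scale _ _ _); clear; move=> a c e f; nra.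
move=> X; apply: (le_trans (ler_normD _ _)).
have := h1 th X; have := h2 th X; move: le1 le2 l.
by move: `|_| `|_| (scale _ _ _) (scale _ _ _) (scale _ _ _) (scale _ _ _); clear;
   move=> *; lra.
Qed.

Lemma bnd_mul b k l F G : reg F -> reg G -> bnd false k F -> bnd b l G ->
  bnd b (k + l) (fun d th X => F d th X * G d th X).
Proof.
move=> rF rG [n1 [m1 h1]] [n2 [m2 h2]].
exists (maxn n1 n2), (m1 + m2)%N => d B.
have {}h1 := h1 d (bounded_le (leq_maxl _ _) B).
have {}h2 := h2 d (bounded_le (leq_maxr _ _) B).
rewrite -scaleM; case: b h2 => h2 th.
  apply: (le_trans (N2_mul (reg_cont rF) (reg_cont rG) (h1 th))).
  by rewrite (exprMn 2 (scale m1 k d) (scale m2 l d)) (EFinM (scale m1 k d ^+ 2)); apply: lee_wpmul2l; rewrite ?lee_fin ?sqr_ge0.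
by move=> X; rewrite normrM ler_pM.
Qed.

Lemma cls_reg b k s F : cls b k s F -> reg F. Proof. by case: s => [|s] []. Qed.
Lemma cls_bnd b k s F : cls b k s F -> bnd b k F. Proof. by case: s => [|s] []. Qed.

Lemma cls_S b k s F : cls b k s.+1 F -> cls b k s F.
Proof.
elim: s F => [|s IH] F; first by case.
by move=> [rF bF [hx hy]]; split; [exact: rF|exact: bF|split; [exact: IH hx|exact: IH hy]].
Qed.

Lemma cls_add b k s F G : cls b k s F -> cls b k s G ->
  cls b k s (fun d th X => F d th X + G d th X).
Proof.
elim: s F G => [|s IH] F G [rF bF hF] [rG bG hG].
  by split; [exact: reg_add|exact: bnd_add|].
split; [exact: reg_add|exact: bnd_add|].
rewrite (px_add rF rG) (py_add rF rG); case: hF => fx fy; case: hG => gx gy.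
by split; [exact: IH fx gx|exact: IH fy gy].
Qed.

Lemma cls_mul b k l s F G : cls false k s F -> cls b l s G ->
  cls b (k + l) s (fun d th X => F d th X * G d th X).
Proof.
elim: s F G => [|s IH] F G HF HG.
  have [rF bF _] := HF; have [rG bG _] := HG.
  by split; [exact: reg_mul|exact: bnd_mul|].
have F0 := cls_S HF; have G0 := cls_S HG.
have [rF bF [Fx Fy]] := HF; have [rG bG [Gx Gy]] := HG.
split; [exact: reg_mul|exact: bnd_mul|].
rewrite (px_mul rF rG) (py_mul rF rG); split; apply: cls_add.
- exact: IH F0 Gx.
- exact: IH Fx G0.
- exact: IH F0 Gy.
- exact: IH Fy G0.
Qed.

Lemma bnd_weaken b k k' F : (k' <= k)%N -> bnd b k F -> bnd b k' F.
Proof.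
move=> kk [n [m H]]; exists n, (m + (k - k'))%N => d B.
have := H d B; have l := scale_weaken m d kk.
case: b H => _ H th; last by move=> X; exact: le_trans (H th X) l.
apply: (le_trans (H th)); rewrite lee_fin lerXn2r ?nnegrE ?(ltW (scale_gt0 _ _ _))//.
Qed.

Lemma cls_weaken b k k' s F : (k' <= k)%N -> cls b k s F -> cls b k' s F.
Proof.
move=> kk; elim: s F => [|s IH] F [rF bF hF].
  by split; [exact: rF|exact: bnd_weaken bF|].
split; [exact: rF|exact: bnd_weaken bF|].
by case: hF => hx hy; split; [exact: IH hx|exact: IH hy].
Qed.

Lemma bnd_sobolev k F : cls true k 2 F -> bnd false k F.
Proof.
move=> [rF [n0 [m0 h0]] [[r1 [n1 [m1 h1]] [_ H12]] [r2 [n2 [m2 h2]] _]]].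
have [r12 [n12 [m12 h12]] _] := H12.
pose n := maxn (maxn n0 n1) (maxn n2 n12); pose m := maxn (maxn m0 m1) (maxn m2 m12).
have [l0 l1 l2 l12] : [/\ n0 <= n, n1 <= n, n2 <= n & n12 <= n]%N.
  by rewrite /n !leq_max !leqnn !orbT.
have [l0' l1' l2' l12'] : [/\ m0 <= m, m1 <= m, m2 <= m & m12 <= m]%N.
  by rewrite /m !leq_max !leqnn !orbT.
exists n, m.+2 => d B th [x y].
have := @sobolev2 R (F d th) (px F d th) (py F d th) (py (px F) d th) x y
  (reg_cont rF) (reg_cont r1) (reg_cont r2) (reg_cont r12)
  (fun x y => reg_is_derive1 d th x y rF) (fun x y => reg_is_derive2 d th x y rF)
  (fun x y => reg_is_derive2 d th x y r1).
have lift k' (N : \bar R) m' : (N <= (scale m' k' d ^+ 2)%:E)%E -> (m' <= m)%N ->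
   (N <= (scale m k' d ^+ 2)%:E)%E.
  move=> h mm; apply: (le_trans h); rewrite lee_fin.
  by rewrite lerXn2r ?nnegrE ?(ltW (scale_gt0 _ _ _))// scale_le.
have {}h0 := lift _ _ _ (h0 d (bounded_le l0 B) th) l0'.
have {}h1 := lift _ _ _ (h1 d (bounded_le l1 B) th) l1'.
have {}h2 := lift _ _ _ (h2 d (bounded_le l2 B) th) l2'.
have {}h12 := lift _ _ _ (h12 d (bounded_le l12 B) th) l12'.
move=> H; have {}H := le_trans H (lee_wpmul2l (_ : (0 <= 4%:E)%E)
   (leeD (leeD (leeD h0 h1) h2) h12)).
have {}H := H _.
have {}H : F d th (x, y) ^+ 2 <= 4 * (scale m k d ^+ 2 + scale m k d ^+ 2 + scale m k d ^+ 2 + scale m k d ^+ 2).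
  move: (scale m k d ^+ 2) (F d th (x, y) ^+ 2) H => a u H.
  by rewrite -lee_fin EFinM !EFinD; apply: H; rewrite lee_fin.
have s0 := scale_gt0 m k d.
apply: (@le_trans _ _ (4 * scale m k d)).
  have p4 : 0 <= 4 * scale m k d by rewrite mulr_ge0// (ltW s0).
  have K : `|F d th (x, y)| ^+ 2 <= (4 * scale m k d) ^+ 2.
    rewrite real_normK ?num_real//; apply: (le_trans H); rewrite (exprMn 2 4 (scale m k d)).
    by move: (scale m k d ^+ 2); clear; move=> a; lra.
  by move: K; rewrite ler_pXn2r// nnegrE.
have := scale2 m k d; have := scale2 m.+1 k d.
by move: (scale _ _ _) (scale _ _ _) (scale _ _ _); clear; move=> *; lra.
Qed.

Lemma cls_sobolev k s F : cls true k s.+2 F -> cls false k s F.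
Proof.
elim: s F => [|s IH] F H.
  by split; [exact: cls_reg H|exact: bnd_sobolev|].
have b2 : cls true k 2 F by elim: s {IH} H => [|s IH2] H; [exact: cls_S H|exact: IH2 (cls_S H)].
split; [exact: cls_reg H|exact: bnd_sobolev|].
by case: H => _ _ [hx hy]; split; [exact: IH hx|exact: IH hy].
Qed.

(** The Sobolev embedding costs two derivatives, which [O] does not notice since it bounds
    derivatives of all orders. *)
Lemma O_sub b k F : O true k F -> O b k F.
Proof. by case: b => // H s; exact/cls_sobolev/H. Qed.

Lemma O_weaken b b' k k' F : O b k F -> (b' ==> b) -> (k' <= k)%N -> O b' k' F.
Proof.
move=> H bb kk s; apply: (cls_weaken kk).
by case: b b' H bb => -[] H // _; exact: O_sub.
Qed.

Lemma O_add b c k l F G : O b k F -> O c l G ->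
  O (b && c) (minn k l) (fun d th X => F d th X + G d th X).
Proof.
move=> HF HG s; apply: cls_add.
  by apply: (O_weaken HF); [case: b {HF}; case: c {HG}|exact: geq_minl].
by apply: (O_weaken HG); [case: b {HF}; case: c {HG}|exact: geq_minr].
Qed.

(** One factor in L^2 is enough; if both are, one of them is first turned into a pointwise bound. A
    sum, in contrast, is in L^2 only when both terms are, hence the [&&] there. *)
Lemma O_mul b c k l F G : O b k F -> O c l G ->
  O (b || c) (k + l) (fun d th X => F d th X * G d th X).
Proof.
move=> HF HG s; case: b HF => HF; last exact: cls_mul.
have -> : (fun d th X => F d th X * G d th X) = (fun d th X => G d th X * F d th X).
  by apply/funext => d; apply/funext => th; apply/funext => X; rewrite mulrC.
by rewrite addnC; apply: cls_mul => //; exact: O_weaken.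
Qed.

Lemma O_px b k F : O b k F -> O b k (px F).
Proof. by move=> H s; have [_ _ []] := H s.+1. Qed.
Lemma O_py b k F : O b k F -> O b k (py F).
Proof. by move=> H s; have [_ _ []] := H s.+1. Qed.
Lemma O_reg b k F : O b k F -> reg F.
Proof. by move=> H; exact: cls_reg (H 0%N). Qed.

Lemma O_theta k (f : data -> R -> R) : (forall d, continuous (f d)) ->
  (exists m, forall d th, `|f d th| <= scale m k d) -> O false k (fun d th _ => f d th).
Proof.
move=> cf [m fm] s; elim: s f cf fm => [|s IH] f cf fm.
  split=> //; last by exists 0%N, m => d _ th _.
  move=> d; split=> [p|th X|th X]; try exact: derivable_cst.
  exact: (@continuous_comp _ _ _ fst (f d) p (@cont_fst _ _ p) (cf d _)).
have e0 (v : R * R) : (fun d th => 'D_v (fun _ : R * R => f d th)) = (fun d th X => cst 0 th).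
  by apply/funext => d; apply/funext => th; apply/funext => X; exact: derive_cst.
have c0 : cls false k s (fun (d : data) (th : R) (X : R * R) => cst 0 th : R).
  apply: (IH (fun d => cst 0)) => [d|d th]; first exact: cC.
  by rewrite normr0 ltW// scale_gt0.
split=> //; [|by exists 0%N, m => d _ th _|by rewrite /px /py !e0].
move=> d; split=> [p|th X|th X]; try exact: derivable_cst.
exact: (@continuous_comp _ _ _ fst (f d) p (@cont_fst _ _ p) (cf d _)).
Qed.

Definition order k (c : data -> R) := exists m, forall d, `|c d| <= scale m k d.

Lemma O_scalar k c : order k c -> O false k (fun d _ _ => c d).
Proof.
move=> [m cm]; apply: (O_theta (f := fun d _ => c d)); first by move=> d; exact: cC.
by exists m.
Qed.

End Classes.

(** * Averages over the level variable *)

Section Operators.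
Variable R : realType.
Implicit Types (F G : family R) (d : data R).

Lemma O_reparam b k F (phi : R -> R) : continuous phi -> O b k F ->
  O b k (fun d th X => F d (phi th) X).
Proof.
move=> cphi H s; move: (H s) => {H}.
elim: s F => [|s IH] F [rF bF hF].
all: have rF' : reg (fun d th X => F d (phi th) X).
1,3: move=> d; have [cF xF yF] := rF d; split=> [p|th X|th X]; [|exact: xF|exact: yF];
  apply: (@cont_comp2 _ R _ _ (F d) (fun p => phi p.1) snd p (cF _) _ (@cont_snd _ _ _));
  exact: (@continuous_comp _ _ _ fst phi p (@cont_fst _ _ p) (cphi _)).
all: have bF' : bnd b k (fun d th X => F d (phi th) X).
1,3: by have [n [m h]] := bF; exists n, m => d /h; case: (b) => h' th; exact: h'.
  by split.
by case: hF => hx hy; split; [exact: rF'|exact: bF'|split; [exact: IH hx|exact: IH hy]].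
Qed.

(** Covers the vertical mean, with [phi th s = s], and the primitive from the bottom, with
    [phi th s = clamp th * s]; the interval of integration is fixed so that differentiation under
    the integral applies. *)
Definition avgf (phi : R -> R -> R) F : family R :=
  fun d th X => J 0 1 (fun s => F d (phi th s) X).

Variable phi : R -> R -> R.
Hypothesis cphi : continuous (fun p : R * R => phi p.1 p.2).

Let cphis th : continuous (phi th).
Proof.
move=> s; exact: (@cont_comp2 _ R _ _ phi (fun=> th) id s (@cphi _) (@cont_cst _ _ _ _) (@cont_id _ _)).
Qed.

Lemma reg_slice F d th X : reg F -> continuous (fun s => F d (phi th s) X).
Proof.
move=> rF s; have [cF _ _] := rF d.
exact: (@cont_comp2 _ R _ _ (F d) (phi th) (fun=> X) s (cF _) (@cphis th s) (@cont_cst _ _ _ _)).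
Qed.

Lemma avgf_is_derive F G d th X (v : R * R) : reg F -> reg G ->
  (forall th X, is_derive X v (F d th) (G d th X)) ->
  is_derive X v (avgf phi F d th) (avgf phi G d th X).
Proof.
move=> rF rG dF; apply: (@J_is_derive R (R * R)%type (fun s Y => F d (phi th s) Y)
  (fun s Y => G d (phi th s) Y) 0 1 X v) => //.
- by apply: (@near_all (R * R)%type) => Y s _; exact: dF.
- by apply: (@near_all (R * R)%type) => Y; exact: reg_slice.
- exact: reg_slice.
move=> s _; have [cG _ _] := rG d.
apply: (@cont_comp2 _ R _ _ (G d) (fun p : R * (R * R) => phi th p.1) snd (s, X) (cG _) _ (@cont_snd _ _ _)).
exact: (@continuous_comp _ _ _ fst (phi th) (s, X) (@cont_fst _ _ (s, X)) (@cphis th s)).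
Qed.

Lemma px_avgf F : reg F -> reg (px F) -> px (avgf phi F) = avgf phi (px F).
Proof.
move=> rF rx; apply/funext => d; apply/funext => th; apply/funext => X.
have D := @avgf_is_derive F (px F) d th X (ex R) rF rx _.
have [_ xF _] := rF d.
by case: D => // th' X'; apply: derivableP.
Qed.

Lemma py_avgf F : reg F -> reg (py F) -> py (avgf phi F) = avgf phi (py F).
Proof.
move=> rF ry; apply/funext => d; apply/funext => th; apply/funext => X.
have D := @avgf_is_derive F (py F) d th X (ey R) rF ry _.
have [_ _ yF] := rF d.
by case: D => // th' X'; apply: derivableP.
Qed.

Lemma reg_avgf F : reg F -> reg (px F) -> reg (py F) -> reg (avgf phi F).
Proof.
move=> rF rx ry d; have [cF xF yF] := rF d; split=> [[th X]|th X|th X].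
- apply: (@J_continuous R (R * (R * R))%type (fun s p => F d (phi p.1 s) p.2) 0 1 (th, X)) => //.
    move=> s _.
    apply: (@cont_comp2 _ R _ _ (F d) (fun p : R * (R * (R * R)) => phi p.2.1 p.1) (fun p => p.2.2)
      (s, (th, X)) (cF _)).
      apply: (@cont_comp2 _ R _ _ phi (fun p : R * (R * (R * R)) => p.2.1) fst (s, (th, X)) (@cphi _)).
        exact: (@continuous_comp _ _ _ snd fst _ (@cont_snd _ _ _) (@cont_fst _ _ _)).
      exact: cont_fst.
    exact: (@continuous_comp _ _ _ snd snd _ (@cont_snd _ _ _) (@cont_snd _ _ _)).
  by apply: (@near_all (R * (R * R))%type) => p; exact: reg_slice.
- have D := @avgf_is_derive F (px F) d th X (ex R) rF rx _.
  by case: D => // th' X'; apply: derivableP.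
- have D := @avgf_is_derive F (py F) d th X (ey R) rF ry _.
  by case: D => // th' X'; apply: derivableP.
Qed.

Lemma bnd_avgf b k F : reg F -> bnd b k F -> bnd b k (avgf phi F).
Proof.
move=> rF [n [m h]]; exists n, m => d /h {h}; case: b => h th.
  have := @N2_J R (fun s => F d (phi th s)) 0 1 (scale m k d ^+ 2) ler01 (sqr_ge0 _).
  rewrite subr0 expr1n mulr1; apply=> [p|s]; last exact: h.
  have [cF _ _] := rF d.
  apply: (@cont_comp2 _ R _ _ (F d) (fun p : R * (R * R) => phi th p.1) snd p (cF _) _ (@cont_snd _ _ _)).
  exact: (@continuous_comp _ _ _ fst (phi th) p (@cont_fst _ _ p) (@cphis th _)).
move=> X; have := @J_dist R 0 1 (scale m k d) (fun s => F d (phi th s) X) (fun=> 0) ler01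
  (@reg_slice F d th X rF) (@cC R R 0) _.
rewrite J_cst// mul0r subr0 subr0 mulr1; apply=> s _; rewrite subr0; exact: h.
Qed.

Lemma O_avgf b k F : O b k F -> O b k (avgf phi F).
Proof.
(* One class more than the goal, because differentiating under the integral uses the regularity of
   [px F] and [py F]. *)
move=> H s; move: (H s.+1) => {H}; elim: s F => [|s IH] F HF.
  have [rF bF [[rx _ _] [ry _ _]]] := HF.
  by split; [exact: reg_avgf|exact: bnd_avgf|].
have [rF bF [hx hy]] := HF; have [rx _ _] := hx; have [ry _ _] := hy.
split; [exact: reg_avgf|exact: bnd_avgf|].
by rewrite (px_avgf rF rx) (py_avgf rF ry); split; [exact: IH hx|exact: IH hy].
Qed.

End Operators.

(** * Vertical mean and primitive from the bottom *)

Section Primitive.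
Variable R : realType.
Implicit Types (F G : family R) (d : data R).

Definition clamp (th : R) : R := Num.max 0 (Num.min 1 th).

Lemma clamp_itv th : 0 <= clamp th <= 1.
Proof. by rewrite /clamp le_max lexx ge_max ler01 ge_min lexx. Qed.

Lemma clamp_id th : 0 <= th <= 1 -> clamp th = th.
Proof. by move=> /andP[t0 t1]; rewrite /clamp (min_idPr t1) (max_idPr t0). Qed.

Lemma continuous_clamp : continuous clamp.
Proof.
move=> th.
have c1 : {for th, continuous ((fun=> 1 : R^o) \min (fun t : R => t : R^o))}.
  by apply: (@continuous_min R R); [exact: cont_cst|exact: cont_id].
have c2 : {for th, continuous ((fun=> 0 : R^o) \max ((fun=> 1 : R^o) \min (fun t : R => t : R^o)))}.
  by apply: (@continuous_max R R); [exact: cont_cst|exact: c1].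
exact: c2.
Qed.

Definition avg F : family R := avgf (fun _ s => s) F.
(** The integral of [F] over levels from 0 to [clamp th], rescaled to [[0, 1]]. *)
Definition prim F : family R :=
  fun d th X => clamp th * avgf (fun th s => clamp th * s) F d th X.

Lemma O_clamp : O false 0 (fun (d : data R) th (_ : R * R) => clamp th).
Proof.
apply: (O_theta (f := fun=> clamp)) => [_|]; first exact: continuous_clamp.
exists 0%N => d th; rewrite /scale !expr0 mulr1.
by have /andP[c0 c1] := clamp_itv th; rewrite ger0_norm.
Qed.

Lemma O_avg b k F : O b k F -> O b k (avg F).
Proof. by apply: O_avgf => p; exact: cont_snd. Qed.

Lemma O_prim b k F : O b k F -> O b k (prim F).
Proof.
move=> H; apply: (O_mul O_clamp); apply: O_avgf => // p.
apply: (@cont_comp2 _ R _ _ (fun x y => x * y) (fun p : R * R => clamp p.1) snd p).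
- exact: mul_continuous.
- exact: (@continuous_comp _ _ _ fst clamp p (@cont_fst _ _ p) (@continuous_clamp _)).
- exact: cont_snd.
Qed.

Lemma prim_FTC F G d X : continuous (fun th => F d th X) ->
  continuous (fun th => G d th X) ->
  (forall th : R, 0 < th < 1 -> is_derive th 1 (fun s => F d s X) (G d th X)) ->
  forall th, prim G d th X = F d (clamp th) X - F d 0 X.
Proof.
move=> cF cG dF th; have /andP[c0 c1] := clamp_itv th.
rewrite /prim /avgf; set c := clamp th in c0 c1 *.
have cl : continuous (fun s : R => c * s).
  exact: (@cM R _ (fun=> c) id (@cC _ _ _) (fun s => @cont_id _ s)).
rewrite -JZ; last by move=> s; exact: (@continuous_comp _ _ _ (fun s => c * s) (fun t => G d t X) s (cl _) (cG _)).
have cFc : continuous (fun s => F d (c * s) X).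
  by move=> s; exact: (@continuous_comp _ _ _ (fun s => c * s) (fun t => F d t X) s (cl _) (cF _)).
have cGc : continuous (fun s => c * G d (c * s) X).
  apply: (@cM R _ (fun=> c)); first exact: cC.
  by move=> s; exact: (@continuous_comp _ _ _ (fun s => c * s) (fun t => G d t X) s (cl _) (cG _)).
rewrite -[in F d c X](mulr1 c) -[in F d 0 X](mulr0 c).
apply: (@J_FTC R 0 1 (fun s => F d (c * s) X)) => //.
move=> s /andP[s0 s1]; have [c00|cn0] := eqVneq c 0.
  rewrite c00 mul0r (_ : (fun s => F d (0 * s) X) = cst (F d 0 X)); first exact: is_derive_cst.
  by apply/funext => t; rewrite mul0r.
have cp : 0 < c by rewrite lt_neqAle eq_sym cn0.
rewrite mulrC; apply: (@is_derive1_comp R (fun t => F d t X) (fun s => c * s)).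
  apply: dF; rewrite mulr_gt0//=.
  by rewrite (le_lt_trans _ s1)// ler_piMl// ltW.
have : is_derive s 1 (c *: (@id R)) (c *: 1) by exact: is_deriveZ.
by rewrite /GRing.scale/= mulr1.
Qed.

End Primitive.

(** * Smooth functions on an open set *)

Section Smooth.
Variables (R : realType) (E : normedModType R).
Implicit Types (W : normedModType R).

Lemma near_zero_differentiable W (k : E -> W) p :
  (\forall q \near p, k q = 0) -> differentiable k p.
Proof.
move=> k0; have kp : k p = 0 := nbhs_singleton k0.
have H : k \o shift p = cst (k p) + (\0 : {linear E -> W}) +o_ 0 id.
  apply/eqaddoP => e e0.
  have [r r0 Hr] : exists2 r : R, 0 < r & forall h, `|h| < r -> k (h + p) = 0.
    have /nbhs_ballP[r /= r0 H] := k0; exists r => // h hr; apply: H.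
    by rewrite -ball_normE /= opprD addrCA subrr addr0 normrN.
  apply: filterS (nbhs0_lt r0) => h hr.
  have -> : (k \o shift p - (cst (k p) + (\0 : {linear E -> W}))) h = 0.
    by rewrite -[LHS]/(k (h + p) - (k p + 0)) Hr// kp addr0 subrr.
  by rewrite normr0 mulr_ge0// ltW.
have c0 : continuous (\0 : {linear E -> W}) by move=> x; exact: cvg_cst.
have d0 := diff_unique c0 H.
by apply/diff_locallyP; split; rewrite d0; [exact: c0|exact: H].
Qed.

(** Differentiability depends only on the germ: [g - f] vanishes near [p], so its differential there
    is zero. *)
Lemma near_eq_differentiable W (f g : E -> W) p :
  (\forall q \near p, f q = g q) -> differentiable f p -> differentiable g p.
Proof.
move=> fg df; have -> : g = f + (g - f) by rewrite addrC subrK.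
apply: differentiableD; first exact: df.
apply: near_zero_differentiable.
by apply: filterS fg => q e; rewrite -[LHS]/(g q - f q) e subrr.
Qed.

Definition iter_derive W (f : E -> W) (vs : seq E) : E -> W :=
  foldr (fun v (g : E -> W) => 'D_v g) f vs.

Definition smooth W (O : set E) (f : E -> W) :=
  forall vs p, O p -> differentiable (iter_derive f vs) p.

Variable O : set E.
Hypothesis oO : open O.

Let nearO p : O p -> \forall q \near p, O q.
Proof. by move=> Op; exact: open_nbhs_nbhs. Qed.

Lemma eq_on_derive W (f g : E -> W) v p : (forall q, O q -> f q = g q) -> O p ->
  'D_v f p = 'D_v g p.
Proof. by move=> fg Op; apply: near_eq_derive; apply: filterS (nearO Op). Qed.

Lemma eq_on_iterate W (f g : E -> W) a v p : (forall q, O q -> f q = g q) -> O p ->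
  iter a (fun k : E -> W => 'D_v k) f p = iter a (fun k : E -> W => 'D_v k) g p.
Proof.
by move=> fg; elim: a p => [|a IH] p Op /=; [exact: fg|exact: eq_on_derive].
Qed.

Lemma smooth_derive W (f : E -> W) v : smooth O f -> smooth O ('D_v f).
Proof. by move=> sf vs p Op; have := sf (rcons vs v) p Op; rewrite /iter_derive foldr_rcons. Qed.

Lemma smooth_iter W (f : E -> W) a v : smooth O f -> smooth O (iter a (fun g : E -> W => 'D_v g) f).
Proof. by move=> sf; elim: a => //= a; exact: smooth_derive. Qed.

Lemma smooth_diff W (f : E -> W) p : smooth O f -> O p -> differentiable f p.
Proof. by move=> sf; exact: (sf [::]). Qed.

Lemma smooth_derivable W (f : E -> W) p v : smooth O f -> O p -> derivable f p v.
Proof. by move=> sf Op; apply: diff_derivable; exact: smooth_diff. Qed.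

Lemma smooth_cont W (f : E -> W) p : smooth O f -> O p -> {for p, continuous f}.
Proof. by move=> sf Op; apply: differentiable_continuous; exact: smooth_diff. Qed.

Lemma smooth_schwarz (f : E -> R) u v p : smooth O f -> O p ->
  'D_v ('D_u f) p = 'D_u ('D_v f) p.
Proof.
move=> sf Op; have sv := smooth_derive v sf; have su := smooth_derive u sf.
apply: schwarz.
- apply: filterS (nearO Op) => q Oq.
  by split; [exact: smooth_derivable sf Oq|exact: smooth_derivable sf Oq
            |exact: smooth_derivable su Oq|exact: smooth_derivable sv Oq].
- exact: smooth_cont (smooth_derive v su) Op.
- exact: smooth_cont (smooth_derive u sv) Op.
Qed.

Lemma derive_iter_comm (f : E -> R) u v a p : smooth O f -> O p ->
  'D_u (iter a (fun g : E -> R => 'D_v g) f) p = iter a (fun g : E -> R => 'D_v g) ('D_u f) p.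
Proof.
move=> sf; elim: a p => [//|a IH] p Op /=.
rewrite (smooth_schwarz _ _ (smooth_iter a v sf) Op).
exact: eq_on_derive.
Qed.

Lemma diff_linear_comp W W' (l : {linear W -> W'}) (f : E -> W) p v :
  continuous l -> differentiable f p ->
  differentiable (l \o f) p /\ 'D_v (l \o f) p = l ('D_v f p).
Proof.
move=> cl df; have dl := linear_differentiable (f p) cl.
split; first exact: differentiable_comp.
by rewrite !deriveE//; [rewrite diff_comp//= diff_lin|exact: differentiable_comp].
Qed.

Lemma iter_linear_comp W W' (l : {linear W -> W'}) (f : E -> W) vs p :
  continuous l -> smooth O f -> O p -> iter_derive (l \o f) vs p = l (iter_derive f vs p).
Proof.
move=> cl sf; elim: vs p => [//|v vs IH] p Op /=.
rewrite (@eq_on_derive _ _ (l \o iter_derive f vs) v p IH Op).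
by have [_] := @diff_linear_comp _ _ l _ p v cl (sf vs p Op).
Qed.

Lemma smooth_linear_comp W W' (l : {linear W -> W'}) (f : E -> W) :
  continuous l -> smooth O f -> smooth O (l \o f).
Proof.
move=> cl sf vs p Op.
have [] := @diff_linear_comp _ _ l _ p 0 cl (sf vs p Op) => H _.
apply: near_eq_differentiable H; apply: filterS (nearO Op) => q Oq.
by rewrite iter_linear_comp.
Qed.

Lemma iter_pair W W' (f : E -> W) (g : E -> W') vs p : smooth O f -> smooth O g -> O p ->
  iter_derive (fun q => (f q, g q)) vs p = (iter_derive f vs p, iter_derive g vs p).
Proof.
move=> sf sg; elim: vs p => [//|v vs IH] p Op /=.
rewrite (@eq_on_derive _ _ (fun q => (iter_derive f vs q, iter_derive g vs q)) v p IH Op).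
have df := sf vs p Op; have dg := sg vs p Op.
by rewrite !deriveE//; [rewrite diff_pair|exact: differentiable_pair].
Qed.

Lemma smooth_pair W W' (f : E -> W) (g : E -> W') : smooth O f -> smooth O g ->
  smooth O (fun q => (f q, g q)).
Proof.
move=> sf sg vs p Op.
have H := differentiable_pair (sf vs p Op) (sg vs p Op).
apply: near_eq_differentiable H; apply: filterS (nearO Op) => q Oq.
by rewrite iter_pair.
Qed.

End Smooth.

(** * Directional derivatives of pairs and compositions *)

Section Curves.
Variables (R : realType) (E E' : normedModType R).

Lemma is_derive_pair (V W : normedModType R) (f : E -> V) (g : E -> W) q v a b :
  is_derive q v f a -> is_derive q v g b -> is_derive q v (fun x => (f x, g x)) (a, b).
Proof.
move=> [df ea] [dg eb].
have H : h^-1 *: ((f (h *: v + q), g (h *: v + q)) - (f q, g q)) @[h --> 0^'] --> (a, b).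
  apply: cvg_pair => /=.
    by rewrite -ea; exact: df.
  by rewrite -eb; exact: dg.
by apply: DeriveDef; [exact/cvgP/H|exact/cvg_lim/H].
Qed.

(** [c] is only known to be derivable along [v]. On the line through [q] it becomes a function of
    one real variable, where derivable means differentiable, and the usual chain rule applies. *)
Lemma is_derive_comp (W : normedModType R) (f : E' -> W) (c : E -> E') q v w :
  differentiable f (c q) -> is_derive q v c w -> is_derive q v (f \o c) ('D_w f (c q)).
Proof.
move=> df [dc ec].
pose c1 (r : R) := c (r *: v + q).
have d1 : differentiable c1 0 by apply/derivable1_diffP; move/derivable1P: dc.
have e1 : 'D_1 c1 0 = w.
  have Q : (fun h : R => h^-1 *: ((c1 \o shift 0) (h *: 1) - c1 0)) =
           (fun h => h^-1 *: ((c \o shift q) (h *: v) - c q)).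
    by apply/funext => h /=; rewrite /c1 addr0 [h *: 1]mulr1 scale0r add0r.
  by rewrite -ec /derive Q.
have c10 : c1 0 = c q by rewrite /c1 scale0r add0r.
have df' : differentiable f (c1 0) by rewrite c10.
have dfc : differentiable (f \o c1) 0 by exact: differentiable_comp.
have e2 : 'D_1 (f \o c1) 0 = 'D_w f (c q).
  by rewrite deriveE// diff_comp//= -(deriveE (1 : R) d1) e1 -(deriveE w df') c10.
apply: DeriveDef.
  by apply/derivable1P; apply/derivable1_diffP.
have Q : (fun h : R => h^-1 *: ((f \o c1 \o shift 0) (h *: 1) - (f \o c1) 0)) =
         (fun h => h^-1 *: ((f \o c \o shift q) (h *: v) - (f \o c) q)).
  by apply/funext => h /=; rewrite /c1 addr0 [h *: 1]mulr1 scale0r add0r.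
by rewrite -e2 /derive Q.
Qed.

End Curves.

(** * Smoothness up to the boundary *)

Section SmoothOn.
Variables (R : realType) (E : normedModType R).
Variable D : set E.

Lemma smooth_onP (W : normedModType R) (f : E -> W) :
  smooth_on D f <-> exists O, [/\ open O, D `<=` O & smooth O f].
Proof. by []. Qed.

Lemma smooth_on_derive (W : normedModType R) (f : E -> W) v : smooth_on D f -> smooth_on D ('D_v f).
Proof.
move=> /smooth_onP[U [oU DU sf]]; apply/smooth_onP.
by exists U; split; [exact: oU|exact: DU|exact: smooth_derive].
Qed.

Lemma smooth_on_iter (W : normedModType R) (f : E -> W) a v :
  smooth_on D f -> smooth_on D (iter a (fun g : E -> W => 'D_v g) f).
Proof. by move=> sf; elim: a => //= a; exact: smooth_on_derive. Qed.

Lemma smooth_on_diff (W : normedModType R) (f : E -> W) p : smooth_on D f -> D p -> differentiable f p.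
Proof. by move=> /smooth_onP[U [oU DU sf]] /DU Up; exact: smooth_diff sf Up. Qed.

Lemma smooth_on_derivable (W : normedModType R) (f : E -> W) p v : smooth_on D f -> D p -> derivable f p v.
Proof. by move=> sf Dp; apply: diff_derivable; exact: smooth_on_diff. Qed.

Lemma smooth_on_cont (W : normedModType R) (f : E -> W) p : smooth_on D f -> D p -> {for p, continuous f}.
Proof. by move=> sf Dp; apply: differentiable_continuous; exact: smooth_on_diff. Qed.

Lemma smooth_on_schwarz (f : E -> R) u v p : smooth_on D f -> D p ->
  'D_v ('D_u f) p = 'D_u ('D_v f) p.
Proof. by move=> /smooth_onP[U [oU DU sf]] /DU Up; exact: (smooth_schwarz oU). Qed.

Lemma smooth_on_iter_comm (f : E -> R) u v a p : smooth_on D f -> D p ->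
  'D_u (iter a (fun g : E -> R => 'D_v g) f) p = iter a (fun g : E -> R => 'D_v g) ('D_u f) p.
Proof. by move=> /smooth_onP[U [oU DU sf]] /DU Up; exact: (derive_iter_comm oU). Qed.

Lemma smooth_on_linear_comp (W W' : normedModType R) (l : {linear W -> W'}) (f : E -> W) :
  continuous l -> smooth_on D f -> smooth_on D (l \o f).
Proof.
move=> cl /smooth_onP[U [oU DU sf]]; apply/smooth_onP.
by exists U; split; [exact: oU|exact: DU|exact: smooth_linear_comp].
Qed.

Lemma derive_linear_comp (W W' : normedModType R) (l : {linear W -> W'}) (f : E -> W) v p :
  continuous l -> smooth_on D f -> D p -> 'D_v (l \o f) p = l ('D_v f p).
Proof.
move=> cl sf Dp.
by have [] := @diff_linear_comp _ _ _ _ l f p v cl (smooth_on_diff sf Dp).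
Qed.

End SmoothOn.

(** * Flattened coordinates *)

Section Flatten.
Variable R : realType.
Implicit Types (d : data R).

Definition ffield := data R -> sp3 R -> R.
Definition sfield := data R -> sp2 R -> R.
Implicit Types (f : ffield) (g : sfield).

Definition fluid d := fluid_closure (dP d) (dS d) (dI d).
Definition surface d : set (sp2 R) := dI d `*` [set: vec2 R].
Definition sfluid f := forall d, smooth_on (fluid d) (f d).
Definition ssurf g := forall d, smooth_on (surface d) (g d).

Definition h d (p : sp2 R) : R := depth (dP d) (dS d) p.

(* [th = 0] is the bottom and [th = 1] the free surface; clamping [th] makes
   [flat f] continuous on the whole of R * R^2. *)
Definition level d (th : R) (p : sp2 R) : sp3 R := (p.1, (p.2, -1 + clamp th * h d p)).

Definition flat f : family R := fun d th X => f d (level d th (dt d, X)).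
Definition surf g : family R := fun d _ X => g d (dt d, X).

Definition zetaf : sfield := fun d => zeta (dS d).

Lemma ssurf_zeta : ssurf zetaf.
Proof. by move=> d; have [[]] := system d. Qed.

Lemma h_ge d p : dI d p.1 -> dhmin d <= h d p.
Proof. by case: p => t X It; have [_ /(_ t It)[hm _ _ _ _]] := system d; exact: hm. Qed.

Lemma h_gt0 d p : dI d p.1 -> 0 < h d p.
Proof. by move=> /h_ge; exact/lt_le_trans/hmin_gt0. Qed.

Lemma level_fluid d th p : dI d p.1 -> fluid d (level d th p).
Proof.
move=> Ip; have h0 := ltW (h_gt0 Ip); have /andP[c0 c1] := clamp_itv th.
split=> //=; split; first by rewrite lerDl mulr_ge0.
have -> : eps (dP d) * zeta (dS d) (p.1, p.2) = -1 + h d p.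
  by rewrite /h /depth -surjective_pairing addrA addNr add0r.
by rewrite lerD2l ler_piMl.
Qed.

Lemma near_surface_h d v p : dI d p.1 -> is_derive p v (h d) (eps (dP d) * 'D_v (zetaf d) p).
Proof.
move=> Ip; have dz : derivable (zetaf d) p v.
  exact: (@smooth_on_derivable R _ (surface d) _ (zetaf d) p v (ssurf_zeta d) (conj Ip Logic.I)).
have D := derivableP dz.
have : is_derive p v (cst 1 + eps (dP d) *: zetaf d) (0 + eps (dP d) *: 'D_v (zetaf d) p).
  by apply: is_deriveD; apply: is_deriveZ.
by rewrite add0r.
Qed.

Lemma is_derive_fst (U V : normedModType R) (p v : U * V) : is_derive p v fst v.1.
Proof.
have cf : continuous (fst : {linear (U * V)%type -> U}) by move=> x; exact: cvg_fst.
have df := linear_differentiable p cf.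
by apply: DeriveDef; [exact: diff_derivable|rewrite deriveE// diff_lin].
Qed.

Lemma is_derive_snd (U V : normedModType R) (p v : U * V) : is_derive p v snd v.2.
Proof.
have cf : continuous (snd : {linear (U * V)%type -> V}) by move=> x; exact: cvg_snd.
have df := linear_differentiable p cf.
by apply: DeriveDef; [exact: diff_derivable|rewrite deriveE// diff_lin].
Qed.

Lemma is_derive_level d th p v : dI d p.1 ->
  is_derive p v (level d th) (v.1, (v.2, clamp th * (eps (dP d) * 'D_v (zetaf d) p))).
Proof.
move=> Ip; apply: is_derive_pair; first exact: is_derive_fst.
apply: is_derive_pair; first exact: is_derive_snd.
have D := near_surface_h v Ip.
have : is_derive p v (cst (-1) + clamp th *: h d) (0 + clamp th *: (eps (dP d) * 'D_v (zetaf d) p)).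
  by apply: is_deriveD; apply: is_deriveZ.
by rewrite add0r.
Qed.

Definition ez3 : sp3 R := (0, ((0, 0), 1)).

Lemma derive_split (F : sp3 R -> R) q (a : R) (u : vec2 R) (k : R) : differentiable F q ->
  'D_((a, (u, k)) : sp3 R) F q = 'D_((a, (u, 0)) : sp3 R) F q + k * dz3 F q.
Proof.
move=> dF; rewrite /dz3 !deriveE//.
have -> : (a, (u, k)) = (a, (u, 0)) + k *: ez3 :> sp3 R.
  apply: injective_projections => /=; first by rewrite [k *: 0]mulr0 addr0.
  apply: injective_projections => /=; last by rewrite [k *: 1]mulr1 add0r.
  by apply: injective_projections => /=; rewrite [k *: 0]mulr0 addr0.
by rewrite linearD linearZ.
Qed.

Lemma is_derive_flat_level f d th p v : sfluid f -> dI d p.1 ->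
  is_derive p v (f d \o level d th)
    ('D_((v.1, (v.2, 0)) : sp3 R) (f d) (level d th p)
     + clamp th * (eps (dP d) * 'D_v (zetaf d) p) * dz3 (f d) (level d th p)).
Proof.
move=> sf Ip; have df := smooth_on_diff (sf d) (level_fluid th Ip).
rewrite -(derive_split _ _ _ df); apply: (is_derive_comp df).
exact: is_derive_level.
Qed.

Lemma is_derive_slice (F : sp2 R -> R) t X (v : vec2 R) a :
  is_derive (t, X) ((0, v) : sp2 R) F a -> is_derive X v (fun Y => F (t, Y)) a.
Proof.
move=> [dF eF].
have Q : (fun k : R => k^-1 *: (F (k *: ((0, v) : sp2 R) + (t, X)) - F (t, X))) =
   (fun k : R => k^-1 *: (F (t, k *: v + X) - F (t, X))).
  apply/funext => k; congr (_ *: (F _ - _)).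
  by apply: injective_projections => //=; rewrite [k *: 0]mulr0 add0r.
by apply: DeriveDef; [rewrite /derivable /= -Q; exact: dF|rewrite /derive /= -Q -eF].
Qed.

Lemma surf_is_derive g d th X (v : vec2 R) : ssurf g ->
  is_derive X v (surf g d th) ('D_((0, v) : sp2 R) (g d) (dt d, X)).
Proof.
move=> sg; apply: is_derive_slice; apply: derivableP.
exact: (@smooth_on_derivable R _ (surface d) _ (g d) (dt d, X) _ (sg d) (conj (dI_dt d) Logic.I)).
Qed.

Lemma flat_is_derive f d th X (v : vec2 R) : sfluid f ->
  is_derive X v (flat f d th)
    ('D_((0, (v, 0)) : sp3 R) (f d) (level d th (dt d, X))
     + clamp th * (eps (dP d) * 'D_((0, v) : sp2 R) (zetaf d) (dt d, X)) *
       dz3 (f d) (level d th (dt d, X))).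
Proof.
move=> sf; apply: (@is_derive_slice (f d \o level d th)).
exact: (@is_derive_flat_level f d th (dt d, X) (0, v) sf (dI_dt d)).
Qed.

Lemma cont_surf g d : ssurf g -> continuous (fun X => g d (dt d, X)).
Proof.
move=> sg X.
have c0 : {for (dt d, X), continuous (g d)}.
  exact: (@smooth_on_cont R _ (surface d) _ (g d) (dt d, X) (sg d) (conj (dI_dt d) Logic.I)).
apply: (@continuous_comp _ _ _ (fun X => (dt d, X)) (g d) X _ c0).
exact: cont_pair (@cont_cst _ _ _ _) (@cont_id _ _).
Qed.

Lemma reg_surf g : ssurf g -> reg (surf g).
Proof.
move=> sg d; split=> [p|th X|th X].
- apply: (@continuous_comp _ _ _ snd (fun X => g d (dt d, X)) p (@cont_snd _ _ p)).
  exact: cont_surf.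
- by have [] := surf_is_derive d th X (ex R) sg.
- by have [] := surf_is_derive d th X (ey R) sg.
Qed.

Lemma px_surf g : ssurf g -> px (surf g) = surf (fun d => dx2 (g d)).
Proof.
move=> sg; apply/funext => d; apply/funext => th; apply/funext => X.
by have [] := surf_is_derive d th X (ex R) sg.
Qed.

Lemma py_surf g : ssurf g -> py (surf g) = surf (fun d => dy2 (g d)).
Proof.
move=> sg; apply/funext => d; apply/funext => th; apply/funext => X.
by have [] := surf_is_derive d th X (ey R) sg.
Qed.

Lemma cont_h d : continuous (fun X => h d (dt d, X)).
Proof.
have cz := @cont_surf zetaf d ssurf_zeta.
exact: (cD (@cC R _ 1) (cM (@cC R _ (eps (dP d))) cz)).
Qed.

Lemma cont_level d : continuous (fun p : R * vec2 R => level d p.1 (dt d, p.2)).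
Proof.
have c1 : continuous (fun p : R * vec2 R => clamp p.1).
  by move=> q; exact: (@continuous_comp _ _ _ fst (@clamp R) q (@cont_fst _ _ q) (@continuous_clamp R q.1)).
have c2 : continuous (fun p : R * vec2 R => h d (dt d, p.2)).
  by move=> q; exact: (@continuous_comp _ _ _ snd (fun X => h d (dt d, X)) q (@cont_snd _ _ q) (@cont_h d q.2)).
have c3 := cD (@cC R _ (-1)) (cM c1 c2).
move=> p.
exact: (cont_pair (@cont_cst _ _ (dt d) p) (cont_pair (@cont_snd _ _ p) (c3 p))).
Qed.

Lemma cont_flat f d : sfluid f -> continuous (fun p : R * vec2 R => flat f d p.1 p.2).
Proof.
move=> sf p.
apply: (@continuous_comp _ _ _ (fun p : R * vec2 R => level d p.1 (dt d, p.2)) (f d) p (@cont_level d p)).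
apply: (@smooth_on_cont R _ (fluid d) _ (f d) _ (sf d)); apply: level_fluid; exact: dI_dt.
Qed.

Lemma reg_flat f : sfluid f -> reg (flat f).
Proof.
move=> sf d; split=> [|th X|th X].
- exact: cont_flat.
- by have [] := flat_is_derive d th X (ex R) sf.
- by have [] := flat_is_derive d th X (ey R) sf.
Qed.

(** The chain-rule correction for differentiating at fixed level instead of fixed height: [Z] is a
    derivative of [zeta] and [F] a vertical derivative. *)
Definition shear : family R -> family R -> family R := fun Z F d th X =>
  clamp th * (eps (dP d) * Z d th X) * F d th X.

Lemma px_flat f : sfluid f -> px (flat f) = fun d th X =>
  flat (fun d => dx3 (f d)) d th X
  + shear (surf (fun d => dx2 (zetaf d))) (flat (fun d => dz3 (f d))) d th X.
Proof.
move=> sf; apply/funext => d; apply/funext => th; apply/funext => X.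
by have [] := flat_is_derive d th X (ex R) sf.
Qed.

Lemma py_flat f : sfluid f -> py (flat f) = fun d th X =>
  flat (fun d => dy3 (f d)) d th X
  + shear (surf (fun d => dy2 (zetaf d))) (flat (fun d => dz3 (f d))) d th X.
Proof.
move=> sf; apply/funext => d; apply/funext => th; apply/funext => X.
by have [] := flat_is_derive d th X (ey R) sf.
Qed.

Lemma is_derive_vertical f d X (z : R) : sfluid f ->
  -1 <= z <= eps (dP d) * zeta (dS d) (dt d, X) ->
  is_derive z 1 (fun s => f d (dt d, (X, s))) (dz3 (f d) (dt d, (X, z))).
Proof.
move=> sf /andP[z0 z1].
have Fz : fluid d (dt d, (X, z)) by split; [exact: dI_dt|].
have df := smooth_on_diff (sf d) Fz.
have dc : is_derive z 1 (fun s : R => (dt d, (X, s))) (0, (0, 1)).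
  by apply: is_derive_pair; apply: is_derive_pair.
exact: (is_derive_comp df dc).
Qed.

Lemma is_derive_flat_theta f d X (th : R) : sfluid f -> 0 < th < 1 ->
  is_derive th 1 (fun s => flat f d s X)
    (h d (dt d, X) * flat (fun d => dz3 (f d)) d th X).
Proof.
move=> sf /andP[t0 t1].
have It := dI_dt d.
have Fl := @level_fluid d th (dt d, X) It.
have cth : clamp th = th by rewrite clamp_id// !ltW.
have D : is_derive th 1 (fun s => f d (dt d, (X, -1 + s * h d (dt d, X))))
    (dz3 (f d) (dt d, (X, -1 + th * h d (dt d, X))) * h d (dt d, X)).
  apply: (@is_derive1_comp R (fun z => f d (dt d, (X, z))) (fun s => -1 + s * h d (dt d, X))).
    apply: is_derive_vertical => //; case: Fl => _ /= [].
    by rewrite cth => a b; apply/andP; split.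
  have : is_derive th 1 (cst (-1) + h d (dt d, X) *: (@id R)) (0 + h d (dt d, X) *: 1).
    by apply: is_deriveD; apply: is_deriveZ.
  rewrite add0r [_ *: 1]mulr1 (_ : cst (-1) + _ = fun s => -1 + s * h d (dt d, X))//.
  by apply/funext => s; rewrite mulrC.
have e : flat (fun d => dz3 (f d)) d th X = dz3 (f d) (dt d, (X, -1 + th * h d (dt d, X))).
  by rewrite /flat /level /= cth.
rewrite mulrC e.
apply: near_eq_is_derive D.
have oi : open (`]0, 1[%classic : set R) by exact: interval_open.
have : nbhs th `]0, 1[%classic by apply: open_nbhs_nbhs; split => //=; rewrite in_itv/= t0 t1.
apply: filterS => s; rewrite /= in_itv/= => /andP[s0 s1].
by rewrite /flat /level/= clamp_id// !ltW.
Qed.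

Lemma flat_prim f d th X : sfluid f ->
  prim (fun d th X => h d (dt d, X) * flat (fun d => dz3 (f d)) d th X) d th X
  = flat f d th X - flat f d 0 X.
Proof.
move=> sf; have sz : sfluid (fun d => dz3 (f d)) by move=> d'; exact: smooth_on_derive.
have cf (f' : ffield) : sfluid f' -> continuous (fun s => flat f' d s X).
  by move=> sf'; exact: (@reg_cont1 R (flat f') d X (reg_flat sf')).
have cz : continuous (fun s => h d (dt d, X) * flat (fun d => dz3 (f d)) d s X).
  exact: cM (@cC _ _ _) (cf _ sz).
apply: (etrans (@prim_FTC R (flat f) _ d X (cf _ sf) cz _ th)).
  by move=> s s01; exact: is_derive_flat_theta.
by rewrite /flat /level (@clamp_id _ (clamp th))// clamp_itv.
Qed.

End Flatten.

(** * Orders of the parameters in the Boussinesq regime *)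

Section Orders.
Variable R : realType.
Implicit Types d : data R.

Lemma regimeP d : let P := dP d in
  [/\ 0 < mu P, 0 < eps P, 0 < gam P & 0 < Ro P] /\
  [/\ eps P <= kap d * mu P, gam P <= 1 & eps P / Ro P <= kap d * nu d].
Proof.
have [[m0 e0 g0 r0] [mm em g1 er]] := regime d; have [_ _ _ kM] := le_kap d.
split => //; split => //.
  by apply: (le_trans em); rewrite ler_wpM2r// ltW.
by apply: (le_trans er); rewrite ler_wpM2r// sqrtr_ge0.
Qed.

Lemma order_mul k l (a b : data R -> R) : order k a -> order l b -> order (k + l) (fun d => a d * b d).
Proof.
move=> [m ha] [m' hb]; exists (m + m')%N => d.
by rewrite normrM -scaleM ler_pM.
Qed.

Lemma order_cst (c : R) : `|c| <= 2 -> order 0 (fun _ : data R => c).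
Proof.
by move=> c2; exists 1%N => d; rewrite /scale expr1 expr0 mulr1 (le_trans c2)// kap_ge2.
Qed.

Lemma order_nu : order 1 (@nu R).
Proof.
exists 0%N => d; rewrite /scale expr1 expr0 mul1r ger0_norm//.
exact/ltW/nu_gt0.
Qed.

Lemma order_mu : order 2 (fun d => mu (dP d)).
Proof.
exists 0%N => d; rewrite /scale expr0 mul1r nu2 ger0_norm//; exact/ltW/mu_gt0.
Qed.

Lemma order_eps : order 2 (fun d => eps (dP d)).
Proof.
exists 1%N => d; rewrite /scale expr1 nu2.
by have [[_ e0 _ _] [em _ _]] := regimeP d; rewrite ger0_norm// ltW.
Qed.

Lemma order_gam : order 0 (fun d => gam (dP d)).
Proof.
exists 0%N => d; rewrite /scale !expr0 mulr1.
by have [[_ _ g0 _] [_ g1 _]] := regimeP d; rewrite ger0_norm// ltW.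
Qed.

(** An order is an upper bound and cannot be divided, so each quotient that occurs is estimated
    directly from the regime. *)
Lemma order_eps_mu : order 0 (fun d => eps (dP d) / mu (dP d)).
Proof.
exists 1%N => d; rewrite /scale expr1 expr0 mulr1.
have [[m0 e0 _ _] [em _ _]] := regimeP d; rewrite ger0_norm; last by rewrite divr_ge0 // ltW.
by rewrite ler_pdivrMr.
Qed.

Lemma order_eps_nu : order 1 (fun d => eps (dP d) / nu d).
Proof.
exists 1%N => d; rewrite /scale !expr1; have n0 := nu_gt0 d.
have [[m0 e0 _ _] [em _ _]] := regimeP d; rewrite ger0_norm; last by rewrite divr_ge0 // ltW.
by rewrite ler_pdivrMr// -mulrA -expr2 nu2.
Qed.

Lemma order_eps_Ro : order 1 (fun d => eps (dP d) / Ro (dP d)).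
Proof.
exists 1%N => d; rewrite /scale !expr1.
have [[_ e0 _ r0] [_ _ er]] := regimeP d; rewrite ger0_norm//; by rewrite divr_ge0 // ltW.
Qed.

Lemma order_eps_nu_Ro : order 0 (fun d => eps (dP d) / Ro (dP d) / nu d).
Proof.
exists 1%N => d; rewrite /scale !expr1 expr0 mulr1; have n0 := nu_gt0 d.
have [[_ e0 _ r0] [_ _ er]] := regimeP d.
rewrite ger0_norm; last by rewrite !divr_ge0 // ltW.
by rewrite ler_pdivrMr.
Qed.

End Orders.

(** * Classes of the surface fields *)

Section Surface.
Variable R : realType.
Implicit Types (d : data R) (g : sfield R).

Lemma term_of_sum (T : nat -> \bar R) n (p : pred nat) a : (forall a, 0 <= T a)%E ->
  (a < n)%N -> p a -> (T a <= \sum_(i < n | p i) T i)%E.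
Proof.
move=> T0 an pa; rewrite (bigD1 (Ordinal an))//=.
by rewrite leeDl// sume_ge0.
Qed.

Lemma sqrte_le (X : \bar R) (A : R) : (0 <= X)%E -> (sqrte X <= A%:E)%E -> (X <= (A ^+ 2)%:E)%E.
Proof.
case: X => [x| |]//=; rewrite !lee_fin => x0 xA.
have A0 : 0 <= A := le_trans (sqrtr_ge0 x) xA.
rewrite -(sqr_sqrtr x0); apply: lerXn2r => //; rewrite nnegrE ?sqrtr_ge0//.
Qed.

Lemma Hnorm2_term (W : normedModType R) (q : W -> R) n (f : sp2 R -> W) t A a b :
  (forall w, 0 <= q w) -> (Hnorm2 q n f t <= A%:E)%E -> (a + b <= n)%N ->
  (\int[lebesgue_measure \x lebesgue_measure]_(X in [set: vec2 R])
      (q (iter a dx2 (iter b dy2 f) (t, X)))%:E <= (A ^+ 2)%:E)%E.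
Proof.
move=> q0 H abn.
pose T a b := (\int[lebesgue_measure \x lebesgue_measure]_(X in [set: vec2 R])
      (q (iter a dx2 (iter b dy2 f) (t, X)))%:E)%E.
have T0 i j : (0 <= T i j)%E by apply: integral_ge0 => X _; rewrite lee_fin.
have S0 i : (0 <= \sum_(b < n.+1 | (i + b <= n)%N) T i b)%E by exact: sume_ge0.
apply: (@le_trans _ _ (\sum_(a < n.+1) \sum_(b < n.+1 | (a + b <= n)%N) T a b)%E).
  apply: (@le_trans _ _ (\sum_(b < n.+1 | (a + b <= n)%N) T a b)%E).
    apply: (@term_of_sum (T a) n.+1 (fun b => a + b <= n)%N b) => //.
    by rewrite ltnS (leq_trans _ abn)// leq_addl.
  apply: (@term_of_sum (fun a => \sum_(b < n.+1 | (a + b <= n)%N) T a b)%E n.+1 xpredT) => //.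
  by rewrite ltnS (leq_trans _ abn)// leq_addr.
by apply: sqrte_le; [exact: sume_ge0|exact: H].
Qed.

Lemma Hnorm3_term (W : normedModType R) (q : W -> R) n Om (f : sp3 R -> W) t A a b c :
  (forall w, 0 <= q w) -> (Hnorm3 q n Om f t <= A%:E)%E -> (a + b + c <= n)%N ->
  (\int[(lebesgue_measure \x lebesgue_measure) \x lebesgue_measure]_(Q in Om)
      (q (iter a dx3 (iter b dy3 (iter c dz3 f)) (t, Q)))%:E <= (A ^+ 2)%:E)%E.
Proof.
move=> q0 H abn.
pose T a b c := (\int[(lebesgue_measure \x lebesgue_measure) \x lebesgue_measure]_(Q in Om)
      (q (iter a dx3 (iter b dy3 (iter c dz3 f)) (t, Q)))%:E)%E.
have T0 i j k : (0 <= T i j k)%E by apply: integral_ge0 => X _; rewrite lee_fin.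
have S0 i j : (0 <= \sum_(c < n.+1 | (i + j + c <= n)%N) T i j c)%E by exact: sume_ge0.
have S00 i : (0 <= \sum_(b < n.+1) \sum_(c < n.+1 | (i + b + c <= n)%N) T i b c)%E by exact: sume_ge0.
have bn : (b <= n)%N by rewrite (leq_trans _ abn)// addnAC leq_addl.
have cn : (c <= n)%N by rewrite (leq_trans _ abn)// leq_addl.
have an : (a <= n)%N by rewrite (leq_trans _ abn)// -addnA leq_addr.
apply: (@le_trans _ _ (\sum_(a < n.+1) \sum_(b < n.+1) \sum_(c < n.+1 | (a + b + c <= n)%N) T a b c)%E).
  apply: (@le_trans _ _ (\sum_(b < n.+1) \sum_(c < n.+1 | (a + b + c <= n)%N) T a b c)%E).
    apply: (@le_trans _ _ (\sum_(c < n.+1 | (a + b + c <= n)%N) T a b c)%E).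
      exact: (@term_of_sum (T a b) n.+1 (fun c => a + b + c <= n)%N c).
    exact: (@term_of_sum (fun b => \sum_(c < n.+1 | (a + b + c <= n)%N) T a b c)%E n.+1 xpredT).
  exact: (@term_of_sum (fun a => \sum_(b < n.+1) \sum_(c < n.+1 | (a + b + c <= n)%N) T a b c)%E n.+1 xpredT).
by apply: sqrte_le; [exact: sume_ge0|exact: H].
Qed.

Definition bounded_field g := forall n d, bounded n d -> (Hnorm2 sq1 n (g d) (dt d) <= (dA d)%:E)%E.

Lemma sqA_le d : 0 <= dA d -> (dA d) ^+ 2 <= scale 1 0 d ^+ 2.
Proof.
move=> A0; have [kA _ _ _] := le_kap d.
by rewrite /scale expr0 mulr1 expr1 lerXn2r// nnegrE// (le_trans A0).
Qed.

Lemma bounded_A_ge0 d n : bounded n d -> 0 <= dA d.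
Proof.
move=> /(_ _ (dI_dt d))[[H _ _ _ _] _].
by rewrite -lee_fin; apply: le_trans H; exact: sqrte_ge0.
Qed.

(** The norm bounds derivatives taken in [y] first and in [x] last; Schwarz brings every mixed
    derivative to this form [N a b]. *)
Lemma O_surf_base g : ssurf g -> bounded_field g -> O true 0 (surf g).
Proof.
move=> sg bg s.
pose N a b : sfield R := fun d => iter a dx2 (iter b dy2 (g d)).
have sN a b : ssurf (N a b) by move=> d; do 2 apply: smooth_on_iter; exact: sg.
have bN a b : bnd true 0 (surf (N a b)).
  exists (a + b)%N, 1%N => d B th.
  apply: (le_trans (@Hnorm2_term _ sq1 _ _ _ _ a b _ (bg _ _ B) (leqnn _))).
    by move=> w; exact: sqr_ge0.
  by rewrite lee_fin; apply: sqA_le; exact: bounded_A_ge0 B.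
have xN a b : px (surf (N a b)) = surf (N a.+1 b) by exact: px_surf.
have yN a b : py (surf (N a b)) = surf (N a b.+1).
  rewrite py_surf//; apply/funext => d; apply/funext => th; apply/funext => X.
  have Dp : surface d (dt d, X) by split; [exact: dI_dt|].
  rewrite /surf /N /dy2; apply: (smooth_on_iter_comm _ _ _ _ Dp).
  exact: smooth_on_iter (sg d).
suff H a b : cls true 0 s (surf (N a b)) by exact: (H 0%N 0%N).
elim: s a b => [|s IH] a b; first by split; [exact: reg_surf|exact: bN|].
split; [exact: reg_surf|exact: bN|].
by rewrite xN yN; split; exact: IH.
Qed.

Lemma O_zeta : O true 0 (surf (@zetaf R)).
Proof.
apply: O_surf_base; first exact: ssurf_zeta.
by move=> n d /(_ _ (dI_dt d))[[]].
Qed.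

Definition dt_zetaf : sfield R := fun d => dt2 (zeta (dS d)).

Lemma ssurf_dt_zeta : ssurf dt_zetaf.
Proof. by move=> d; apply: smooth_on_derive; exact: ssurf_zeta. Qed.

Lemma O_dt_zeta : O true 0 (surf dt_zetaf).
Proof.
apply: O_surf_base; first exact: ssurf_dt_zeta.
by move=> n d /(_ _ (dI_dt d))[_ []].
Qed.

Definition hf : family R := fun d _ X => h d (dt d, X).

Lemma O_one : O false 0 (fun (_ : data R) _ _ => 1).
Proof. by apply: (O_scalar (order_cst _)); rewrite normr1 ler1n. Qed.

(** Pointwise only: the constant 1 in the depth is not square integrable over the plane. *)
Lemma O_h : O false 0 hf.
Proof.
exact: (@O_weaken _ _ false _ 0 hf (O_add O_one (O_mul (O_scalar (@order_eps R)) O_zeta))).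
Qed.

End Surface.

(** Used with [K] a power of [kap], [k = kap] and [x] the square of [A]: two more powers of [kap]
    absorb the factor 2 and the square. *)
Lemma absorb_constant (R : realType) (x K k : R) : 1 <= K -> 2 <= k -> x <= k * k ->
  K * (x + x) <= K * k * k * (K * k * k).
Proof.
move=> K1 k2 xk; have kk : 4 <= k * k by nra.
have -> : K * k * k * (K * k * k) = K * (K * (k * k) * (k * k)) by ring.
apply: (@le_trans _ _ (K * (2 * (k * k)))).
  by apply: ler_wpM2l; lra.
move: (k * k) xk kk => q xk kk; apply: ler_wpM2l; first lra.
have : 2 * q <= q * q by rewrite ler_wpM2r//; lra.
have : q * q <= K * q * q by rewrite -mulrA ler_peMl// mulr_ge0; lra.
lra.
Qed.

(** * Traces of fluid fields on the levels *)

Section FluidBase.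
Variable R : realType.
Implicit Types (d : data R) (f : ffield R).
Local Notation leb3 := ((@lebesgue_measure R \x @lebesgue_measure R) \x @lebesgue_measure R)%E.

Definition fN (a b c : nat) f : ffield R := fun d => iter a dx3 (iter b dy3 (iter c dz3 (f d))).

Definition bounded_ffield f := forall n d a b c, bounded n d -> (a + b + c <= n)%N ->
  (\int[leb3]_(Q in Omega (dP d) (dS d) (dt d)) (fN a b c f d (dt d, Q) ^+ 2)%R%:E
     <= (dA d ^+ 2)%:E)%E.

Lemma sfluid_fN a b c f : sfluid f -> sfluid (fN a b c f).
Proof. by move=> sf d; do 3 apply: smooth_on_iter; exact: sf. Qed.

Lemma fN_z a b c f d p : sfluid f -> fluid d p -> dz3 (fN a b c f d) p = fN a b c.+1 f d p.
Proof.
move=> sf Fp; have /smooth_onP[U [oU FU sU]] := sf d; have Up := FU _ Fp.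
have sc : smooth U (iter c dz3 (f d)) := smooth_iter c _ sU.
have sb : smooth U (iter b dy3 (iter c dz3 (f d))) := smooth_iter b _ sc.
apply: (etrans (derive_iter_comm oU _ _ a sb Up)).
apply: (@eq_on_iterate R _ U oU _ _ _ a _ p) => // q Uq.
exact: (derive_iter_comm oU _ _ b sc Uq).
Qed.

Lemma fN_y a b c f d p : sfluid f -> fluid d p -> dy3 (fN a b c f d) p = fN a b.+1 c f d p.
Proof.
move=> sf Fp; have sc : smooth_on (fluid d) (iter c dz3 (f d)) := smooth_on_iter c _ (sf d).
exact: (smooth_on_iter_comm _ _ a (smooth_on_iter b _ sc) Fp).
Qed.

Definition top d (X : vec2 R) : R := eps (dP d) * zeta (dS d) (dt d, X).

Lemma cont_top d : continuous (top d).
Proof. exact: (cM (@cC R _ (eps (dP d))) (@cont_surf R (@zetaf R) d (@ssurf_zeta R))). Qed.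

Lemma Omega_fluid d Q : Omega (dP d) (dS d) (dt d) Q -> fluid d (dt d, Q).
Proof. by move=> [q0 q1]; split; [exact: dI_dt|split=> /=; apply: ltW => //; rewrite -surjective_pairing]. Qed.

(** The slice is extended by constants below the bottom and above the surface, which makes it
    continuous on the whole line. *)
Lemma cont_vertical d X f : sfluid f ->
  continuous (fun z => f d (dt d, (X, Num.max (-1) (Num.min (top d X) z)))).
Proof.
move=> sf z.
have t1 : -1 <= top d X.
  by have := ltW (@h_gt0 R d (dt d, X) (dI_dt d)); rewrite /h /depth -lerBlDl sub0r.
have c1 : {for z, continuous ((fun=> top d X : R^o) \min (fun t : R => t : R^o))}.
  by apply: (@continuous_min R R); [exact: cont_cst|exact: cont_id].
have c2 : {for z, continuous ((fun=> -1 : R^o) \max ((fun=> top d X : R^o) \min (fun t : R => t : R^o)))}.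
  by apply: (@continuous_max R R); [exact: cont_cst|exact: c1].
have Fz : fluid d (dt d, (X, Num.max (-1) (Num.min (top d X) z))).
  split; first exact: dI_dt.
  by split; rewrite /= ?le_max ?lexx// ge_max t1 ge_min lexx.
have cf := @smooth_on_cont R _ (fluid d) _ (f d) _ (sf d) Fz.
apply: (@continuous_comp _ _ _ (fun z => (dt d, (X, Num.max (-1) (Num.min (top d X) z)))) (f d) z _ cf).
exact: (cont_pair (@cont_cst _ _ _ _) (cont_pair (@cont_cst _ _ _ _) c2)).
Qed.

(** Both constants of the one-dimensional Sobolev inequality on a water column: [1 / h] is
    controlled by [hmin], and [h] by the pointwise bound on [zeta]. *)
Lemma depth_bound : exists n m, forall d, bounded n d -> forall X,
  2 / h d (dt d, X) + h d (dt d, X) <= kap d ^+ m.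
Proof.
have [_ [n [m Hh]] _] := @O_h R 0%N.
exists n, (m.+3)%N => d B X; have {}Hh := Hh d B 0 X.
rewrite /scale expr0 mulr1 in Hh.
have h0 := @h_gt0 R d (dt d, X) (dI_dt d).
have hi : (h d (dt d, X))^-1 <= kap d.
  have [_ _ kh _] := le_kap d; apply: le_trans kh.
  by rewrite lef_pV2 ?posrE ?hmin_gt0//; apply: h_ge; exact: dI_dt.
have hl : h d (dt d, X) <= kap d ^+ m by apply: le_trans Hh; exact: ler_norm.
have k2 := kap_ge2 d.
have k1 : 1 <= kap d ^+ m by rewrite exprn_ege1// kap_ge1.
rewrite !exprSr; move: hi hl k1 k2.
move: (h d _)^-1 => a; move: (h d _) => b; move: (kap d ^+ m) => K; move: (kap d) => k.
clear => ak bK K1 k2.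
have q1 : 2 * k <= k * k by rewrite ler_wpM2r//; lra.
have [q4 qK] : 4 <= k * k /\ 0 <= k * k by split; lra.
move: (k * k) q1 q4 qK (mulrA K k k) => q q1 q4 q0 <-.
have E1 : q <= K * q by rewrite ler_peMl.
have E2 : K <= K * q by rewrite ler_peMr//; lra.
have E3 : K * q * 2 <= K * q * k by apply: ler_wpM2l => //; lra.
by lra.
Qed.

(** On each column the value at level [th] is bounded, uniformly in [th], by the field and its
    vertical derivative in L^2 of the column; hence one derivative more than [a + b + c] is asked of
    the norm. *)
Lemma bnd_flat f a b c : sfluid f -> bounded_ffield f -> bnd true 0 (flat (fN a b c f)).
Proof.
move=> sf bf; have [n [m Hc]] := depth_bound.
exists (maxn n (a + b + c).+1), (m.+2)%N => d B th.
have {}Hc := Hc d (bounded_le (leq_maxl _ _) B).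
have B' := bounded_le (leq_maxr n (a + b + c).+1) B.
have A0 := bounded_A_ge0 B.
pose g Q := fN a b c f d (dt d, Q).
pose gz Q := fN a b c.+1 f d (dt d, Q).
have sg := sfluid_fN a b c sf; have sgz := sfluid_fN a b c.+1 sf.
have cg f' : sfluid f' -> forall p, strip (top d) p -> {for p, continuous (fun Q => f' d (dt d, Q))}.
  move=> sf' p sp; have Fp := @Omega_fluid d p sp.
  have cf := @smooth_on_cont R _ (fluid d) _ (f' d) _ (sf' d) Fp.
  apply: (@continuous_comp _ _ _ (fun Q => (dt d, Q)) (f' d) p _ cf).
  exact: (cont_pair (@cont_cst _ _ _ _) (@cont_id _ _)).
have k0 : 0 <= kap d ^+ m by rewrite exprn_ge0// ltW// kap_gt0.
have zE p := @fN_z a b c f d p sf.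
have := @N2_strip R (top d) (flat (fN a b c f) d th) g gz (kap d ^+ m) (@cont_top d)
  (reg_cont (F := flat (fN a b c f)) (reg_flat sg)) k0 (cg _ sg) (cg _ sgz).
have H X : exists h hz : R -> R, [/\ continuous h, continuous hz,
     (forall z, -1 < z < top d X -> h z = g (X, z)),
     (forall z, -1 < z < top d X -> hz z = gz (X, z)) &
     flat (fN a b c f) d th X ^+ 2 <= kap d ^+ m *
      (J (-1) (top d X) (fun z => h z ^+ 2) + J (-1) (top d X) (fun z => hz z ^+ 2))].
  pose hh f' z : R := f' d (dt d, (X, Num.max (-1) (Num.min (top d X) z))).
  have h0 := @h_gt0 R d (dt d, X) (dI_dt d).
  have t0 : -1 < top d X by move: h0; rewrite /h /depth -ltrBlDl sub0r.
  have cl z : -1 <= z <= top d X -> Num.max (-1) (Num.min (top d X) z) = z.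
    by move=> /andP[z0 z1]; rewrite (min_idPr z1) (max_idPr z0).
  exists (hh (fN a b c f)), (hh (fN a b c.+1 f)); split.
  - exact: cont_vertical.
  - exact: cont_vertical.
  - by move=> z /andP[z0 z1]; rewrite /hh cl// !ltW.
  - by move=> z /andP[z0 z1]; rewrite /hh cl// !ltW.
  have zth : -1 <= -1 + clamp th * h d (dt d, X) <= top d X.
    by have [_ /=] := @level_fluid R d th (dt d, X) (dI_dt d) => -[-> ->].
  have lE : top d X - -1 = h d (dt d, X) by rewrite opprK addrC.
  have := @sobolev1 R (-1) (top d X) (hh (fN a b c f)) (hh (fN a b c.+1 f)) _ t0
     (@cont_vertical d X _ sg) (@cont_vertical d X _ sgz) _ zth.
  have fE : hh (fN a b c f) (-1 + clamp th * h d (dt d, X)) = flat (fN a b c f) d th X.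
    by rewrite /hh cl.
  rewrite lE fE => S; apply: (le_trans (S _)).
    move=> z /andP[z0 z1].
    have zz : -1 <= z <= top d X by rewrite !ltW.
    have Fz : fluid d (dt d, (X, z)) by split; [exact: dI_dt|exact/andP].
    have e : hh (fN a b c.+1 f) z = dz3 (fN a b c f d) (dt d, (X, z)) by rewrite /hh cl// zE.
    rewrite e.
    apply: near_eq_is_derive (is_derive_vertical sg zz).
    have oi : open (`]-1, (top d X)[%classic : set R) by exact: interval_open.
    have : nbhs z `]-1, (top d X)[%classic by apply: open_nbhs_nbhs; split => //=; rewrite in_itv/= z0 z1.
    apply: filterS => s; rewrite /= in_itv/= => /andP[s0 s1].
    by rewrite /hh cl// !ltW.
  have J0 f' : 0 <= J (-1) (top d X) (fun z => hh f' z ^+ 2) by apply: J_ge0 => z _; exact: sqr_ge0.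
  rewrite mulrDr; apply: lerD; apply: ler_wpM2r => //; apply: le_trans (Hc X).
    by rewrite lerDl ltW.
  by rewrite lerDr divr_ge0// ltW.
move=> /(_ H) le1; apply: (le_trans le1) => {le1}.
have b1 : (\int[leb3]_(Q in strip (top d)) (g Q ^+ 2)%R%:E <= (dA d ^+ 2)%:E)%E.
  by apply: (bf _ _ a b c B').
have b2 : (\int[leb3]_(Q in strip (top d)) (gz Q ^+ 2)%R%:E <= (dA d ^+ 2)%:E)%E.
  by apply: (bf _ _ a b c.+1 B'); rewrite addnS.
apply: (@le_trans _ _ ((kap d ^+ m)%:E * ((dA d ^+ 2)%:E + (dA d ^+ 2)%:E))%E).
  by apply: lee_wpmul2l => //; exact: leeD b1 b2.
rewrite -EFinD -EFinM lee_fin.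
have e : scale m.+2 0 d = kap d ^+ m * kap d * kap d by rewrite /scale expr0 mulr1 !exprSr.
rewrite e [leRHS]expr2; apply: absorb_constant; first by rewrite exprn_ege1// kap_ge1.
  exact: kap_ge2.
by have := sqA_le A0; rewrite /scale expr0 mulr1 expr1 [leRHS]expr2.
Qed.

End FluidBase.

(** * Classes of fluid fields and of their components *)

Section FluidClasses.
Variable R : realType.
Implicit Types (d : data R) (f : ffield R).
Local Notation leb3 := ((@lebesgue_measure R \x @lebesgue_measure R) \x @lebesgue_measure R)%E.

Lemma flat_eq f f' : (forall d p, fluid d p -> f d p = f' d p) -> flat f = flat f'.
Proof.
move=> ff; apply/funext => d; apply/funext => th; apply/funext => X.
by apply: ff; apply: level_fluid; exact: dI_dt.
Qed.

(** The induction treats all [a b c] together, because a horizontal derivative at fixed level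
    produces, through [shear], one more vertical derivative of the field. *)
Lemma O_flat f a b c : sfluid f -> bounded_ffield f -> O true 0 (flat (fN a b c f)).
Proof.
move=> sf bf s; have bd a' b' c' := bnd_flat a' b' c' sf bf.
have rg a' b' c' := reg_flat (sfluid_fN a' b' c' sf).
have ys a' b' c' : flat (fun d => dy3 (fN a' b' c' f d)) = flat (fN a' b'.+1 c' f).
  by apply: flat_eq => d p; exact: fN_y.
have zs a' b' c' : flat (fun d => dz3 (fN a' b' c' f d)) = flat (fN a' b' c'.+1 f).
  by apply: flat_eq => d p; exact: fN_z.
elim: s a b c => [|s IH] a b c; first by split; [exact: rg|exact: bd|].
split; [exact: rg|exact: bd|].
have cx Z a' b' c' : O true 0 Z -> cls true 0 s (shear Z (flat (fN a' b' c' f))).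
  move=> OZ; have H := O_mul (@O_clamp R) (O_mul (O_scalar (@order_eps R)) OZ).
  exact: (cls_mul (@O_weaken _ _ false _ 0 _ H isT isT s) (IH a' b' c')).
have zx : O true 0 (surf (fun d => dx2 (@zetaf R d))).
  by rewrite -(px_surf (@ssurf_zeta R)); exact: O_px (@O_zeta R).
have zy : O true 0 (surf (fun d => dy2 (@zetaf R d))).
  by rewrite -(py_surf (@ssurf_zeta R)); exact: O_py (@O_zeta R).
have xE : px (flat (fN a b c f)) = fun d th X => flat (fN a.+1 b c f) d th X
    + shear (surf (fun d => dx2 (@zetaf R d))) (flat (fN a b c.+1 f)) d th X.
  by rewrite -(zs a b c); exact: (px_flat (sfluid_fN a b c sf)).
have yE : py (flat (fN a b c f)) = fun d th X => flat (fN a b.+1 c f) d th X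
    + shear (surf (fun d => dy2 (@zetaf R d))) (flat (fN a b c.+1 f)) d th X.
  by rewrite -(zs a b c) -(ys a b c); exact: (py_flat (sfluid_fN a b c sf)).
rewrite xE yE; split; apply: cls_add.
- exact: (IH a.+1 b c).
- exact: cx zx.
- exact: (IH a b.+1 c).
- exact: cx zy.
Qed.

Lemma iter_nseq (E W : normedModType R) (f : E -> W) v n vs :
  iter_derive f (nseq n v ++ vs) = iter n (fun g : E -> W => 'D_v g) (iter_derive f vs).
Proof. by elim: n => //= n ->. Qed.

(** The spatial derivatives of the norm written as a list of directions, applied after [w], which
    will be empty or the time direction. *)
Definition word a b c (w : seq (sp3 R)) : seq (sp3 R) :=
  nseq a ((0, ((1, 0), 0)) : sp3 R) ++ nseq b ((0, ((0, 1), 0)) : sp3 R) ++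
  nseq c ((0, ((0, 0), 1)) : sp3 R) ++ w.

Lemma iter_word (W : normedModType R) (f : sp3 R -> W) a b c w :
  iter_derive f (word a b c w) = iter a dx3 (iter b dy3 (iter c dz3 (iter_derive f w))).
Proof. by rewrite /word !iter_nseq. Qed.

Lemma component_cont (l : {linear vec3 R -> R}) d (F : sp3 R -> vec3 R) w Q :
  continuous l -> smooth_on (fluid d) F -> strip (top d) Q ->
  {for Q, continuous (fun Q => iter_derive (l \o F) w (dt d, Q))}.
Proof.
move=> cl sF sQ; have Fp := @Omega_fluid R d Q sQ.
have /smooth_onP[U [oU FU sU]] := sF.
have sl := smooth_linear_comp oU cl sU.
have cf : {for (dt d, Q), continuous (iter_derive (l \o F) w)}.
  by apply: differentiable_continuous; exact: sl (FU _ Fp).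
apply: (@continuous_comp _ _ _ (fun Q => (dt d, Q)) (iter_derive (l \o F) w) Q _ cf).
exact: (cont_pair (@cont_cst _ _ _ _) (@cont_id _ _)).
Qed.

(** A linear component commutes with derivatives and its square is at most that of the vector; [l1],
    [l2], [l3] show that the latter is nonnegative and measurable. *)
Lemma component_bound (l1 l2 l3 l : {linear vec3 R -> R}) d (F : sp3 R -> vec3 R) w n a b c A :
  continuous l1 -> continuous l2 -> continuous l3 -> continuous l ->
  (forall u : vec3 R, sq3 u = l1 u ^+ 2 + l2 u ^+ 2 + l3 u ^+ 2) ->
  (forall u : vec3 R, l u ^+ 2 <= sq3 u) ->
  smooth_on (fluid d) F ->
  (Hnorm3 sq3 n (Omega (dP d) (dS d) (dt d)) (iter_derive F w) (dt d) <= A%:E)%E ->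
  (a + b + c <= n)%N ->
  (\int[leb3]_(Q in Omega (dP d) (dS d) (dt d))
      (iter a dx3 (iter b dy3 (iter c dz3 (iter_derive (l \o F) w))) (dt d, Q) ^+ 2)%R%:E
     <= (A ^+ 2)%:E)%E.
Proof.
move=> c1 c2 c3 cl E3 lle sF H abc.
have q0 (u : vec3 R) : 0 <= sq3 u by rewrite E3 !addr_ge0 ?sqr_ge0.
apply: le_trans (Hnorm3_term (q := sq3) q0 H abc).
have /smooth_onP[U [oU FU sU]] := sF.
have mS : measurable (strip (top d) : set ((measurableTypeR R * measurableTypeR R) * measurableTypeR R)).
  exact: (measurable_strip (@cont_top R d)).
have eq1 (k : {linear vec3 R -> R}) Q : continuous k -> strip (top d) Q ->
   k (iter_derive F (word a b c w) (dt d, Q)) = iter_derive (k \o F) (word a b c w) (dt d, Q).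
  move=> ck sQ; have Up := FU _ (@Omega_fluid R d Q sQ).
  by rewrite (iter_linear_comp oU _ ck sU Up).
have m1 (k : {linear vec3 R -> R}) : continuous k ->
   measurable_fun (strip (top d) : set ((measurableTypeR R * measurableTypeR R) * measurableTypeR R))
     (fun Q => (iter_derive (k \o F) (word a b c w) (dt d, Q) ^+ 2)%:E).
  move=> ck.
  have := measurable_strip_sqr (@cont_top R d)
     (fun Q sQ => @component_cont k d F (word a b c w) Q ck sF sQ).
  by move/(measurable_restrict _ mS measurableT); rewrite setTI.
apply: ge0_le_integral => //.
- by move=> Q _; rewrite lee_fin sqr_ge0.
- by rewrite -iter_word; exact: m1.
- rewrite -iter_word.
  apply: (eq_measurable_fun (fun Q =>
    ((iter_derive (l1 \o F) (word a b c w) (dt d, Q) ^+ 2)%:E +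
     (iter_derive (l2 \o F) (word a b c w) (dt d, Q) ^+ 2)%:E +
     (iter_derive (l3 \o F) (word a b c w) (dt d, Q) ^+ 2)%:E)%E)).
    by move=> Q; rewrite inE => sQ; rewrite -!eq1// E3 !EFinD.
  by do 2 (apply: emeasurable_funD; last exact: m1); exact: m1.
move=> Q sQ; rewrite lee_fin -!iter_word -eq1//; exact: lle.
Qed.

End FluidClasses.

(** * Scalar components of velocity and vorticity *)

Section Fields.
Variable R : realType.
Implicit Types (d : data R) (f : ffield R).

Definition c1 : {linear vec3 R -> R} := (fst \o fst : vec3 R -> R).
Definition c2 : {linear vec3 R -> R} := (snd \o fst : vec3 R -> R).
Definition c3 : {linear vec3 R -> R} := (snd : vec3 R -> R).

Lemma cont_c1 : continuous c1.
Proof. by move=> u; exact: (@continuous_comp _ _ _ fst fst u (@cont_fst _ _ u) (@cont_fst _ _ u.1)). Qed.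
Lemma cont_c2 : continuous c2.
Proof. by move=> u; exact: (@continuous_comp _ _ _ fst snd u (@cont_fst _ _ u) (@cont_snd _ _ u.1)). Qed.
Lemma cont_c3 : continuous c3.
Proof. by move=> u; exact: (@cont_snd _ _ u). Qed.

Lemma sq3E (u : vec3 R) : sq3 u = c1 u ^+ 2 + c2 u ^+ 2 + c3 u ^+ 2.
Proof. by []. Qed.

Lemma c1_le (u : vec3 R) : c1 u ^+ 2 <= sq3 u.
Proof. by rewrite sq3E -addrA lerDl addr_ge0 ?sqr_ge0. Qed.
Lemma c2_le (u : vec3 R) : c2 u ^+ 2 <= sq3 u.
Proof. by rewrite sq3E addrAC lerDr addr_ge0 ?sqr_ge0. Qed.
Lemma c3_le (u : vec3 R) : c3 u ^+ 2 <= sq3 u.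
Proof. by rewrite sq3E lerDr addr_ge0 ?sqr_ge0. Qed.

Lemma smooth_velU d : smooth_on (fluid d) (velU (dS d)).
Proof.
have [[_ _ _ sV sw] _] := system d.
have /smooth_onP[U1 [oU1 D1 s1]] := sV; have /smooth_onP[U2 [oU2 D2 s2]] := sw.
apply/smooth_onP; exists (U1 `&` U2); split; first exact: openI.
  by move=> p Dp; split; [exact: D1|exact: D2].
apply: smooth_pair; first exact: openI.
  by move=> vs p [Up _]; exact: s1.
by move=> vs p [_ Up]; exact: s2.
Qed.

Lemma smooth_omega d : smooth_on (fluid d) (omega (dS d)).
Proof. by have [[]] := system d. Qed.

Definition V1 : ffield R := fun d => c1 \o velU (dS d).
Definition V2 : ffield R := fun d => c2 \o velU (dS d).
Definition W : ffield R := fun d => c3 \o velU (dS d).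
Definition o1 : ffield R := fun d => c1 \o omega (dS d).
Definition o2 : ffield R := fun d => c2 \o omega (dS d).
Definition o3 : ffield R := fun d => c3 \o omega (dS d).
Definition fdt f : ffield R := fun d => dt3 (f d).

Lemma sfluid_dt f : sfluid f -> sfluid (fdt f).
Proof. by move=> sf d; exact: smooth_on_derive. Qed.

Lemma sV1 : sfluid V1. Proof. by move=> d; exact: (smooth_on_linear_comp cont_c1 (smooth_velU d)). Qed.
Lemma sV2 : sfluid V2. Proof. by move=> d; exact: (smooth_on_linear_comp cont_c2 (smooth_velU d)). Qed.
Lemma sW : sfluid W. Proof. by move=> d; exact: (smooth_on_linear_comp cont_c3 (smooth_velU d)). Qed.
Lemma so1 : sfluid o1. Proof. by move=> d; exact: (smooth_on_linear_comp cont_c1 (smooth_omega d)). Qed.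
Lemma so2 : sfluid o2. Proof. by move=> d; exact: (smooth_on_linear_comp cont_c2 (smooth_omega d)). Qed.
Lemma so3 : sfluid o3. Proof. by move=> d; exact: (smooth_on_linear_comp cont_c3 (smooth_omega d)). Qed.

Definition et3 : sp3 R := (1, ((0, 0), 0)).

Lemma bounded_velU n d : bounded n d ->
  (Hnorm3 sq3 n (Omega (dP d) (dS d) (dt d)) (velU (dS d)) (dt d) <= (dA d)%:E)%E.
Proof. by move=> /(_ _ (dI_dt d))[[]]. Qed.
Lemma bounded_omega n d : bounded n d ->
  (Hnorm3 sq3 n (Omega (dP d) (dS d) (dt d)) (omega (dS d)) (dt d) <= (dA d)%:E)%E.
Proof. by move=> /(_ _ (dI_dt d))[[]]. Qed.
Lemma bounded_velUt n d : bounded n d ->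
  (Hnorm3 sq3 n (Omega (dP d) (dS d) (dt d)) (dt3 (velU (dS d))) (dt d) <= (dA d)%:E)%E.
Proof. by move=> /(_ _ (dI_dt d))[_ []]. Qed.

Definition cb l w F n a b c d cl ll sF H abc :=
  @component_bound R c1 c2 c3 l d F w n a b c (dA d) cont_c1 cont_c2 cont_c3 cl sq3E ll sF H abc.

Lemma O_V1 a b c : O true 0 (flat (fN a b c V1)).
Proof. by apply: (O_flat a b c sV1) => n d i j k B; exact: (@cb _ [::] _ _ _ _ _ _ cont_c1 c1_le (smooth_velU d) (bounded_velU B)). Qed.
Lemma O_V2 a b c : O true 0 (flat (fN a b c V2)).
Proof. by apply: (O_flat a b c sV2) => n d i j k B; exact: (@cb _ [::] _ _ _ _ _ _ cont_c2 c2_le (smooth_velU d) (bounded_velU B)). Qed.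
Lemma O_W a b c : O true 0 (flat (fN a b c W)).
Proof. by apply: (O_flat a b c sW) => n d i j k B; exact: (@cb _ [::] _ _ _ _ _ _ cont_c3 c3_le (smooth_velU d) (bounded_velU B)). Qed.
Lemma O_o1 a b c : O true 0 (flat (fN a b c o1)).
Proof. by apply: (O_flat a b c so1) => n d i j k B; exact: (@cb _ [::] _ _ _ _ _ _ cont_c1 c1_le (smooth_omega d) (bounded_omega B)). Qed.
Lemma O_o2 a b c : O true 0 (flat (fN a b c o2)).
Proof. by apply: (O_flat a b c so2) => n d i j k B; exact: (@cb _ [::] _ _ _ _ _ _ cont_c2 c2_le (smooth_omega d) (bounded_omega B)). Qed.
Lemma O_o3 a b c : O true 0 (flat (fN a b c o3)).
Proof. by apply: (O_flat a b c so3) => n d i j k B; exact: (@cb _ [::] _ _ _ _ _ _ cont_c3 c3_le (smooth_omega d) (bounded_omega B)). Qed.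
Lemma O_V1t a b c : O true 0 (flat (fN a b c (fdt V1))).
Proof. by apply: (O_flat a b c (sfluid_dt sV1)) => n d i j k B; exact: (@cb _ [:: et3] _ _ _ _ _ _ cont_c1 c1_le (smooth_velU d) (bounded_velUt B)). Qed.
Lemma O_V2t a b c : O true 0 (flat (fN a b c (fdt V2))).
Proof. by apply: (O_flat a b c (sfluid_dt sV2)) => n d i j k B; exact: (@cb _ [:: et3] _ _ _ _ _ _ cont_c2 c2_le (smooth_velU d) (bounded_velUt B)). Qed.
Lemma O_Wt a b c : O true 0 (flat (fN a b c (fdt W))).
Proof. by apply: (O_flat a b c (sfluid_dt sW)) => n d i j k B; exact: (@cb _ [:: et3] _ _ _ _ _ _ cont_c3 c3_le (smooth_velU d) (bounded_velUt B)). Qed.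

End Fields.

(** * Differentiating identities that hold on the fluid only *)

Section Interior.
Variable R : realType.
Implicit Types (d : data R) (f g : ffield R).

(** Derivability fixes the limit of the quotients, so it can be computed along any small steps on
    which [F] vanishes. At an end point of the time interval these steps have a single sign. *)
Lemma derive_one_sided (E : normedModType R) (F : E -> R) p v : derivable F p v -> F p = 0 ->
  (forall e : R, 0 < e -> exists r, [/\ r != 0, `|r| < e & F (r *: v + p) = 0]) -> 'D_v F p = 0.
Proof.
move=> dF Fp H; apply/eqP; rewrite -normr_le0; apply/ler_addgt0Pl => e e0; rewrite addr0.
have /cvgrPdist_le/(_ _ e0) := dF; rewrite -[lim _]/('D_v F p) => K.
have [e1 /= e10 He] : exists2 r : R, 0 < r & forall h, `|h| < r -> h != 0 ->
   `|'D_v F p - h^-1 *: (F (h *: v + p) - F p)| <= e.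
  have [r /= r0 Hr] := K; exists r => // k kr k0; apply: Hr => //.
  by rewrite /= sub0r normrN.
have [r [r0 re Fr]] := H _ e10.
by have := He r re r0; rewrite Fr Fp subrr scaler0 subr0.
Qed.

Definition interior d : set (sp3 R) := [set p | dI d p.1 /\ Omega (dP d) (dS d) p.1 p.2].

Lemma interior_fluid d p : interior d p -> fluid d p.
Proof. by move=> [Ip [q0 q1]]; split=> //; split=> /=; apply: ltW => //; rewrite -surjective_pairing. Qed.

(* One-sided when [t] is an end point of the time interval. *)
Lemma time_steps d t : dI d t -> exists2 k : R, k != 0 &
  forall s, 0 <= s <= 1 -> dI d (s * k + t).
Proof.
move=> It; have [t1 [t2 [I1 I2 t12]]] := dI_nontrivial d.
have [t' It' tt'] : exists2 t', dI d t' & t' != t.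
  have [e|n] := eqVneq t1 t; first by exists t2 => //; rewrite gt_eqF// -e.
  by exists t1.
exists (t' - t); first by rewrite subr_eq0.
move=> s /andP[s0 s1].
have [lt|lt|e] := ltgtP t t'.
- apply: (itv_dI (d := d) It It'); apply/andP; split.
    by rewrite lerDr mulr_ge0// subr_ge0 ltW.
  by rewrite -lerBrDr ler_piMl// subr_ge0 ltW.
- apply: (itv_dI (d := d) It' It); apply/andP; split.
    by rewrite -lerBlDr ler_niMl// subr_le0 ltW.
  by rewrite gerDr mulr_ge0_le0// subr_le0 ltW.
- by rewrite e eqxx in tt'.
Qed.

(** The boolean [a] is the time component of the direction. For [a = true] the identity is
    differentiated in time although [interior] is not open at the ends of the interval. *)
Lemma derive_interior d (F : sp3 R -> R) p (a : bool) (u : vec3 R) :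
  (forall q, interior d q -> F q = 0) -> interior d p ->
  derivable F p (a%:R, u) -> 'D_((a%:R, u) : sp3 R) F p = 0.
Proof.
move=> F0 ip dF; apply: (derive_one_sided dF); first exact: F0.
move=> e e0; have [Ip [z0 z1]] := ip.
have [k k0 Ik] := time_steps Ip.
have cz : {for (p.1, p.2.1), continuous (zeta (dS d))}.
  exact: (@smooth_on_cont R _ (surface d) _ (zeta (dS d)) (p.1, p.2.1) (@ssurf_zeta R d) (conj Ip Logic.I)).
have near1 : \forall q \near p, -1 < q.2.2.
  have c : {for p, continuous (fun q : sp3 R => q.2.2)}.
    exact: (@continuous_comp _ _ _ snd snd p (@cont_snd _ _ p) (@cont_snd _ _ p.2)).
  exact: (c [set z : R | -1 < z] (open_nbhs_nbhs (conj (@open_gt R (-1)) z0))).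
have near2 : \forall q \near p, 0 < eps (dP d) * zeta (dS d) (q.1, q.2.1) - q.2.2.
  have c : {for p, continuous (fun q : sp3 R => q.2.2)}.
    exact: (@continuous_comp _ _ _ snd snd p (@cont_snd _ _ p) (@cont_snd _ _ p.2)).
  have c' : {for p, continuous (fun q : sp3 R => (q.1, q.2.1))}.
    apply: (cont_pair (@cont_fst _ _ p)).
    exact: (@continuous_comp _ _ _ snd fst p (@cont_snd _ _ p) (@cont_fst _ _ p.2)).
  have cc : {for p, continuous (fun q : sp3 R => zeta (dS d) (q.1, q.2.1))}.
    exact: (@continuous_comp _ _ _ (fun q : sp3 R => (q.1, q.2.1)) (zeta (dS d)) p c' cz).
  have ccc : {for p, continuous (fun q : sp3 R => eps (dP d) * zeta (dS d) (q.1, q.2.1) - q.2.2)}.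
    by apply: cvgB; [apply: cvgM; [exact: cvg_cst|exact: cc]|exact: c].
  have z10 : 0 < eps (dP d) * zeta (dS d) (p.1, p.2.1) - p.2.2 by rewrite subr_gt0.
  exact: (ccc [set z : R | 0 < z] (open_nbhs_nbhs (conj (@open_gt R 0) z10))).
have [r0 r00 Hr] := near_line ((a%:R, u) : sp3 R) (filterI near1 near2).
(* The 1 keeps the time in the interval; the halves make the step smaller than [e] and than the
   radius on which the point stays strictly between bottom and surface. *)
pose m := Num.min 1 (Num.min (e / 2) (r0 / 2) / `|k|).
have k1 : 0 < `|k| by rewrite normr_gt0.
have m0 : 0 < m by rewrite /m lt_min ltr01 divr_gt0// lt_min !divr_gt0.
have m1 : m <= 1 by rewrite /m ge_min lexx.
have mk : m * `|k| <= Num.min (e / 2) (r0 / 2).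
  by rewrite -ler_pdivlMr// /m ge_min lexx orbT.
have [mke mkr] : m * `|k| < e /\ m * `|k| < r0.
  move: mk; rewrite le_min => /andP[a1 a2].
  by split; [apply: (le_lt_trans a1)|apply: (le_lt_trans a2)]; rewrite ltr_pdivrMr// ltr_pMr// ltr1n.
exists (m * k); split.
- by rewrite mulf_neq0// gt_eqF.
- by rewrite normrM (gtr0_norm m0).
apply: F0; have [] := Hr (m * k); first by rewrite normrM (gtr0_norm m0).
move=> n1 n2; split; last by split; [exact: n1|move: n2; rewrite subr_gt0].
move=> /=; case: (a) => /=.
  by rewrite [_ *: 1]mulr1; apply: Ik; rewrite (ltW m0).
by rewrite [_ *: 0]mulr0 add0r.
Qed.

End Interior.

(** * Divergence and curl equations on the levels *)

Section Equations.
Variable R : realType.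
Implicit Types (d : data R) (f g : ffield R).

Lemma cont_limit_zero (w : R -> R) (x k : R) : {for x, continuous w} ->
  (forall s, 0 < s < 1 -> w (s * k + x) = 0) -> w x = 0.
Proof.
move=> /cvgrPdist_le cw w0; apply/eqP; rewrite -normr_le0; apply/ler_addgt0Pl => e e0.
rewrite addr0; have [r r0 Hr] := near_line k (cw _ e0).
pose s := Num.min (r / 2) (1 / 2).
have s0 : 0 < s by rewrite lt_min !divr_gt0.
have sr : s < r.
  by apply: (@le_lt_trans _ _ (r / 2)); [rewrite /s ge_min lexx|rewrite ltr_pdivrMr// ltr_pMr// ltr1n].
have s1 : s < 1.
  by apply: (@le_lt_trans _ _ (1 / 2)); [rewrite /s ge_min lexx orbT|rewrite ltr_pdivrMr// mul1r ltr1n].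
have := Hr s; rewrite -[s *: k]/(s * k) w0 ?s0// subr0; apply.
by rewrite gtr0_norm.
Qed.

Lemma eq_at_ends (u v : R -> R) : continuous u -> continuous v ->
  (forall th, 0 < th < 1 -> u th = v th) -> u 0 = v 0 /\ u 1 = v 1.
Proof.
move=> cu cv uv.
have cw x : {for x, continuous (fun s => u s - v s)} by apply: cvgB; [exact: cu|exact: cv].
split; apply/eqP; rewrite -subr_eq0; apply/eqP.
  apply: (@cont_limit_zero (fun s => u s - v s) 0 1 (cw 0)) => s s01.
  by rewrite mulr1 addr0 uv// subrr.
apply: (@cont_limit_zero (fun s => u s - v s) 1 (-1) (cw 1)) => s /andP[s0 s1].
by rewrite uv ?subrr// mulrN1; apply/andP; split; lra.
Qed.

Lemma clamp_ext (u v : R -> R) : continuous u -> continuous v ->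
  (forall th, u (clamp th) = u th) -> (forall th, v (clamp th) = v th) ->
  (forall th, 0 < th < 1 -> u th = v th) -> forall th, u th = v th.
Proof.
move=> cu cv uc vc uv th; rewrite -uc -vc; have [e0 e1] := eq_at_ends cu cv uv.
have /andP[] := clamp_itv th; set c := clamp th.
rewrite le_eqVlt => /orP[/eqP <- //|c0]; rewrite le_eqVlt => /orP[/eqP -> //|c1'].
by apply: uv; rewrite c0.
Qed.

Lemma level_clamp d th p : level d (clamp th) p = level d th p.
Proof. by rewrite /level (@clamp_id _ (clamp th))// clamp_itv. Qed.

Lemma flat_clamp f d th X : flat f d (clamp th) X = flat f d th X.
Proof. by rewrite /flat level_clamp. Qed.

Lemma level_interior d th X : 0 < th < 1 -> interior d (level d th (dt d, X)).
Proof.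
move=> /andP[t0 t1]; split; first exact: dI_dt.
have h0 := @h_gt0 R d (dt d, X) (dI_dt d).
have cth : clamp th = th by rewrite clamp_id// !ltW.
split; rewrite /= cth; first by rewrite ltrDl mulr_gt0.
have -> : eps (dP d) * zeta (dS d) (dt d, X) = -1 + h d (dt d, X) by rewrite /h /depth addrA addNr add0r.
by rewrite ltrD2l gtr_pMl.
Qed.

Lemma flat_cont f d X : sfluid f -> continuous (fun th => flat f d th X).
Proof. by move=> sf; exact: (@reg_cont1 R (flat f) d X (reg_flat sf)). Qed.

(** The coefficients depend on the parameters only, so that the relation is differentiated term by
    term; the divergence and curl equations have this form. *)
Definition lin_eq f g1 g2 (a b : data R -> R) :=
  forall d p, interior d p -> f d p = a d * g1 d p + b d * g2 d p.

Lemma lin_eq_flat f g1 g2 a b : sfluid f -> sfluid g1 -> sfluid g2 -> lin_eq f g1 g2 a b ->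
  forall d th X, flat f d th X = a d * flat g1 d th X + b d * flat g2 d th X.
Proof.
move=> sf s1 s2 H d th X.
apply: (@clamp_ext (fun th => flat f d th X) (fun th => a d * flat g1 d th X + b d * flat g2 d th X)).
- exact: flat_cont.
- by apply: cD; apply: cM; [exact: cC|exact: flat_cont|exact: cC|exact: flat_cont].
- by move=> t; exact: flat_clamp.
- by move=> t; rewrite !flat_clamp.
by move=> t t01; apply: H; exact: level_interior.
Qed.

Lemma lin_eq_derive f g1 g2 a b (k : bool) (u : vec3 R) :
  sfluid f -> sfluid g1 -> sfluid g2 -> lin_eq f g1 g2 a b ->
  lin_eq (fun d => 'D_((k%:R, u) : sp3 R) (f d)) (fun d => 'D_((k%:R, u) : sp3 R) (g1 d))
    (fun d => 'D_((k%:R, u) : sp3 R) (g2 d)) a b.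
Proof.
move=> sf s1 s2 H d p ip; have Fp := interior_fluid ip.
pose v : sp3 R := (k%:R, u).
have df := derivableP (@smooth_on_derivable R _ (fluid d) _ (f d) p v (sf d) Fp).
have d1 := derivableP (@smooth_on_derivable R _ (fluid d) _ (g1 d) p v (s1 d) Fp).
have d2 := derivableP (@smooth_on_derivable R _ (fluid d) _ (g2 d) p v (s2 d) Fp).
have D : is_derive p v (f d - (a d *: g1 d + b d *: g2 d))
    ('D_v (f d) p - (a d *: 'D_v (g1 d) p + b d *: 'D_v (g2 d) p)).
  have z1 : is_derive p v (a d *: g1 d) (a d *: 'D_v (g1 d) p) by apply: is_deriveZ.
  have z2 : is_derive p v (b d *: g2 d) (b d *: 'D_v (g2 d) p) by apply: is_deriveZ.
  have z3 := is_deriveD z1 z2.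
  exact: (is_deriveB df z3).
have : 'D_v (f d - (a d *: g1 d + b d *: g2 d)) p = 0.
  apply: (@derive_interior R d _ p k u _ ip); last by case: D.
  by move=> q iq; apply/eqP; rewrite subr_eq0; apply/eqP; exact: H.
by rewrite derive_val => /eqP; rewrite subr_eq0 => /eqP.
Qed.

Lemma fN_t a b c f d p : sfluid f -> fluid d p -> dt3 (fN a b c f d) p = fN a b c (fdt f) d p.
Proof.
move=> sf Fp; have /smooth_onP[U [oU FU sU]] := sf d; have Up := FU _ Fp.
have sc : smooth U (iter c dz3 (f d)) := smooth_iter c _ sU.
have sb : smooth U (iter b dy3 (iter c dz3 (f d))) := smooth_iter b _ sc.
apply: (etrans (derive_iter_comm oU _ _ a sb Up)).
apply: (@eq_on_iterate R _ U oU _ _ _ a _ p) => // q Uq.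
apply: (etrans (derive_iter_comm oU _ _ b sc Uq)).
apply: (@eq_on_iterate R _ U oU _ _ _ b _ q) => // r Ur.
exact: (derive_iter_comm oU _ _ c sU Ur).
Qed.

Lemma flat_y a b c f : sfluid f -> flat (fun d => dy3 (fN a b c f d)) = flat (fN a b.+1 c f).
Proof. by move=> sf; apply: flat_eq => d p; exact: fN_y. Qed.
Lemma flat_z a b c f : sfluid f -> flat (fun d => dz3 (fN a b c f d)) = flat (fN a b c.+1 f).
Proof. by move=> sf; apply: flat_eq => d p; exact: fN_z. Qed.
Lemma flat_t a b c f : sfluid f -> flat (fun d => dt3 (fN a b c f d)) = flat (fN a b c (fdt f)).
Proof. by move=> sf; apply: flat_eq => d p; exact: fN_t. Qed.

(** The relation for d_z f with its first derivatives in [x], [y], [z] and [t]: these occur when the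
    momentum is differentiated vertically. *)
Lemma lin_eq_jet f f1 f2 a1 b1 e1 a2 b2 e2 a b : sfluid f -> sfluid f1 -> sfluid f2 ->
  lin_eq (fN 0 0 1 f) (fN a1 b1 e1 f1) (fN a2 b2 e2 f2) a b ->
  forall d th X,
  [/\ flat (fN 0 0 1 f) d th X = a d * flat (fN a1 b1 e1 f1) d th X + b d * flat (fN a2 b2 e2 f2) d th X,
      flat (fN 1 0 1 f) d th X = a d * flat (fN a1.+1 b1 e1 f1) d th X + b d * flat (fN a2.+1 b2 e2 f2) d th X,
      flat (fN 0 1 1 f) d th X = a d * flat (fN a1 b1.+1 e1 f1) d th X + b d * flat (fN a2 b2.+1 e2 f2) d th X,
      flat (fN 0 0 2 f) d th X = a d * flat (fN a1 b1 e1.+1 f1) d th X + b d * flat (fN a2 b2 e2.+1 f2) d th X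
    & flat (fN 0 0 1 (fdt f)) d th X = a d * flat (fN a1 b1 e1 (fdt f1)) d th X + b d * flat (fN a2 b2 e2 (fdt f2)) d th X].
Proof.
move=> sf s1 s2 H d th X.
have S := sfluid_fN 0 0 1 sf; have S1 := sfluid_fN a1 b1 e1 s1; have S2 := sfluid_fN a2 b2 e2 s2.
have sD v F : sfluid F -> sfluid (fun d => 'D_v (F d)) by move=> sF d'; exact: smooth_on_derive.
split.
- exact: lin_eq_flat.
- exact: (lin_eq_flat (sD _ _ S) (sD _ _ S1) (sD _ _ S2) (@lin_eq_derive _ _ _ _ _ false ((1, 0), 0) S S1 S2 H)).
- rewrite -(flat_y 0 0 1 sf) -(flat_y a1 b1 e1 s1) -(flat_y a2 b2 e2 s2).
  exact: (lin_eq_flat (sD _ _ S) (sD _ _ S1) (sD _ _ S2) (@lin_eq_derive _ _ _ _ _ false ((0, 1), 0) S S1 S2 H)).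
- rewrite -(flat_z 0 0 1 sf) -(flat_z a1 b1 e1 s1) -(flat_z a2 b2 e2 s2).
  exact: (lin_eq_flat (sD _ _ S) (sD _ _ S1) (sD _ _ S2) (@lin_eq_derive _ _ _ _ _ false ((0, 0), 1) S S1 S2 H)).
- rewrite -(flat_t 0 0 1 sf) -(flat_t a1 b1 e1 s1) -(flat_t a2 b2 e2 s2).
  exact: (lin_eq_flat (sD _ _ S) (sD _ _ S1) (sD _ _ S2) (@lin_eq_derive _ _ _ _ _ true ((0, 0), 0) S S1 S2 H)).
Qed.

Lemma derive_Umu d p v : fluid d p ->
  'D_v (Umu (dP d) (dS d)) p
  = ((nu d * 'D_v (V1 d) p, nu d * 'D_v (V2 d) p), 'D_v (W d) p).
Proof.
move=> Fp.
have d1 := derivableP (@smooth_on_derivable R _ (fluid d) _ (@V1 R d) p v (@sV1 R d) Fp).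
have d2 := derivableP (@smooth_on_derivable R _ (fluid d) _ (@V2 R d) p v (@sV2 R d) Fp).
have d3 := derivableP (@smooth_on_derivable R _ (fluid d) _ (@W R d) p v (@sW R d) Fp).
have D : is_derive p v (fun q => ((nu d *: V1 d q, nu d *: V2 d q), W d q))
   ((nu d *: 'D_v (V1 d) p, nu d *: 'D_v (V2 d) p), 'D_v (W d) p).
  by apply: is_derive_pair; apply: is_derive_pair; apply: is_deriveZ.
by case: D.
Qed.

Lemma derive_omega d p v : fluid d p ->
  'D_v (omega (dS d)) p = (('D_v (o1 d) p, 'D_v (o2 d) p), 'D_v (o3 d) p).
Proof.
move=> Fp; have sO := smooth_omega d.
rewrite /o1 /o2 /o3 (derive_linear_comp _ (@cont_c1 R) sO Fp) (derive_linear_comp _ (@cont_c2 R) sO Fp)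
  (derive_linear_comp _ (@cont_c3 R) sO Fp).
by case: ('D_v _ _) => [[]].
Qed.

(** With horizontal velocity [nu V] and [mu = nu ^+ 2], the horizontal curl equations carry a factor
    [nu] and the vertical one a factor [nu ^+ 2], which are divided out. *)
Lemma div_curl_interior d p : interior d p -> let m := mu (dP d) in let g := gam (dP d) in
  [/\ fN 0 0 1 (@W R) d p = - m * fN 1 0 0 (@V1 R) d p + - m * g * fN 0 1 0 (@V2 R) d p,
      fN 0 0 1 (@V1 R) d p = 1 * fN 1 0 0 (@W R) d p + nu d * o2 d p,
      fN 0 0 1 (@V2 R) d p = g * fN 0 1 0 (@W R) d p + - nu d * o1 d p
    & o3 d p = 1 * fN 1 0 0 (@V2 R) d p + - g * fN 0 1 0 (@V1 R) d p].
Proof.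
move=> ip m g; have Fp := interior_fluid ip; have [Ip Op] := ip.
have [_ /(_ _ Ip)[_ [_ Hc Hd _ _] _ _ _]] := system d.
have n0 := nu_gt0 d; have n00 : nu d != 0 by rewrite gt_eqF.
have n2 : m = nu d * nu d by rewrite -expr2 nu2.
have pE : (p.1, p.2) = p by rewrite -surjective_pairing.
move: (Hc _ Op) (Hd _ Op); rewrite pE /curl /div3 /D1 /D2 /D3 /dx3 /dy3 /dz3 !derive_Umu//.
rewrite -/(nu d) -/m -/g => -[h1 h2 h3] h4.
rewrite /= in h1 h2 h3 h4.
have e1 : omega (dS d) p = ((o1 d p, o2 d p), o3 d p) by rewrite /o1 /o2 /o3 /=; case: (omega _ _) => [[]].
rewrite e1 /= in h1 h2 h3.
split.
- by move: h4; rewrite /GRing.scale/= n2 => h4; apply/eqP; rewrite -subr_eq0; apply/eqP; rewrite -[RHS]h4; rewrite /fN/= /dx3 /dy3 /dz3; ring.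
- apply: (mulfI n00); move: h2; rewrite /GRing.scale/= n2 /fN/= /dx3 /dz3 => h2.
  by apply/eqP; rewrite -subr_eq0; apply/eqP; move/eqP: h2; rewrite -subr_eq0 => /eqP h2; rewrite -[RHS]h2; ring.
- apply: (mulfI n00); move: h1; rewrite /GRing.scale/= n2 /fN/= /dy3 /dz3 => h1.
  by apply/eqP; rewrite -subr_eq0; apply/eqP; move/eqP: h1; rewrite -subr_eq0 => /eqP h1; rewrite -[RHS]oppr0 -[in RHS]h1; ring.
- apply: (mulfI (mulf_neq0 n00 n00)); move: h3; rewrite /GRing.scale/= n2 /fN/= /dx3 /dy3 => h3.
  by apply/eqP; rewrite -subr_eq0; apply/eqP; move/eqP: h3; rewrite -subr_eq0 => /eqP h3; rewrite -[RHS]oppr0 -[in RHS]h3; ring.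
Qed.

End Equations.

Section Opp.
Variable R : realType.

Lemma order_opp k (a : data R -> R) : order k a -> order k (fun d => - a d).
Proof. by move=> [m H]; exists m => d; rewrite normrN. Qed.

Lemma O_opp b k (F : family R) : O b k F -> O b k (fun d th X => - F d th X).
Proof.
move=> H.
have -> : (fun d th X => - F d th X) = (fun (d : data R) (th : R) (X : vec2 R) => -1 * F d th X).
  by apply/funext => d; apply/funext => th; apply/funext => X; rewrite mulN1r.
have o1 : O false 0 (fun (_ : data R) (_ : R) (_ : vec2 R) => -1 : R).
  by apply: (@O_scalar R 0 (fun=> -1)); apply: order_cst; rewrite normrN normr1 ler1n.
by apply: (@O_weaken _ _ b _ k _ (O_mul o1 H)); [case: (b)|].
Qed.

Definition at1 (F : family R) : family R := fun d _ X => F d 1 X.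
Lemma O_at1 b k F : O b k F -> O b k (at1 F).
Proof. by move=> H; exact: (@O_reparam R b k F (fun=> 1) (@cC R _ 1) H). Qed.

End Opp.

(* Constants are opaque in the hint database so that distinct derivatives are compared syntactically. *)
Create HintDb odb discriminated.
#[global] Hint Constants Opaque : odb.
#[global] Hint Variables Opaque : odb.
#[global] Hint Resolve O_zeta O_dt_zeta O_h O_clamp : odb.
(* Priority 9 places these order-0 bounds behind the sharper ones added later for the same
   fields. *)
#[global] Hint Resolve O_V1 O_V2 O_W O_o1 O_o2 O_o3 O_V1t O_V2t O_Wt | 9 : odb.

Ltac order_tac := first
  [ exact: order_eps_nu_Ro | exact: order_eps_mu | exact: order_eps_nu | exact: order_eps_Ro
  | exact: order_eps | exact: order_gam | exact: order_mu | exact: order_nu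
  | (apply: order_cst; rewrite ?normrN ger0_norm; lra)
  | (eapply order_opp; order_tac) | (eapply order_mul; order_tac) ].

Ltac syntactic_assumption := match goal with
  | H : O _ _ ?F |- O _ _ ?F => eapply H
  end.

Ltac O_step := lazymatch goal with
  | |- O _ _ (fun d th X => @?c d) => eapply (@O_scalar _ _ c); cbv beta; order_tac
  | |- O _ _ (fun d th X => clamp th) => exact: O_clamp
  | |- O _ _ (fun d th X => @?F d th X + @?G d th X) => eapply (@O_add _ _ _ _ _ F G); cbv beta; O_step
  | |- O _ _ (fun d th X => - @?F d th X) => eapply (@O_opp _ _ _ F); cbv beta; O_step
  | |- O _ _ (fun d th X => @?F d th X * @?G d th X) => eapply (@O_mul _ _ _ _ _ F G); cbv beta; O_step
  | |- O _ _ (fun d th X => px ?F d th X) => eapply (@O_px _ _ _ F); O_step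
  | |- O _ _ (fun d th X => py ?F d th X) => eapply (@O_py _ _ _ F); O_step
  | |- O _ _ (fun d th X => avg ?F d th X) => eapply (@O_avg _ _ _ F); O_step
  | |- O _ _ (fun d th X => prim ?F d th X) => eapply (@O_prim _ _ _ F); O_step
  | |- O _ _ (fun d th X => at1 ?F d th X) => eapply (@O_at1 _ _ _ F); O_step
  | |- O _ _ (px ?F) => eapply (@O_px _ _ _ F); O_step
  | |- O _ _ (py ?F) => eapply (@O_py _ _ _ F); O_step
  | |- O _ _ (avg ?F) => eapply (@O_avg _ _ _ F); O_step
  | |- O _ _ (prim ?F) => eapply (@O_prim _ _ _ F); O_step
  | |- O _ _ (at1 ?F) => eapply (@O_at1 _ _ _ F); O_step
  | |- O _ _ (fun d th X => ?F d th X) => change (fun d th X => F d th X) with F; O_step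
  | |- _ => first [ syntactic_assumption | solve [typeclasses eauto 1 with odb] ]
  end.

(** [O_step] computes flag and order of the expression by unification; the two [done] compare them
    with the claimed ones. *)
Ltac O_tac := eapply O_weaken; [ O_step | done | done ].

Local Notation "''F' f" := (flat (fN 0 0 0 f)) (at level 8, f at level 2).
Local Notation "''Fx' f" := (flat (fN 1 0 0 f)) (at level 8, f at level 2).
Local Notation "''Fy' f" := (flat (fN 0 1 0 f)) (at level 8, f at level 2).
Local Notation "''Fz' f" := (flat (fN 0 0 1 f)) (at level 8, f at level 2).
Local Notation zx := (px (surf (@zetaf _))).
Local Notation zy := (py (surf (@zetaf _))).
Local Notation zt := (surf (@dt_zetaf _)).

(** * The vorticity equation and the bottom condition *)

Section Vorticity.
Variable R : realType.
Implicit Types (d : data R).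
Local Notation V1 := (@V1 R). Local Notation V2 := (@V2 R). Local Notation W := (@W R).
Local Notation o1 := (@o1 R). Local Notation o2 := (@o2 R). Local Notation o3 := (@o3 R).

(** The horizontal vorticity equation solved for d_t omega, [V] being the velocity component that
    matches [o]. The [1 / nu] in the last two coefficients is [nu / mu]. *)
Definition vort_rhs (o V : ffield R) d th X : R :=
  let e := eps (dP d) in let g := gam (dP d) in
  - (e * ('F V1 d th X * 'Fx o d th X + g * ('F V2 d th X * 'Fy o d th X)))
  - e / mu (dP d) * ('F W d th X * 'Fz o d th X)
  + e * ('F o1 d th X * 'Fx V d th X + g * ('F o2 d th X * 'Fy V d th X))
  + e / nu d * ('F o3 d th X * 'Fz V d th X)
  + e / Ro (dP d) / nu d * 'Fz V d th X.

Lemma vort_alg (e g r n a1 a2 a3 v1 v2 w ot ox oy oz Vx Vy Vz : R) : n != 0 -> r != 0 ->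
  ot + e / (n * n) * (n * v1 * (n * ox) + n * v2 * (n * g * oy) + w * oz)
  = e / (n * n) * (a1 * (n * (n * Vx)) + a2 * (n * g * (n * Vy)) + a3 * (n * Vz))
    + e / (n * n * r) * (n * Vz) ->
  ot = - (e * (v1 * ox + g * (v2 * oy))) - e / (n * n) * (w * oz)
       + e * (a1 * Vx + g * (a2 * Vy)) + e / n * (a3 * Vz) + e / r / n * Vz.
Proof.
move=> n0 r0 H; apply: (@addIr _ (e / (n * n) * (n * v1 * (n * ox) + n * v2 * (n * g * oy) + w * oz))).
by rewrite H; field; rewrite n0.
Qed.

Lemma vorticity_interior d th X : 0 < th < 1 ->
  'F (fdt o1) d th X = vort_rhs o1 V1 d th X /\ 'F (fdt o2) d th X = vort_rhs o2 V2 d th X.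
Proof.
move=> t01; have [Ip Op] := level_interior d X t01.
have Fp := interior_fluid (conj Ip Op).
have [_ /(_ _ Ip)[_ _ _ _ Hv]] := system d.
have n0 := nu_gt0 d; have n00 : nu d != 0 by rewrite gt_eqF.
have r0 : Ro (dP d) != 0 by have [[_ _ _ r0] _] := regimeP d; rewrite gt_eqF.
move: (Hv _ Op); rewrite /vorticity_eq -surjective_pairing /adv3 /D1 /D2 /D3.
rewrite /dt3 /dx3 /dy3 /dz3 !(derive_Umu _ Fp) !(derive_omega _ Fp) -/(nu d).
rewrite /vort_rhs /flat /fN /= /fdt /dt3 /dx3 /dy3 /dz3.
have -> : mu (dP d) = nu d * nu d by rewrite -expr2 nu2.
set p := level d th (dt d, X).
have e1 : omega (dS d) p = ((o1 d p, o2 d p), o3 d p) by rewrite /o1 /o2 /o3 /=; case: (omega _ _) => [[]].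
rewrite e1 /= -[(velV (dS d) p).1]/(V1 d p) -[(velV (dS d) p).2]/(V2 d p) -[velw (dS d) p]/(W d p).
move=> [h1 h2 _]; move: h1 h2; rewrite /GRing.scale/=.
have -> : Num.sqrt (nu d * nu d) = nu d by rewrite -expr2 sqrtr_sqr gtr0_norm.
by move=> h1 h2; split; [exact: (vort_alg n00 r0 h1)|exact: (vort_alg n00 r0 h2)].
Qed.

Lemma O_ext b k (F G : family R) : (forall d th X, F d th X = G d th X) -> O b k G -> O b k F.
Proof. by move=> FG; suff -> : F = G by []; do 3 (apply/funext => ?); exact: FG. Qed.

Lemma vorticity_flat d th X :
  'F (fdt o1) d th X = vort_rhs o1 V1 d th X /\ 'F (fdt o2) d th X = vort_rhs o2 V2 d th X.
Proof.
(* The class provides continuity in the level, from which the equation is extended to the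
   boundary. *)
have O1 : O true 0 (vort_rhs o1 V1) by rewrite /vort_rhs; O_tac.
have O2 : O true 0 (vort_rhs o2 V2) by rewrite /vort_rhs; O_tac.
have cl o V t : vort_rhs o V d (clamp t) X = vort_rhs o V d t X by rewrite /vort_rhs /flat (level_clamp d t (dt d, X)).
split.
  apply: (@clamp_ext R (fun t => 'F (fdt o1) d t X) (fun t => vort_rhs o1 V1 d t X)).
  - exact: flat_cont (sfluid_dt (@so1 R)).
  - exact: (@reg_cont1 R _ d X (O_reg O1)).
  - by move=> t; exact: flat_clamp.
  - exact: cl.
  by move=> t t01; have [] := vorticity_interior d X t01.
apply: (@clamp_ext R (fun t => 'F (fdt o2) d t X) (fun t => vort_rhs o2 V2 d t X)).
- exact: flat_cont (sfluid_dt (@so2 R)).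
- exact: (@reg_cont1 R _ d X (O_reg O2)).
- by move=> t; exact: flat_clamp.
- exact: cl.
by move=> t t01; have [] := vorticity_interior d X t01.
Qed.

Lemma lin_W : lin_eq (fN 0 0 1 W) (fN 1 0 0 V1) (fN 0 1 0 V2)
  (fun d => - mu (dP d)) (fun d => - mu (dP d) * gam (dP d)).
Proof. by move=> d p ip; have [h _ _ _] := div_curl_interior ip. Qed.
Lemma lin_V1 : lin_eq (fN 0 0 1 V1) (fN 1 0 0 W) (fN 0 0 0 o2) (fun=> 1) (@nu R).
Proof. by move=> d p ip; have [_ h _ _] := div_curl_interior ip. Qed.
Lemma lin_V2 : lin_eq (fN 0 0 1 V2) (fN 0 1 0 W) (fN 0 0 0 o1) (fun d => gam (dP d)) (fun d => - nu d).
Proof. by move=> d p ip; have [_ _ h _] := div_curl_interior ip. Qed.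

Definition jetW := lin_eq_jet (@sW R) (@sV1 R) (@sV2 R) lin_W.
Definition jetV1 := lin_eq_jet (@sV1 R) (@sW R) (@so2 R) lin_V1.
Definition jetV2 := lin_eq_jet (@sV2 R) (@sW R) (@so1 R) lin_V2.

Lemma vert_vorticity d th X :
  'F o3 d th X = 1 * 'Fx V2 d th X + - gam (dP d) * 'Fy V1 d th X.
Proof.
apply: (@lin_eq_flat R (fN 0 0 0 o3) (fN 1 0 0 V2) (fN 0 1 0 V1) (fun=> 1) (fun d => - gam (dP d))).
- exact: (@so3 R).
- exact: (sfluid_fN 1 0 0 (@sV2 R)).
- exact: (sfluid_fN 0 1 0 (@sV1 R)).
by move=> d' p ip; have [_ _ _ h] := div_curl_interior ip.
Qed.

Lemma level0 d X : level d 0 (dt d, X) = (dt d, (X, -1)).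
Proof. by rewrite /level /= clamp_id ?lexx ?ler01// mul0r addr0. Qed.

Lemma bottom_W d X : 'F W d 0 X = 0.
Proof.
rewrite /flat level0; have [_ /(_ _ (dI_dt d))[_ [_ _ _ _ hb] _ _ _]] := system d.
exact: hb.
Qed.

(** The bottom condition is known at times of the interval only, so it is differentiated along
    one-sided steps. *)
Lemma bottom_Wt d X : 'F (fdt W) d 0 X = 0.
Proof.
rewrite /flat level0.
have bW t : dI d t -> W d (t, (X, -1)) = 0.
  by move=> It; have [_ /(_ _ It)[_ [_ _ _ _ hb] _ _ _]] := system d; exact: hb.
have Fp : fluid d (dt d, (X, -1)).
  by rewrite -level0; apply: level_fluid; exact: dI_dt.
apply: (@derive_one_sided R _ (W d) (dt d, (X, -1)) (et3 R)).
- exact: (@smooth_on_derivable R _ (fluid d) _ _ _ _ (@sW R d) Fp).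
- by apply: bW; exact: dI_dt.
move=> e e0; have [k k0 Ik] := time_steps (dI_dt d).
have k1 : 0 < `|k| by rewrite normr_gt0.
pose m := Num.min 1 (e / 2 / `|k|).
have m0 : 0 < m by rewrite lt_min ltr01 !divr_gt0.
have m1 : m <= 1 by rewrite ge_min lexx.
have mk : m * `|k| < e.
  apply: (@le_lt_trans _ _ (e / 2)); last by rewrite ltr_pdivrMr// ltr_pMr// ltr1n.
  by rewrite -ler_pdivlMr// ge_min lexx orbT.
exists (m * k); split; [by rewrite mulf_neq0// gt_eqF|by rewrite normrM (gtr0_norm m0)|].
have -> : (m * k) *: et3 R + (dt d, (X, -1)) = (m * k + dt d, (X, -1)).
  rewrite /et3; apply: injective_projections => /=; first by rewrite [_ *: 1]mulr1.
  apply: injective_projections => /=; last by rewrite [_ *: 0]mulr0 add0r.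
  by apply: injective_projections => /=; rewrite [_ *: 0]mulr0 add0r.
by apply: bW; apply: Ik; rewrite (ltW m0).
Qed.

End Vorticity.

(** * Rules for means and primitives *)

Section Averages.
Variable R : realType.
Implicit Types (d : data R) (F G : family R).

Lemma reg_th F d X : reg F -> continuous (fun s => F d s X).
Proof. by move=> rF; exact: (@reg_cont1 R F d X rF). Qed.

Lemma avg_ext F G d th X : (forall s, 0 <= s <= 1 -> F d s X = G d s X) ->
  avg F d th X = avg G d th X.
Proof. by move=> FG; apply: J_eq. Qed.

Lemma avg_add F G d th X : reg F -> reg G ->
  avg (fun d th X => F d th X + G d th X) d th X = avg F d th X + avg G d th X.
Proof. by move=> rF rG; apply: JD; exact: reg_th. Qed.

Lemma avg_scale (c : data R -> vec2 R -> R) F d th X : reg F ->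
  avg (fun d th X => c d X * F d th X) d th X = c d X * avg F d th X.
Proof. by move=> rF; rewrite /avg /avgf JZ//; exact: reg_th. Qed.

Lemma avg_const (c : data R -> vec2 R -> R) d th X : avg (fun d _ X => c d X) d th X = c d X.
Proof. by rewrite /avg /avgf J_cst ?ler01// subr0 mulr1. Qed.

Lemma prim_ext F G d th X : (forall s, F d s X = G d s X) -> prim F d th X = prim G d th X.
Proof. by move=> FG; rewrite /prim /avgf; congr (_ * _); apply: J_eq. Qed.

Let cscale (c : R) F d X : reg F -> continuous (fun s => F d (c * s) X).
Proof.
move=> rF s; apply: (@continuous_comp _ _ _ (fun s => c * s) (fun t => F d t X) s).
  exact: (@cM R R (fun=> c) id (@cC R _ c) (fun s => @cont_id _ s)).
exact: (@reg_th F d X rF).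
Qed.

Lemma prim_add F G d th X : reg F -> reg G ->
  prim (fun d th X => F d th X + G d th X) d th X = prim F d th X + prim G d th X.
Proof.
by move=> rF rG; rewrite /prim /avgf JD ?mulrDr//; exact: cscale.
Qed.

Lemma prim_scale (c : data R -> vec2 R -> R) F d th X : reg F ->
  prim (fun d th X => c d X * F d th X) d th X = c d X * prim F d th X.
Proof.
move=> rF; have e := JZ 0 1 (c d X) (@cscale (clamp th) F d X rF).
exact: (etrans (congr1 (fun r => clamp th * r) e) (mulrCA _ _ _)).
Qed.

Lemma prim_const (c : data R -> vec2 R -> R) d th X :
  prim (fun d _ X => c d X) d th X = clamp th * c d X.
Proof. by rewrite /prim /avgf J_cst ?ler01// subr0 mulr1. Qed.

Lemma reg_clamp : reg (fun (_ : data R) th (_ : vec2 R) => clamp th).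
Proof. exact: O_reg (@O_clamp R). Qed.

Lemma derive_sqr_half (s : R) : is_derive s 1 (fun t : R => t ^+ 2 / 2) s.
Proof.
have -> : (fun t : R => t ^+ 2 / 2) = 2^-1 *: (@id R) ^+ 2.
  by apply/funext => t; rewrite mulrC.
have : is_derive s 1 (2^-1 *: (@id R) ^+ 2) (2^-1 *: ((2%:R * s ^+ 1) *: 1)).
  exact: is_deriveZ.
by rewrite expr1 [(_ *: 1)]mulr1 /GRing.scale/= mulrA mulVf ?mul1r// pnatr_eq0.
Qed.

Lemma csqrh : continuous (fun t : R => t ^+ 2 / 2).
Proof. by apply: cM; [apply: csqr => s; exact: cont_id|exact: cC]. Qed.

Lemma prim_clamp d th X : prim (fun (_ : data R) th (_ : vec2 R) => clamp th) d th X
  = clamp th ^+ 2 / 2.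
Proof.
have := @prim_FTC R (fun _ t _ => t ^+ 2 / 2) (fun _ t _ => clamp t) d X csqrh (@continuous_clamp R) _ th.
rewrite expr0n/= mul0r subr0; apply => s /andP[s0 s1].
by rewrite clamp_id ?(ltW s0) ?(ltW s1)//; exact: derive_sqr_half.
Qed.

Lemma avg_clamp_sqr d th X : avg (fun (_ : data R) th (_ : vec2 R) => clamp th ^+ 2 / 2) d th X = 6^-1.
Proof.
rewrite /avg /avgf (@J_eq _ _ _ _ (fun s => s ^+ 2 / 2)); last by move=> s s01; rewrite clamp_id.
have c3 : continuous (fun s : R => s ^+ 3 / 6).
  by apply: cM; [|exact: cC] => s; apply: (@exprn_continuous R 3 s).
apply: (etrans (@J_FTC R 0 1 (fun s => s ^+ 3 / 6) _ ler01 c3 csqrh _)); last first.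
  by rewrite expr1n expr0n/= mul0r subr0 mul1r.
move=> s _.
have -> : (fun t : R => t ^+ 3 / 6) = 6^-1 *: (@id R) ^+ 3.
  by apply/funext => t; rewrite mulrC.
have D : is_derive s 1 (6^-1 *: (@id R) ^+ 3) (6^-1 *: ((3%:R * s ^+ 2) *: 1)).
  exact: is_deriveZ.
apply: (is_derive_eq D); rewrite [(_ *: 1)]mulr1 /GRing.scale/=.
by field.
Qed.

End Averages.

(** * Orders of w, d_z V and their time derivatives *)

Section Smallness.
Variable R : realType.
Implicit Types (d : data R) (F G : family R) (f : ffield R).
Local Notation V1 := (@V1 R). Local Notation V2 := (@V2 R). Local Notation W := (@W R).
Local Notation o1 := (@o1 R). Local Notation o2 := (@o2 R). Local Notation o3 := (@o3 R).
Local Notation hf := (@hf R).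

(** Passes the order of a field to its derivative at fixed height: [px] keeps the order, and the
    correction has the factor [eps]. *)
Lemma flat_x a b c f d th X : sfluid f -> flat (fN a.+1 b c f) d th X
  = px (flat (fN a b c f)) d th X
    - clamp th * (eps (dP d) * zx d th X) * flat (fN a b c.+1 f) d th X.
Proof.
move=> sf.
have e : px (flat (fN a b c f)) d th X = flat (fN a.+1 b c f) d th X +
    clamp th * (eps (dP d) * zx d th X) * flat (fN a b c.+1 f) d th X.
  rewrite -(flat_z a b c sf) (px_surf (@ssurf_zeta R)).
  exact: (congr1 (fun F : family R => F d th X) (px_flat (sfluid_fN a b c sf))).
by rewrite e addrK.
Qed.

Lemma flat_yE a b c f d th X : sfluid f -> flat (fN a b.+1 c f) d th X
  = py (flat (fN a b c f)) d th X
    - clamp th * (eps (dP d) * zy d th X) * flat (fN a b c.+1 f) d th X.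
Proof.
move=> sf.
have e : py (flat (fN a b c f)) d th X = flat (fN a b.+1 c f) d th X +
    clamp th * (eps (dP d) * zy d th X) * flat (fN a b c.+1 f) d th X.
  rewrite -(flat_z a b c sf) -(flat_y a b c sf) (py_surf (@ssurf_zeta R)).
  exact: (congr1 (fun F : family R => F d th X) (py_flat (sfluid_fN a b c sf))).
by rewrite e addrK.
Qed.

Lemma flat_primE f d th X : sfluid f -> 'F f d th X
  = 'F f d 0 X + prim (fun d th X => hf d th X * 'Fz f d th X) d th X.
Proof.
move=> sf; have H := @flat_prim R f d th X sf.
by apply: (etrans (esym (subrKC _ _))); congr (_ + _); exact: esym H.
Qed.

(** Incompressibility puts [mu] in front, and the derivatives of the equation keep it. *)
Lemma O_Wz : O true 2 ('Fz W).
Proof. by apply: O_ext => [d th X|]; [have [h _ _ _ _] := jetW d th X; exact: h|O_tac]. Qed.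
Lemma O_Wxz : O true 2 (flat (fN 1 0 1 W)).
Proof. by apply: O_ext => [d th X|]; [have [_ h _ _ _] := jetW d th X; exact: h|O_tac]. Qed.
Lemma O_Wyz : O true 2 (flat (fN 0 1 1 W)).
Proof. by apply: O_ext => [d th X|]; [have [_ _ h _ _] := jetW d th X; exact: h|O_tac]. Qed.
Lemma O_Wtz : O true 2 ('Fz (fdt W)).
Proof. by apply: O_ext => [d th X|]; [have [_ _ _ _ h] := jetW d th X; exact: h|O_tac]. Qed.
Hint Resolve O_Wz O_Wxz O_Wyz O_Wtz : odb.

Lemma W_prim d th X : 'F W d th X = prim (fun d th X => hf d th X * 'Fz W d th X) d th X.
Proof. by rewrite flat_primE; [rewrite bottom_W add0r|exact: sW]. Qed.
Lemma Wt_prim d th X : 'F (fdt W) d th X = prim (fun d th X => hf d th X * 'Fz (fdt W) d th X) d th X.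
Proof. by rewrite flat_primE; [rewrite bottom_Wt add0r|exact/sfluid_dt/sW]. Qed.

(** Vanishing at the bottom, [w] is the primitive of its vertical derivative, which has order 2. *)
Lemma O_W2 : O true 2 ('F W).
Proof.
by apply: (O_ext W_prim); O_tac.
Qed.
Lemma O_Wt2 : O true 2 ('F (fdt W)).
Proof. by apply: (O_ext Wt_prim); O_tac. Qed.
Hint Resolve O_W2 O_Wt2 : odb.

Let sW := @sW R. Let sV1 := @sV1 R. Let sV2 := @sV2 R.

Lemma O_Wx : O true 2 ('Fx W).
Proof. by apply: (O_ext (fun d th X => flat_x 0 0 0 d th X sW)); O_tac. Qed.
Lemma O_Wy : O true 2 ('Fy W).
Proof. by apply: (O_ext (fun d th X => flat_yE 0 0 0 d th X sW)); O_tac. Qed.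
Hint Resolve O_Wx O_Wy : odb.
Lemma O_Wxx : O true 2 (flat (fN 2 0 0 W)).
Proof. by apply: (O_ext (fun d th X => flat_x 1 0 0 d th X sW)); O_tac. Qed.
Lemma O_Wxy : O true 2 (flat (fN 1 1 0 W)).
Proof. by apply: (O_ext (fun d th X => flat_yE 1 0 0 d th X sW)); O_tac. Qed.
Lemma O_Wyy : O true 2 (flat (fN 0 2 0 W)).
Proof. by apply: (O_ext (fun d th X => flat_yE 0 1 0 d th X sW)); O_tac. Qed.
Hint Resolve O_Wxx O_Wxy O_Wyy : odb.
Lemma O_Wtx : O true 2 ('Fx (fdt W)).
Proof. by apply: (O_ext (fun d th X => flat_x 0 0 0 d th X (sfluid_dt sW))); O_tac. Qed.
Lemma O_Wty : O true 2 ('Fy (fdt W)).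
Proof. by apply: (O_ext (fun d th X => flat_yE 0 0 0 d th X (sfluid_dt sW))); O_tac. Qed.
Hint Resolve O_Wtx O_Wty : odb.

Lemma O_V1z : O true 1 ('Fz V1).
Proof. by apply: O_ext => [d th X|]; [have [h _ _ _ _] := jetV1 d th X; exact: h|O_tac]. Qed.
Lemma O_V2z : O true 1 ('Fz V2).
Proof. by apply: O_ext => [d th X|]; [have [h _ _ _ _] := jetV2 d th X; exact: h|O_tac]. Qed.
Hint Resolve O_V1z O_V2z : odb.

(** Every term of [vort_rhs] has order at least 2 except the last one, where [eps / Ro / nu] has
    order 0 and d_z V order 1. *)
Lemma O_o1t : O true 1 ('F (fdt o1)).
Proof. by apply: O_ext => [d th X|]; [have [h _] := vorticity_flat d th X; exact: h|rewrite /vort_rhs; O_tac]. Qed.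
Lemma O_o2t : O true 1 ('F (fdt o2)).
Proof. by apply: O_ext => [d th X|]; [have [_ h] := vorticity_flat d th X; exact: h|rewrite /vort_rhs; O_tac]. Qed.
Hint Resolve O_o1t O_o2t : odb.

(** One order better than d_z V: in the curl equation differentiated in time, the vorticity term is
    [nu] times d_t omega, itself of order 1, and the derivative of d_t w has order 2. *)
Lemma O_V1tz : O true 2 ('Fz (fdt V1)).
Proof. by apply: O_ext => [d th X|]; [have [_ _ _ _ h] := jetV1 d th X; exact: h|O_tac]. Qed.
Lemma O_V2tz : O true 2 ('Fz (fdt V2)).
Proof. by apply: O_ext => [d th X|]; [have [_ _ _ _ h] := jetV2 d th X; exact: h|O_tac]. Qed.
Hint Resolve O_V1tz O_V2tz : odb.

Lemma reg_at F c : reg F -> reg (fun d _ X => F d c X).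
Proof.
move=> rF d; have [cF xF yF] := rF d; split=> [p|th X|th X]; [|exact: xF|exact: yF].
exact: (@cont_comp2 _ R _ _ (F d) (fun=> c) snd p (cF _) (@cont_cst _ _ _ _) (@cont_snd _ _ p)).
Qed.

Definition osc F : family R := fun d th X => F d th X - avg F d th X.

(** The bottom value cancels in the difference, which leaves the primitive of [h] d_z f minus its
    own mean. *)
Lemma O_osc k f : sfluid f -> O true k ('Fz f) -> O true k (osc ('F f)).
Proof.
move=> sf Oz; pose K : family R := prim (fun d th X => hf d th X * 'Fz f d th X).
have OK : O true k K by rewrite /K; O_tac.
apply: (@O_ext _ _ _ _ (fun d th X => K d th X - avg K d th X)); last first.
  by apply: (O_weaken (O_add OK (O_opp (O_avg OK)))); rewrite ?minnn.
move=> d th X; rewrite /osc flat_primE//.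
have -> : avg ('F f) d th X = 'F f d 0 X + avg K d th X.
  rewrite (@avg_ext _ _ (fun d th X => 'F f d 0 X + K d th X)); last by move=> s _; exact: flat_primE.
  rewrite avg_add ?(avg_const (fun d X => 'F f d 0 X))//; last exact: O_reg OK.
  exact: (@reg_at ('F f) 0 (reg_flat sf)).
by rewrite -/(K d th X); ring.
Qed.

End Smallness.

#[local] Hint Resolve O_Wz O_Wxz O_Wyz O_Wtz O_W2 O_Wt2 O_Wx O_Wy O_Wxx O_Wxy O_Wyy O_Wtx O_Wty
  O_V1z O_V2z O_o1t O_o2t O_V1tz O_V2tz : odb.

(** * The vertical acceleration and the dispersive term *)

Section Pressure.
Variable R : realType.
Implicit Types (d : data R) (F G D : family R) (f : ffield R).
Local Notation V1 := (@V1 R). Local Notation V2 := (@V2 R). Local Notation W := (@W R).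
Local Notation o1 := (@o1 R). Local Notation o2 := (@o2 R). Local Notation o3 := (@o3 R).
Local Notation hf := (@hf R).
Let sW := @sW R. Let sV1 := @sV1 R. Let sV2 := @sV2 R.

Lemma px_split F G d th X : reg F -> reg G ->
  px (fun d th X => F d th X + G d th X) d th X = px F d th X + px G d th X.
Proof. by move=> rF rG; rewrite px_add. Qed.
Lemma py_split F G d th X : reg F -> reg G ->
  py (fun d th X => F d th X + G d th X) d th X = py F d th X + py G d th X.
Proof. by move=> rF rG; rewrite py_add. Qed.

Lemma px_scale (c : data R -> R -> R) F d th X : reg F ->
  px (fun d th X => c d th * F d th X) d th X = c d th * px F d th X.
Proof. by move=> rF; have [_ xF _] := rF d; exact: (deriveZ (c d th) (xF th X)). Qed.
Lemma py_scale (c : data R -> R -> R) F d th X : reg F ->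
  py (fun d th X => c d th * F d th X) d th X = c d th * py F d th X.
Proof. by move=> rF; have [_ _ yF] := rF d; exact: (deriveZ (c d th) (yF th X)). Qed.

#[local] Opaque fN px py.

(** The time derivative of [f] at fixed level: the level follows the surface with vertical speed
    [clamp th * eps] d_t zeta. *)
Definition slope f : family R := fun d th X =>
  'F (fdt f) d th X + clamp th * (eps (dP d) * zt d th X) * 'Fz f d th X.

(* The time derivative of the averaged velocity, see [dt_Vbar]. *)
Definition T1 : family R := avg (slope V1).
Definition T2 : family R := avg (slope V2).

Lemma O_slope1 : O true 0 (slope V1). Proof. by rewrite /slope; O_tac. Qed.
Lemma O_slope2 : O true 0 (slope V2). Proof. by rewrite /slope; O_tac. Qed.
Lemma O_T1 : O true 0 T1. Proof. exact: O_avg O_slope1. Qed.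
Lemma O_T2 : O true 0 T2. Proof. exact: O_avg O_slope2. Qed.
Hint Resolve O_T1 O_T2 : odb.

Definition e1 : family R := fun d th X => 'F (fdt V1) d th X - T1 d th X.
Definition e2 : family R := fun d th X => 'F (fdt V2) d th X - T2 d th X.

Lemma e_split f d th X : sfluid f ->
  O true 0 (fun d th X => clamp th * (eps (dP d) * zt d th X) * 'Fz f d th X) ->
  'F (fdt f) d th X - avg (slope f) d th X
  = osc ('F (fdt f)) d th X
    - avg (fun d th X => clamp th * (eps (dP d) * zt d th X) * 'Fz f d th X) d th X.
Proof.
move=> sf Ob; rewrite /osc /slope avg_add; first by rewrite opprD addrA.
  exact: reg_flat (sfluid_dt sf).
exact: O_reg Ob.
Qed.

(** Order 2, whereas [V] minus its mean has only order 1: d_t d_z V has order 2, and the motion of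
    the levels enters with the factor [eps]. *)
Lemma O_e1 : O true 2 e1.
Proof.
have Oo := O_osc (sfluid_dt sV1) (@O_V1tz R).
by apply: (O_ext (fun d th X => e_split d th X sV1 ltac:(O_tac))); O_tac.
Qed.
Lemma O_e2 : O true 2 e2.
Proof.
have Oo := O_osc (sfluid_dt sV2) (@O_V2tz R).
by apply: (O_ext (fun d th X => e_split d th X sV2 ltac:(O_tac))); O_tac.
Qed.
Hint Resolve O_e1 O_e2 : odb.

Definition divT : family R := fun d th X => px T1 d th X + gam (dP d) * py T2 d th X.
Lemma O_divT : O true 0 divT. Proof. by rewrite /divT; O_tac. Qed.
Hint Resolve O_divT : odb.

Definition delta : family R := fun d th X =>
  'Fx (fdt V1) d th X + gam (dP d) * 'Fy (fdt V2) d th X - divT d th X.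

Lemma delta_alg (g a b p1 p2 s1 s2 t1 t2 q1 q2 : R) : a = p1 - s1 -> b = p2 - s2 ->
  p1 = t1 + q1 -> p2 = t2 + q2 -> a + g * b - (t1 + g * t2) = q1 - s1 + g * (q2 - s2).
Proof. by move=> -> -> -> ->; ring. Qed.

Lemma O_delta : O true 2 delta.
Proof.
apply: (@O_ext _ _ _ _ (fun d th X =>
  (px e1 d th X - clamp th * (eps (dP d) * zx d th X) * 'Fz (fdt V1) d th X)
  + gam (dP d) * (py e2 d th X - clamp th * (eps (dP d) * zy d th X) * 'Fz (fdt V2) d th X)));
  last O_tac.
move=> d th X.
have E1 : 'F (fdt V1) = fun d th X => T1 d th X + e1 d th X.
  by do 3 (apply/funext => ?); exact: esym (subrKC _ _).
have E2 : 'F (fdt V2) = fun d th X => T2 d th X + e2 d th X.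
  by do 3 (apply/funext => ?); exact: esym (subrKC _ _).
have X1 : px ('F (fdt V1)) d th X = px T1 d th X + px e1 d th X.
  by rewrite E1; apply: px_split; [exact: O_reg O_T1|exact: O_reg O_e1].
have Y2 : py ('F (fdt V2)) d th X = py T2 d th X + py e2 d th X.
  by rewrite E2; apply: py_split; [exact: O_reg O_T2|exact: O_reg O_e2].
exact: (delta_alg _ (flat_x 0 0 0 d th X (sfluid_dt sV1)) (flat_yE 0 0 0 d th X (sfluid_dt sV2)) X1 Y2).
Qed.
Hint Resolve O_delta : odb.

Definition Wt_rem : family R := fun d th X => 'F (fdt W) d th X + mu (dP d) * (clamp th * divT d th X).

Lemma Wt_rem_alg (e z m g a b D w h : R) : w = - m * a + - m * g * b -> h = 1 + e * z ->
  h * w = - m * (a + g * b - D + e * z * (D + (a + g * b - D))) + - m * D.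
Proof. by move=> -> ->; ring. Qed.

(** The difference between [h] d_z d_t w and [- mu * divT], obtained from [h = 1 + eps zeta]. As
    [delta] and [eps] have order 2, it has order 4. *)
Definition Wt_rem_source : family R := fun d th X => - mu (dP d) *
  (delta d th X + eps (dP d) * surf (@zetaf R) d th X * (divT d th X + delta d th X)).

Lemma O_Wt_rem_source : O true 4 Wt_rem_source.
Proof. by rewrite /Wt_rem_source; O_tac. Qed.

Lemma prim_Wt d th X : 'F (fdt W) d th X
  = prim Wt_rem_source d th X + clamp th * (- mu (dP d) * divT d th X).
Proof.
apply: (etrans (Wt_prim d th X)); apply: etrans; last first.
  apply: (congr1 (fun r => _ + r)).
  exact: (@prim_const R (fun d X => - mu (dP d) * divT d 0 X) d th X).
apply: etrans; last first.
  apply: (@prim_add R Wt_rem_source (fun d _ X => - mu (dP d) * divT d 0 X)).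
    exact: O_reg O_Wt_rem_source.
  by apply: (@O_reg _ true 0); apply: (O_weaken (O_mul (O_scalar (order_opp (@order_mu R))) O_divT)).
apply: prim_ext => s; have [_ _ _ _ wz] := jetW d s X.
exact: (@Wt_rem_alg (eps (dP d)) (surf (@zetaf R) d s X) _ _ _ _ (divT d s X) _ _ wz erefl).
Qed.

Lemma O_Wt_rem : O true 4 Wt_rem.
Proof.
apply: (@O_ext _ _ _ _ (prim Wt_rem_source)); last exact: O_prim O_Wt_rem_source.
move=> d th X; rewrite /Wt_rem; move: (prim_Wt d th X).
move: ('F (fdt W) d th X) (prim _ _ _ _) (divT _ _ _) => a b c.
by move: (clamp th) (mu _) => x y ->; clear; ring.
Qed.
Hint Resolve O_Wt_rem : odb.

Lemma Wt_split : 'F (fdt W) = fun d th X => Wt_rem d th X + (- mu (dP d) * clamp th) * divT d th X.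
Proof. by do 3 (apply/funext => ?); rewrite /Wt_rem; ring. Qed.

(** The [x]-derivative at fixed height of d_t w + eps V.grad w + (eps/mu) w d_z w, expanded by the
    product rule. *)
Definition Gx : family R := fun d th X => let e := eps (dP d) in let g := gam (dP d) in
  'Fx (fdt W) d th X
  + e * ('Fx V1 d th X * 'Fx W d th X + 'F V1 d th X * flat (fN 2 0 0 W) d th X
         + g * ('Fx V2 d th X * 'Fy W d th X + 'F V2 d th X * flat (fN 1 1 0 W) d th X))
  + e / mu (dP d) * ('Fx W d th X * 'Fz W d th X + 'F W d th X * flat (fN 1 0 1 W) d th X).

Definition Gy : family R := fun d th X => let e := eps (dP d) in let g := gam (dP d) in
  'Fy (fdt W) d th X
  + e * ('Fy V1 d th X * 'Fx W d th X + 'F V1 d th X * flat (fN 1 1 0 W) d th X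
         + g * ('Fy V2 d th X * 'Fy W d th X + 'F V2 d th X * flat (fN 0 2 0 W) d th X))
  + e / mu (dP d) * ('Fy W d th X * 'Fz W d th X + 'F W d th X * flat (fN 0 1 1 W) d th X).

Lemma G_alg (w p S r m c D A B : R) : w = p - S -> p = r + (- m * c) * D ->
  w + A + B + m * (c * D) = r - S + A + B.
Proof. by move=> -> ->; ring. Qed.

Lemma px_Wt d th X : px ('F (fdt W)) d th X
  = px Wt_rem d th X + (- mu (dP d) * clamp th) * px divT d th X.
Proof.
apply: (etrans (congr1 (fun F : family R => px F d th X) Wt_split)).
apply: etrans; first apply: (@px_split Wt_rem (fun d th X => (- mu (dP d) * clamp th) * divT d th X)).
- exact: O_reg O_Wt_rem.
- by apply: (@O_reg _ true 0); apply: (O_weaken (O_mul (O_mul (O_scalar (order_opp (@order_mu R))) (@O_clamp R)) O_divT)).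
by apply: congr1; apply: (@px_scale (fun d th => - mu (dP d) * clamp th)); exact: O_reg O_divT.
Qed.

(** Only d_t w counts below order 4: in the quadratic terms [w] either has the factor [eps] or
    occurs twice against the bounded [eps / mu]. *)
Lemma O_Gx : O true 4 (fun d th X => Gx d th X + mu (dP d) * (clamp th * px divT d th X)).
Proof.
apply: (@O_ext _ _ _ _ (fun d th X =>
  (px Wt_rem d th X - clamp th * (eps (dP d) * zx d th X) * 'Fz (fdt W) d th X)
  + eps (dP d) * ('Fx V1 d th X * 'Fx W d th X + 'F V1 d th X * flat (fN 2 0 0 W) d th X
         + gam (dP d) * ('Fx V2 d th X * 'Fy W d th X + 'F V2 d th X * flat (fN 1 1 0 W) d th X))
  + eps (dP d) / mu (dP d) * ('Fx W d th X * 'Fz W d th X + 'F W d th X * flat (fN 1 0 1 W) d th X)));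
  last O_tac.
move=> d th X; exact: (G_alg _ _ (flat_x 0 0 0 d th X (sfluid_dt sW)) (px_Wt d th X)).
Qed.

Lemma py_Wt d th X : py ('F (fdt W)) d th X
  = py Wt_rem d th X + (- mu (dP d) * clamp th) * py divT d th X.
Proof.
apply: (etrans (congr1 (fun F : family R => py F d th X) Wt_split)).
apply: etrans; first apply: (@py_split Wt_rem (fun d th X => (- mu (dP d) * clamp th) * divT d th X)).
- exact: O_reg O_Wt_rem.
- by apply: (@O_reg _ true 0); apply: (O_weaken (O_mul (O_mul (O_scalar (order_opp (@order_mu R))) (@O_clamp R)) O_divT)).
by apply: congr1; apply: (@py_scale (fun d th => - mu (dP d) * clamp th)); exact: O_reg O_divT.
Qed.

Lemma O_Gy : O true 4 (fun d th X => Gy d th X + mu (dP d) * (clamp th * py divT d th X)).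
Proof.
apply: (@O_ext _ _ _ _ (fun d th X =>
  (py Wt_rem d th X - clamp th * (eps (dP d) * zy d th X) * 'Fz (fdt W) d th X)
  + eps (dP d) * ('Fy V1 d th X * 'Fx W d th X + 'F V1 d th X * flat (fN 1 1 0 W) d th X
         + gam (dP d) * ('Fy V2 d th X * 'Fy W d th X + 'F V2 d th X * flat (fN 0 2 0 W) d th X))
  + eps (dP d) / mu (dP d) * ('Fy W d th X * 'Fz W d th X + 'F W d th X * flat (fN 0 1 1 W) d th X)));
  last O_tac.
move=> d th X; exact: (G_alg _ _ (flat_yE 0 0 0 d th X (sfluid_dt sW)) (py_Wt d th X)).
Qed.

Section PressureOrder.
Variables G D : family R.
Hypotheses (D0 : forall d th X, D d th X = D d 0 X) (OD : O true 0 D)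
  (OGD : O true 4 (fun d th X => G d th X + mu (dP d) * (clamp th * D d th X))).

(** Chosen so that [h * G = pressure_rem - mu * D * clamp th]: since [eps zeta] times a term of
    order 2 has order 4, the depth may be replaced by 1 in the dispersive part. *)
Definition pressure_rem : family R := fun d th X =>
  hf d th X * (G d th X + mu (dP d) * (clamp th * D d th X))
  + - (eps (dP d) * surf (@zetaf R) d th X * (mu (dP d) * (clamp th * D d th X))).

Lemma O_pressure_rem : O true 4 pressure_rem.
Proof.
have O2 : O true 4 (fun d th X => eps (dP d) * surf (@zetaf R) d th X * (mu (dP d) * (clamp th * D d th X))).
  by O_tac.
by apply: (O_weaken (O_add (O_mul (@O_h R) OGD) (O_opp O2))).
Qed.

Lemma O_D0 : O true 2 (fun d th X => - mu (dP d) * D d 0 X).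
Proof.
have O0 : O true 0 (fun d (_ : R) X => D d 0 X) by exact: (@O_reparam R _ _ D (fun=> 0) (@cC R _ 0)).
exact: (O_weaken (O_mul (O_scalar (order_opp (@order_mu R))) O0)).
Qed.

Lemma pressure_alg (h G' m c D' z : R) : h = 1 + z ->
  h * G' = h * (G' + m * (c * D')) + - (z * (m * (c * D'))) + - m * D' * c.
Proof. by move=> ->; ring. Qed.

Lemma prim_pressure d th X : prim (fun d th X => hf d th X * G d th X) d th X
   = prim pressure_rem d th X + (- mu (dP d) * D d 0 X) * (clamp th ^+ 2 / 2).
Proof.
apply: etrans; last first.
  apply: (congr1 (fun r => _ + (- mu (dP d) * D d 0 X) * r)); exact: prim_clamp d th X.
apply: etrans; last first.
  apply: (congr1 (fun r => _ + r)).
  by apply: (@prim_scale R (fun d X => - mu (dP d) * D d 0 X)); exact: reg_clamp.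
apply: etrans; last first.
  apply: (@prim_add R pressure_rem (fun d th X => - mu (dP d) * D d 0 X * clamp th)).
    exact: O_reg O_pressure_rem.
  exact: O_reg (O_mul O_D0 (@O_clamp R)).
apply: prim_ext => s.
exact: (etrans (@pressure_alg (hf d s X) (G d s X) (mu (dP d)) (clamp s) (D d s X)
  (eps (dP d) * surf (@zetaf R) d s X) erefl)
  (congr1 (fun r => pressure_rem d s X + - mu (dP d) * r * clamp s) (D0 d s X))).
Qed.

Lemma pressure_avg_alg (a b k l m D' : R) : a = b + (- m * D') * 6^-1 ->
  k = l + (- m * D') * (1 / 2) -> a - k - m / 3 * D' = b - l.
Proof. by move=> -> ->; field. Qed.

(* [clamp^2 / 2] has average 1/6 and value 1/2 at the top; 1/2 - 1/6 = 1/3. *)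
Lemma O_pressure : O true 4 (fun d th X =>
    avg (prim (fun d th X => hf d th X * G d th X)) d th X
    - prim (fun d th X => hf d th X * G d th X) d 1 X - mu (dP d) / 3 * D d th X).
Proof.
have OQ := O_pressure_rem.
apply: (@O_ext _ _ _ _ (fun d th X => avg (prim pressure_rem) d th X - at1 (prim pressure_rem) d th X)); last first.
  by apply: (O_weaken (O_add (O_avg (O_prim OQ)) (O_opp (O_at1 (O_prim OQ))))).
have Oc : O false 0 (fun (_ : data R) th (_ : vec2 R) => clamp th ^+ 2 / 2).
  by apply: (O_weaken (O_mul (O_mul (@O_clamp R) (@O_clamp R)) (O_scalar (order_cst (c := 2^-1) _)))) => //; rewrite ger0_norm; lra.
move=> d th X.
have E : avg (prim (fun d th X => hf d th X * G d th X)) d th X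
    = avg (prim pressure_rem) d th X + (- mu (dP d) * D d 0 X) * 6^-1.
  apply: (etrans (@avg_ext R _ (fun d th X => prim pressure_rem d th X
    + (- mu (dP d) * D d 0 X) * (clamp th ^+ 2 / 2)) d th X (fun s _ => prim_pressure d s X))).
  apply: etrans; first apply: (@avg_add R (prim pressure_rem) (fun d th X => - mu (dP d) * D d 0 X * (clamp th ^+ 2 / 2))).
  - exact: O_reg (O_prim OQ).
  - exact: O_reg (O_mul O_D0 Oc).
  apply: (congr1 (fun r => _ + r)); apply: etrans.
    by apply: (@avg_scale R (fun d X => - mu (dP d) * D d 0 X)); exact: O_reg Oc.
  by rewrite avg_clamp_sqr.
have c1 : clamp (1 : R) = 1 by rewrite clamp_id// ler01 lexx.
rewrite (D0 d th X); apply: (pressure_avg_alg E).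
by have := prim_pressure d 1 X; rewrite c1 expr1n.
Qed.

End PressureOrder.

End Pressure.

#[local] Hint Resolve O_Wz O_Wxz O_Wyz O_Wtz O_W2 O_Wt2 O_Wx O_Wy O_Wxx O_Wxy O_Wyy O_Wtx O_Wty
  O_V1z O_V2z O_o1t O_o2t O_V1tz O_V2tz O_T1 O_T2 O_divT O_e1 O_e2 : odb.

(** * The vertical derivative of the horizontal momentum *)

Section VerticalMomentum.
Variable R : realType.
Implicit Types (d : data R) (F G D : family R) (f : ffield R).
Local Notation V1 := (@V1 R). Local Notation V2 := (@V2 R). Local Notation W := (@W R).
Local Notation o1 := (@o1 R). Local Notation o2 := (@o2 R). Local Notation o3 := (@o3 R).
Local Notation hf := (@hf R).
Let sW := @sW R. Let sV1 := @sV1 R. Let sV2 := @sV2 R.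
Lemma px_divT d th X : px (@divT R) d th X = px (@divT R) d 0 X. Proof. by []. Qed.
Lemma py_divT d th X : py (@divT R) d th X = py (@divT R) d 0 X. Proof. by []. Qed.
#[local] Opaque fN px py.

Lemma is_derive_momentum (a v1 x v2 y w z u : R -> R) (da dv1 dx dv2 dy dw dz du c g k l s : R) :
  is_derive s 1 a da -> is_derive s 1 v1 dv1 -> is_derive s 1 x dx ->
  is_derive s 1 v2 dv2 -> is_derive s 1 y dy -> is_derive s 1 w dw ->
  is_derive s 1 z dz -> is_derive s 1 u du ->
  is_derive s 1 (fun t => a t + c * (v1 t * x t + g * (v2 t * y t)) + k * (w t * z t) + l * u t)
    (da + c * (v1 s * dx + x s * dv1 + g * (v2 s * dy + y s * dv2)) + k * (w s * dz + z s * dw) + l * du).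
Proof.
move=> Da Dv1 Dx Dv2 Dy Dw Dz Du.
exact: (is_deriveD (is_deriveD (is_deriveD Da (is_deriveZ c (is_deriveD (is_deriveM Dv1 Dx)
  (is_deriveZ g (is_deriveM Dv2 Dy))))) (is_deriveZ k (is_deriveM Dw Dz))) (is_deriveZ l Du)).
Qed.

(** One formula for both components: [f] is the component, [u] the other one and [l] the signed
    Coriolis coefficient. *)
Definition mom f (u : ffield R) (l : data R -> R) : family R := fun d th X =>
  'F (fdt f) d th X
  + eps (dP d) * ('F V1 d th X * 'Fx f d th X + gam (dP d) * ('F V2 d th X * 'Fy f d th X))
  + eps (dP d) / mu (dP d) * ('F W d th X * 'Fz f d th X) + l d * 'F u d th X.

Definition dmom f (u : ffield R) (l : data R -> R) : family R := fun d th X =>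
  'Fz (fdt f) d th X
  + eps (dP d) * ('F V1 d th X * flat (fN 1 0 1 f) d th X + 'Fx f d th X * 'Fz V1 d th X
     + gam (dP d) * ('F V2 d th X * flat (fN 0 1 1 f) d th X + 'Fy f d th X * 'Fz V2 d th X))
  + eps (dP d) / mu (dP d) * ('F W d th X * flat (fN 0 0 2 f) d th X + 'Fz f d th X * 'Fz W d th X)
  + l d * 'Fz u d th X.

Lemma is_derive_flatN a b c f d X (th : R) : sfluid f -> 0 < th < 1 ->
  is_derive th 1 (fun t => flat (fN a b c f) d t X) (hf d th X * flat (fN a b c.+1 f) d th X).
Proof.
move=> sf t01; apply: is_derive_eq; first exact: is_derive_flat_theta (sfluid_fN a b c sf) t01.
by rewrite (flat_z a b c sf).
Qed.

Lemma mom_alg (h a v1 x v2 y w z u da dv1 dx dv2 dy dw dz du c g k l : R) :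
  h * da + c * (v1 * (h * dx) + x * (h * dv1) + g * (v2 * (h * dy) + y * (h * dv2)))
    + k * (w * (h * dz) + z * (h * dw)) + l * (h * du)
  = h * (da + c * (v1 * dx + x * dv1 + g * (v2 * dy + y * dv2)) + k * (w * dz + z * dw) + l * du).
Proof. ring. Qed.

Lemma is_derive_mom f u l d X (th : R) : sfluid f -> sfluid u -> 0 < th < 1 ->
  is_derive th 1 (fun t => mom f u l d t X) (hf d th X * dmom f u l d th X).
Proof.
move=> sf su t01.
have D a b c (k : ffield R) (sk : sfluid k) := @is_derive_flatN a b c k d X th sk t01.
apply: is_derive_eq.
  exact: (is_derive_momentum (eps (dP d)) (gam (dP d)) (eps (dP d) / mu (dP d)) (l d)
    (D 0%N 0%N 0%N _ (sfluid_dt sf)) (D 0%N 0%N 0%N _ sV1) (D 1%N 0%N 0%N _ sf)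
    (D 0%N 0%N 0%N _ sV2) (D 0%N 1%N 0%N _ sf) (D 0%N 0%N 0%N _ sW) (D 0%N 0%N 1%N _ sf)
    (D 0%N 0%N 0%N _ su)).
exact: mom_alg.
Qed.

Definition cor1 d := - (eps (dP d) / Ro (dP d)).
Definition cor2 d := eps (dP d) / Ro (dP d).
(* The components of [d_t V + eps V.grad V + (eps/mu) w d_z V + (eps/Ro) V^perp]. *)
Definition E1 := mom V1 V2 cor1.
Definition E2 := mom V2 V1 cor2.

(** An exact cancellation. Once the derivatives of d_z V are expressed by the divergence and curl
    equations and d_t omega by the vorticity equation, the vorticity and the Coriolis terms drop
    out, and the gradient of the vertical acceleration remains. *)
Lemma dmom1_alg (e g n r V1' V2' W' Wz Wx Wy Wxx Wxy Wxz V1x V1y V2x V2y o1' o2' o2x o2y o2z o3'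
   V1z V1xz V1yz V1zz V1tz Wtx o2t V2z : R) : n != 0 -> r != 0 ->
  V1z = 1 * Wx + n * o2' -> V1xz = 1 * Wxx + n * o2x -> V1yz = 1 * Wxy + n * o2y ->
  V1zz = 1 * Wxz + n * o2z -> V1tz = 1 * Wtx + n * o2t -> V2z = g * Wy + - n * o1' ->
  Wz = - n ^+ 2 * V1x + - n ^+ 2 * g * V2y -> o3' = 1 * V2x + - g * V1y ->
  o2t = - (e * (V1' * o2x + g * (V2' * o2y))) - e / n ^+ 2 * (W' * o2z)
    + e * (o1' * V2x + g * (o2' * V2y)) + e / n * (o3' * V2z) + e / r / n * V2z ->
  V1tz + e * (V1' * V1xz + V1x * V1z + g * (V2' * V1yz + V1y * V2z))
   + e / n ^+ 2 * (W' * V1zz + V1z * Wz) + - (e / r) * V2z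
  = Wtx + e * (V1x * Wx + V1' * Wxx + g * (V2x * Wy + V2' * Wxy))
   + e / n ^+ 2 * (Wx * Wz + W' * Wxz).
Proof. by move=> n0 r0 -> -> -> -> -> -> -> -> ->; field; rewrite n0 r0. Qed.

Lemma dmom2_alg (e g n r V1' V2' W' Wz Wx Wy Wyy Wxy Wyz V1x V1y V2x V2y o1' o2' o1x o1y o1z o3'
   V2z V2xz V2yz V2zz V2tz Wty o1t V1z : R) : n != 0 -> r != 0 ->
  V2z = g * Wy + - n * o1' -> V2xz = g * Wxy + - n * o1x -> V2yz = g * Wyy + - n * o1y ->
  V2zz = g * Wyz + - n * o1z -> V2tz = g * Wty + - n * o1t -> V1z = 1 * Wx + n * o2' ->
  Wz = - n ^+ 2 * V1x + - n ^+ 2 * g * V2y -> o3' = 1 * V2x + - g * V1y ->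
  o1t = - (e * (V1' * o1x + g * (V2' * o1y))) - e / n ^+ 2 * (W' * o1z)
    + e * (o1' * V1x + g * (o2' * V1y)) + e / n * (o3' * V1z) + e / r / n * V1z ->
  V2tz + e * (V1' * V2xz + V2x * V1z + g * (V2' * V2yz + V2y * V2z))
   + e / n ^+ 2 * (W' * V2zz + V2z * Wz) + e / r * V1z
  = g * (Wty + e * (V1y * Wx + V1' * Wxy + g * (V2y * Wy + V2' * Wyy))
   + e / n ^+ 2 * (Wy * Wz + W' * Wyz)).
Proof. by move=> n0 r0 -> -> -> -> -> -> -> -> ->; field; rewrite n0 r0. Qed.

Lemma Ro_neq0 d : Ro (dP d) != 0.
Proof. by have [[_ _ _ r0] _] := regimeP d; rewrite gt_eqF. Qed.
Lemma nu_neq0 d : nu d != 0. Proof. by rewrite gt_eqF// nu_gt0. Qed.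

Lemma dmom1 d th X : dmom V1 V2 cor1 d th X = Gx d th X.
Proof.
have [z1 xz1 yz1 zz1 tz1] := jetV1 d th X; have [z2 _ _ _ _] := jetV2 d th X.
have [wz _ _ _ _] := jetW d th X; have [_ vt] := vorticity_flat d th X.
have o3E := vert_vorticity d th X.
move: vt wz; rewrite /dmom /Gx /vort_rhs -(nu2 d) => vt wz.
exact: (dmom1_alg (nu_neq0 d) (Ro_neq0 d) z1 xz1 yz1 zz1 tz1 z2 wz o3E vt).
Qed.

Definition gGy : family R := fun d th X => gam (dP d) * Gy d th X.

Lemma dmom2 d th X : dmom V2 V1 cor2 d th X = gGy d th X.
Proof.
have [z2 xz2 yz2 zz2 tz2] := jetV2 d th X; have [z1 _ _ _ _] := jetV1 d th X.
have [wz _ _ _ _] := jetW d th X; have [vt _] := vorticity_flat d th X.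
have o3E := vert_vorticity d th X.
move: vt wz; rewrite /dmom /gGy /Gy /vort_rhs -(nu2 d) => vt wz.
exact: (dmom2_alg (nu_neq0 d) (Ro_neq0 d) z2 xz2 yz2 zz2 tz2 z1 wz o3E vt).
Qed.

Lemma O_E1 : O true 0 E1.
Proof. rewrite /E1 /mom /cor1; O_tac. Qed.
Lemma O_E2 : O true 0 E2.
Proof. rewrite /E2 /mom /cor2; O_tac. Qed.
Lemma O_Gx0 : O true 0 (@Gx R).
Proof. rewrite /Gx; O_tac. Qed.
Lemma O_Gy0 : O true 0 gGy.
Proof. rewrite /gGy /Gy; O_tac. Qed.

(** [F] is its bottom value plus the primitive of [h * G]; the bottom value, about which the
    equations say nothing, is eliminated in favour of the surface value. *)
Lemma avg_top F G : reg F -> reg G ->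
  (forall d X (th : R), 0 < th < 1 -> is_derive th 1 (fun t => F d t X) (hf d th X * G d th X)) ->
  (forall d th X, F d (clamp th) X = F d th X) ->
  forall d th X, avg F d th X = F d 1 X
    + (avg (prim (fun d th X => hf d th X * G d th X)) d th X - prim (fun d th X => hf d th X * G d th X) d 1 X).
Proof.
move=> rF rG DF cF d th X; set K := prim _.
have rH : reg (fun d th X => hf d th X * G d th X) by exact: (reg_mul (O_reg (@O_h R)) rG).
have FK t : F d t X = F d 0 X + K d t X.
  rewrite /K (@prim_FTC R F (fun d th X => hf d th X * G d th X) d X _ _ (DF d X)) ?cF 1?addrC ?subrK//.
    exact: (@reg_cont1 R F d X rF).
  exact: (@reg_cont1 R _ d X rH).
have rK : continuous (fun t => K d t X).
  have -> : (fun t => K d t X) = (fun t => F d t X - F d 0 X).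
    by apply/funext => t; rewrite (FK t) addrC addKr.
  by move=> t; apply: cvgB; [exact: (@reg_cont1 R F d X rF)|exact: cvg_cst].
have -> : avg F d th X = F d 0 X + avg K d th X.
  rewrite (@avg_ext R F (fun d th X => F d 0 X + K d th X) d th X); last by move=> s _; exact: FK.
  rewrite /avg /avgf JD//; last by move=> ?; exact: cvg_cst.
  by rewrite J_cst ?ler01// subr0 mulr1.
by rewrite (FK 1); ring.
Qed.

Lemma mom_clamp f u l d th X : mom f u l d (clamp th) X = mom f u l d th X.
Proof. by rewrite /mom /flat (level_clamp d th (dt d, X)). Qed.

Lemma O_avg_E1 : O true 4 (fun d th X => avg E1 d th X - at1 E1 d th X - mu (dP d) / 3 * px (@divT R) d th X).
Proof.
have OG : O true 4 (fun d th X => Gx d th X + mu (dP d) * (clamp th * px (@divT R) d th X)) by exact: O_Gx.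
have Op := @O_pressure R _ _ px_divT (O_px (@O_divT R)) OG.
apply: (O_ext _ Op) => d th X; congr (_ - _).
rewrite (avg_top (O_reg O_E1) (O_reg O_Gx0) _ (mom_clamp _ _ _)); first by rewrite /at1 addrC addKr.
by move=> d' X' s s01; rewrite -dmom1; exact: (is_derive_mom cor1 d' X' sV1 sV2 s01).
Qed.

Lemma O_avg_E2 : O true 4 (fun d th X =>
  avg E2 d th X - at1 E2 d th X - mu (dP d) / 3 * (gam (dP d) * py (@divT R) d th X)).
Proof.
have OD : O true 0 (fun d th X => gam (dP d) * py (@divT R) d th X) by O_tac.
have OG : O true 4 (fun d th X => gGy d th X + mu (dP d) * (clamp th * (gam (dP d) * py (@divT R) d th X))).
  have O4 := @O_Gy R.
  apply: (@O_ext _ _ _ _ (fun d th X => gam (dP d) * (Gy d th X + mu (dP d) * (clamp th * py (@divT R) d th X)))).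
    by move=> d th X; rewrite /gGy; move: (Gy _ _ _) (py _ _ _ _) (clamp _) => *; ring.
  exact: (O_weaken (O_mul (O_scalar (@order_gam R)) O4)).
have D0 d th X : gam (dP d) * py (@divT R) d th X = gam (dP d) * py (@divT R) d 0 X.
  by rewrite py_divT.
have Op := @O_pressure R _ _ D0 OD OG.
apply: (O_ext _ Op) => d th X; congr (_ - _).
rewrite (avg_top (O_reg O_E2) (O_reg O_Gy0) _ (mom_clamp _ _ _)); first by rewrite /at1 addrC addKr.
by move=> d' X' s s01; rewrite -dmom2; exact: (is_derive_mom cor2 d' X' sV2 sV1 s01).
Qed.

End VerticalMomentum.

#[local] Hint Resolve O_Wz O_Wxz O_Wyz O_Wtz O_W2 O_Wt2 O_Wx O_Wy O_Wxx O_Wxy O_Wyy O_Wtx O_Wty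
  O_V1z O_V2z O_o1t O_o2t O_V1tz O_V2tz O_T1 O_T2 O_divT O_e1 O_e2 : odb.

(** * The momentum equation at the free surface *)

Section SurfaceMomentum.
Variable R : realType.
Implicit Types (d : data R) (F G : family R) (f : ffield R) (g : sfield R).
Local Notation V1 := (@V1 R). Local Notation V2 := (@V2 R). Local Notation W := (@W R).
Local Notation o1 := (@o1 R). Local Notation o2 := (@o2 R). Local Notation o3 := (@o3 R).
Local Notation hf := (@hf R).
Let sW := @sW R. Let sV1 := @sV1 R. Let sV2 := @sV2 R.
Let sz := @ssurf_zeta R.

Lemma surface_derive d (F : sp2 R -> R) t X (a : bool) (u : vec2 R) :
  (forall p, dI d p.1 -> F p = 0) -> dI d t -> derivable F (t, X) (a%:R, u) ->
  'D_((a%:R, u) : sp2 R) F (t, X) = 0.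
Proof.
move=> F0 It dF; apply: (derive_one_sided dF); first exact: F0.
move=> e e0; have [k k0 Ik] := time_steps It.
pose m := Num.min 1 (e / 2 / `|k|).
have k1 : 0 < `|k| by rewrite normr_gt0.
have m0 : 0 < m by rewrite /m lt_min ltr01 !divr_gt0.
have m1 : m <= 1 by rewrite /m ge_min lexx.
have mk : m * `|k| < e.
  apply: (@le_lt_trans _ _ (e / 2)); last by rewrite ltr_pdivrMr// ltr_pMr// ltr1n.
  by rewrite -ler_pdivlMr// ge_min lexx orbT.
exists (m * k); split; [by rewrite mulf_neq0// gt_eqF|by rewrite normrM (gtr0_norm m0)|].
apply: F0 => /=; case: (a) => /=.
  by rewrite [_ *: 1]mulr1; apply: Ik; rewrite (ltW m0).
by rewrite [_ *: 0]mulr0 add0r.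
Qed.

Lemma derive_surf_slice g d X (u : vec2 R) : derivable (g d) (dt d, X) ((0, u) : sp2 R) ->
  'D_((0, u) : sp2 R) (g d) (dt d, X) = 'D_u (fun Y => g d (dt d, Y)) X.
Proof. by move=> /derivableP /is_derive_slice[_ ->]. Qed.

Definition topf f : sfield R := fun d p => f d (level d 1 p).

Lemma clamp1 : clamp (1 : R) = 1. Proof. by rewrite clamp_id// ler01 lexx. Qed.

Lemma derivable_topf f d p v : sfluid f -> dI d p.1 -> derivable (topf f d) p v.
Proof. by move=> sf Ip; have [] := @is_derive_flat_level R f d 1 p v sf Ip. Qed.

Lemma derivable_surf g d p v : ssurf g -> dI d p.1 -> derivable (g d) p v.
Proof. by move=> sg Ip; exact: (@smooth_on_derivable R _ (surface d) _ (g d) p v (sg d) (conj Ip Logic.I)). Qed.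

Lemma ssurf_derive g v : ssurf g -> ssurf (fun d => 'D_v (g d)).
Proof. by move=> sg d; apply: smooth_on_derive. Qed.

Definition zxf : sfield R := fun d => dx2 (zeta (dS d)).
Definition zyf : sfield R := fun d => dy2 (zeta (dS d)).
Lemma szx : ssurf zxf. Proof. exact: ssurf_derive. Qed.
Lemma szy : ssurf zyf. Proof. exact: ssurf_derive. Qed.

(** A component of [eps w grad zeta], by which [U_//] differs from [V] at the surface. It has order
    4, since [eps] and [w] both have order 2. *)
Definition rf (c : data R -> R) (z : sfield R) : sfield R := fun d p => c d * (topf W d p * z d p).

Lemma is_derive_rf c z d p v a b : is_derive p v (topf W d) a -> is_derive p v (z d) b ->
  is_derive p v (rf c z d) (c d * (topf W d p * b + z d p * a)).
Proof. by move=> Da Db; exact: (is_deriveZ (c d) (is_deriveM Da Db)). Qed.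

Definition eg d := eps (dP d) * gam (dP d).

Lemma Upar_top d p : dI d p.1 ->
  (Upar (dS d) p).1 = topf V1 d p + rf (fun d => eps (dP d)) zxf d p /\
  (Upar (dS d) p).2 = topf V2 d p + rf eg zyf d p.
Proof.
case: p => t X It; have [_ /(_ t It)[_ [_ _ _ HU _] _ _ _]] := system d.
have lE : level d 1 (t, X) = (t, (X, eps (dP d) * zeta (dS d) (t, X))).
  by rewrite /level clamp1 mul1r /h /depth addrA addNr add0r.
rewrite -HU /trace /topf /rf /eg /topf !lE /=; split=> //.
  by congr (_ + _); exact: esym (mulrA _ _ _).
by congr (_ + _); exact: mulrACA.
Qed.

Definition U1f : sfield R := fun d p => (Upar (dS d) p).1.
Definition U2f : sfield R := fun d p => (Upar (dS d) p).2.

Lemma smooth_Upar d : smooth_on (surface d) (Upar (dS d)).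
Proof. by have [[]] := system d. Qed.

Lemma sU1 : ssurf U1f.
Proof.
have cf : continuous (fst : {linear (R * R)%type -> R}) by move=> x; exact: cvg_fst.
by move=> d; exact: (smooth_on_linear_comp cf (@smooth_Upar d)).
Qed.
Lemma sU2 : ssurf U2f.
Proof.
have cf : continuous (snd : {linear (R * R)%type -> R}) by move=> x; exact: cvg_snd.
by move=> d; exact: (smooth_on_linear_comp cf (@smooth_Upar d)).
Qed.

Lemma derive_Upar d p v : dI d p.1 ->
  'D_v (Upar (dS d)) p = ('D_v (U1f d) p, 'D_v (U2f d) p).
Proof.
move=> Ip; have Fp : surface d p by split.
have cf : continuous (fst : {linear (R * R)%type -> R}) by move=> x; exact: cvg_fst.
have cs : continuous (snd : {linear (R * R)%type -> R}) by move=> x; exact: cvg_snd.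
rewrite (derive_linear_comp v cf (@smooth_Upar d) Fp) (derive_linear_comp v cs (@smooth_Upar d) Fp).
exact: surjective_pairing.
Qed.

(** [F = G + H] is known at times of the interval only, so it is [F - (G + H)] that is
    differentiated, along one-sided steps. *)
Lemma derive_split_top (F G H : sp2 R -> R) d X (a : bool) (u : vec2 R) b c :
  (forall p, dI d p.1 -> F p = G p + H p) -> derivable F (dt d, X) (a%:R, u) ->
  is_derive (dt d, X) ((a%:R, u) : sp2 R) G b -> is_derive (dt d, X) ((a%:R, u) : sp2 R) H c ->
  'D_((a%:R, u) : sp2 R) F (dt d, X) = b + c.
Proof.
move=> FGH dF DG DH.
have D := is_deriveB (derivableP dF) (is_deriveD DG DH).
have := @surface_derive d (F - (G + H)) (dt d) X a u _ (dI_dt d).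
case: D => D1 D2; rewrite D2 => E; apply/eqP; rewrite -subr_eq0; apply/eqP.
apply: E; last exact: D1.
by move=> p Ip; rewrite /= fctE/= FGH// subrr.
Qed.

Lemma derive_t_zx d X : 'D_((1, (0, 0)) : sp2 R) (zxf d) (dt d, X) = px (surf (@dt_zetaf R)) d 0 X.
Proof.
rewrite (px_surf (@ssurf_dt_zeta R)).
exact: (@smooth_on_schwarz R _ (surface d) (zeta (dS d)) _ _ (dt d, X) (sz d) (conj (dI_dt d) Logic.I)).
Qed.

Lemma derive_t_zy d X : 'D_((1, (0, 0)) : sp2 R) (zyf d) (dt d, X) = py (surf (@dt_zetaf R)) d 0 X.
Proof.
rewrite (py_surf (@ssurf_dt_zeta R)).
exact: (@smooth_on_schwarz R _ (surface d) (zeta (dS d)) _ _ (dt d, X) (sz d) (conj (dI_dt d) Logic.I)).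
Qed.

(** The quantity under the last gradient of the momentum equation. Quadratic in [w], it has order 4,
    which the factor [eps / (2 mu)] preserves because [eps / mu] is bounded. *)
Definition Qf : sfield R := fun d p =>
  (1 + eps (dP d) ^+ 2 * mu (dP d) * sq2 (grad (gam (dP d)) (zeta (dS d)) p)) * topf W d p ^+ 2.

Lemma derivable_kinetic (a b w : sp2 R -> R) (c g : R) p v :
  derivable a p v -> derivable b p v -> derivable w p v ->
  derivable (fun q => (1 + c * (a q ^+ 2 + (g * b q) ^+ 2)) * w q ^+ 2) p v.
Proof.
move=> /derivableP Da /derivableP Db /derivableP Dw.
have D4 := is_deriveD (is_derive_cst (1 : R) p v) (is_deriveZ c
  (is_deriveD (is_deriveX 2 Da) (is_deriveX 2 (is_deriveZ g Db)))).
by have [] := is_deriveM D4 (is_deriveX 2 Dw).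
Qed.

Lemma derivable_Qf d (X : vec2 R) (v : sp2 R) : derivable (Qf d) (dt d, X) v.
Proof.
exact: (@derivable_kinetic (zxf d) (zyf d) (topf W d) (eps (dP d) ^+ 2 * mu (dP d)) (gam (dP d))
  (dt d, X) v (@derivable_surf _ d (dt d, X) v szx (dI_dt d))
  (@derivable_surf _ d (dt d, X) v szy (dI_dt d)) (@derivable_topf _ d (dt d, X) v sW (dI_dt d))).
Qed.

Lemma momentum_top d (X : vec2 R) (th : R) :
  let p := (dt d, X) in let e := eps (dP d) in let g := gam (dP d) in let m := mu (dP d) in
  let Dt (k : sfield R) := 'D_((1, (0, 0)) : sp2 R) (k d) p in
  let Dx (k : sfield R) := 'D_((0, (1, 0)) : sp2 R) (k d) p in
  let Dy (k : sfield R) := 'D_((0, (0, 1)) : sp2 R) (k d) p in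
  let v1 := topf V1 d p in let v2 := topf V2 d p in
  let u1 := U1f d p in let u2 := U2f d p in
  Dt U1f + zx d th X + e / 2 * (2 * (u1 * Dx U1f + u2 * Dx U2f)) - e / (2 * m) * px (surf Qf) d th X
   + e * (- g * Dy U1f + Dx U2f) * (- v2) + e / Ro (dP d) * - v2 = 0 /\
  Dt U2f + g * zy d th X + e / 2 * (g * (2 * (u1 * Dy U1f + u2 * Dy U2f)))
   - e / (2 * m) * (g * py (surf Qf) d th X)
   + e * (- g * Dy U1f + Dx U2f) * v1 + e / Ro (dP d) * v1 = 0.
Proof.
have [_ /(_ _ (dI_dt d))[_ _ _ /(_ X) + _]] := system d.
move=> HM p e g m Dt Dx Dy v1 v2 u1 u2.
have topE f q : f d (level d 1 q) = f d (q.1, (q.2, e * zeta (dS d) q)).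
  by rewrite /level clamp1 mul1r /h /depth addrA addNr add0r.
have sqU v : 'D_v (fun r => sq2 (Upar (dS d) r)) p
   = 2 * (u1 * 'D_v (U1f d) p + u2 * 'D_v (U2f d) p).
  have D1 := derivableP (@derivable_surf _ d p v sU1 (dI_dt d)).
  have D2 := derivableP (@derivable_surf _ d p v sU2 (dI_dt d)).
  have [_ /= E] := is_deriveD (is_deriveX 2 D1) (is_deriveX 2 D2).
  apply: etrans; first exact: E.
  by rewrite /GRing.scale /= !expr1 mulrDr !mulrA.
have QE v : 'D_v (fun r => (1 + e ^+ 2 * m * sq2 (grad g (zeta (dS d)) r))
      * trace (dP d) (dS d) (velw (dS d)) r ^+ 2) p = 'D_v (Qf d) p.
  congr ('D_v _ p); apply/funext => r; rewrite /Qf /topf.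
  by rewrite topE.
have qx : px (surf Qf) d th X = 'D_((0, (1, 0)) : sp2 R) (Qf d) p.
  exact: (esym (@derive_surf_slice Qf d X (ex R) (@derivable_Qf d X _))).
have qy : py (surf Qf) d th X = 'D_((0, (0, 1)) : sp2 R) (Qf d) p.
  exact: (esym (@derive_surf_slice Qf d X (ey R) (@derivable_Qf d X _))).
have zxE : zx d th X = dx2 (zeta (dS d)) p.
  exact: (congr1 (fun F : family R => F d th X) (px_surf sz)).
have zyE : zy d th X = dy2 (zeta (dS d)) p.
  exact: (congr1 (fun F : family R => F d th X) (py_surf sz)).
have tv : trace (dP d) (dS d) (velV (dS d)) p = (v1, v2).
  rewrite /v1 /v2 /topf (topE V1) (topE V2) /V1 /V2 /trace /=.
  exact: surjective_pairing.
move: HM; rewrite /momentum_eq /grad /rotg /dt2 /dx2 /dy2 -/p -/e -/g -/m !sqU !QE tv !(derive_Upar _ (dI_dt d : dI d p.1)) /=.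
rewrite qx qy zxE zyE /dx2 /dy2 /perp /GRing.scale /=.
by move=> [E1 E2]; split; [exact: E1|exact: E2].
Qed.

Lemma kinematic_top d (X : vec2 R) (th : R) : let e := eps (dP d) in
  zt d th X = at1 ('F W) d th X / mu (dP d)
    - e * (at1 ('F V1) d th X * zx d th X + gam (dP d) * (at1 ('F V2) d th X * zy d th X)).
Proof.
have [_ /(_ _ (dI_dt d))[_ _ /(_ X) + _ _]] := system d.
have topE f : f d (level d 1 (dt d, X)) = f d (dt d, (X, eps (dP d) * zeta (dS d) (dt d, X))).
  by rewrite /level clamp1 mul1r /h /depth addrA addNr add0r.
have zxE : zx d th X = dx2 (zeta (dS d)) (dt d, X).
  exact: (congr1 (fun F : family R => F d th X) (px_surf sz)).
have zyE : zy d th X = dy2 (zeta (dS d)) (dt d, X).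
  exact: (congr1 (fun F : family R => F d th X) (py_surf sz)).
move=> K e; move: K; rewrite zxE zyE /kinematic_eq /dot3 /normalN /grad /= -/(nu d).
rewrite -[at1 ('F V1) d th X]/(V1 d (level d 1 (dt d, X))) -[at1 ('F V2) d th X]/(V2 d (level d 1 (dt d, X))).
rewrite -[at1 ('F W) d th X]/(W d (level d 1 (dt d, X))) !topE -[zt d th X]/(dt2 (zeta (dS d)) (dt d, X)).
rewrite /trace /V1 /V2 /W /velU /Umu /= /GRing.scale /= -/e -/(nu d) -(nu2 d).
move: (nu_neq0 d) (velw _ _) (velV _ _).1 (velV _ _).2 (dx2 _ _) (dy2 _ _) (dt2 _ _) => n0 w v1 v2 a b c.
move/eqP; rewrite subr_eq0 => /eqP ->; move: e (nu d) n0 => e n n0; field; exact: n0.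
Qed.

Definition r1 : family R := surf (rf (fun d => eps (dP d)) zxf).
Definition r2 : family R := surf (rf eg zyf).

Lemma zx_surf : zx = surf zxf. Proof. exact: px_surf sz. Qed.
Lemma zy_surf : zy = surf zyf. Proof. exact: py_surf sz. Qed.

Lemma O_r1 : O true 4 r1.
Proof.
have -> : r1 = fun d th X => eps (dP d) * (at1 ('F W) d th X * zx d th X) by rewrite zx_surf.
by O_tac.
Qed.
Lemma O_r2 : O true 4 r2.
Proof.
have -> : r2 = fun d th X => eps (dP d) * gam (dP d) * (at1 ('F W) d th X * zy d th X) by rewrite zy_surf.
by O_tac.
Qed.

Lemma O_Q : O true 4 (surf Qf).
Proof.
have -> : surf Qf = fun d th X => at1 ('F W) d th X * at1 ('F W) d th X
   + (eps (dP d) * eps (dP d) * mu (dP d)) * ((zx d th X * zx d th X + gam (dP d) * gam (dP d) * (zy d th X * zy d th X))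
     * (at1 ('F W) d th X * at1 ('F W) d th X)).
  rewrite zx_surf zy_surf; do 3 (apply/funext => ?); rewrite /surf /Qf /sq2 /grad /= -/(zxf _ _) -/(zyf _ _).
  rewrite -[at1 _ _ _ _]/(topf W _ _).
  by move: (topf _ _ _) (zxf _ _) (zyf _ _) (eps _) (gam _) (mu _); clear => *; ring.
by O_tac.
Qed.

Lemma unshear_alg (q p k s w : R) : q = p - k * s * w -> k = 1 -> q + s * w = p.
Proof. by move=> -> ->; rewrite mul1r subrK. Qed.

Section Component.
Variables (U : sfield R) (f : ffield R) (c : data R -> R) (z : sfield R).
Hypotheses (sU : ssurf U) (sf : sfluid f) (sz' : ssurf z)
  (HU : forall d p, dI d p.1 -> U d p = topf f d p + rf c z d p).

Let derivable_rf d X v : derivable (rf c z d) (dt d, X) v.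
Proof.
by have [] := is_derive_rf c (derivableP (@derivable_topf _ d (dt d, X) v sW (dI_dt d)))
  (derivableP (@derivable_surf _ d (dt d, X) v sz' (dI_dt d))).
Qed.

Lemma Dx_component d (X : vec2 R) (th : R) : 'D_((0, (1, 0)) : sp2 R) (U d) (dt d, X)
  = at1 ('Fx f) d th X + eps (dP d) * zx d th X * at1 ('Fz f) d th X + px (surf (rf c z)) d th X.
Proof.
have -> : at1 ('Fx f) d th X + eps (dP d) * zx d th X * at1 ('Fz f) d th X = px ('F f) d 1 X.
  exact: (unshear_alg (flat_x 0 0 0 d 1 X sf) clamp1).
have D1 := derivableP (@derivable_topf _ d (dt d, X) ((0, (1, 0)) : sp2 R) sf (dI_dt d)).
have D2 := derivableP (@derivable_rf d X ((0, (1, 0)) : sp2 R)).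
apply: (etrans (@derive_split_top (U d) _ _ d X false (1, 0) _ _ (@HU d)
  (@derivable_surf _ d (dt d, X) _ sU (dI_dt d)) D1 D2)).
exact: (congr2 +%R
  (@derive_surf_slice (topf f) d X (1, 0) (@derivable_topf _ d (dt d, X) _ sf (dI_dt d)))
  (@derive_surf_slice (rf c z) d X (1, 0) (@derivable_rf d X _))).
Qed.

Lemma Dy_component d (X : vec2 R) (th : R) : 'D_((0, (0, 1)) : sp2 R) (U d) (dt d, X)
  = at1 ('Fy f) d th X + eps (dP d) * zy d th X * at1 ('Fz f) d th X + py (surf (rf c z)) d th X.
Proof.
have -> : at1 ('Fy f) d th X + eps (dP d) * zy d th X * at1 ('Fz f) d th X = py ('F f) d 1 X.
  exact: (unshear_alg (flat_yE 0 0 0 d 1 X sf) clamp1).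
have D1 := derivableP (@derivable_topf _ d (dt d, X) ((0, (0, 1)) : sp2 R) sf (dI_dt d)).
have D2 := derivableP (@derivable_rf d X ((0, (0, 1)) : sp2 R)).
apply: (etrans (@derive_split_top (U d) _ _ d X false (0, 1) _ _ (@HU d)
  (@derivable_surf _ d (dt d, X) _ sU (dI_dt d)) D1 D2)).
exact: (congr2 +%R
  (@derive_surf_slice (topf f) d X (0, 1) (@derivable_topf _ d (dt d, X) _ sf (dI_dt d)))
  (@derive_surf_slice (rf c z) d X (0, 1) (@derivable_rf d X _))).
Qed.

Lemma Dt_component d (X : vec2 R) (th : R) : 'D_((1, (0, 0)) : sp2 R) (U d) (dt d, X)
  = at1 ('F (fdt f)) d th X + eps (dP d) * zt d th X * at1 ('Fz f) d th X
    + c d * (at1 ('F W) d th X * 'D_((1, (0, 0)) : sp2 R) (z d) (dt d, X)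
      + z d (dt d, X) * (at1 ('F (fdt W)) d th X + eps (dP d) * zt d th X * at1 ('Fz W) d th X)).
Proof.
have D1 := @is_derive_flat_level R f d 1 (dt d, X) (1, (0, 0)) sf (dI_dt d).
have DW := @is_derive_flat_level R W d 1 (dt d, X) (1, (0, 0)) sW (dI_dt d).
have D2 := is_derive_rf c DW (derivableP (@derivable_surf _ d (dt d, X) (1, (0, 0)) sz' (dI_dt d))).
apply: (etrans (@derive_split_top (U d) _ _ d X true (0, 0) _ _ (@HU d)
  (@derivable_surf _ d (dt d, X) _ sU (dI_dt d)) D1 D2)).
by rewrite /= clamp1 !mul1r.
Qed.

End Component.

Definition rt1 : family R := fun d th X => eps (dP d) * (at1 ('F W) d th X * px zt d th X
  + zx d th X * (at1 ('F (fdt W)) d th X + eps (dP d) * zt d th X * at1 ('Fz W) d th X)).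
Definition rt2 : family R := fun d th X => eg d * (at1 ('F W) d th X * py zt d th X
  + zy d th X * (at1 ('F (fdt W)) d th X + eps (dP d) * zt d th X * at1 ('Fz W) d th X)).

Definition top_x f : family R := fun d th X =>
  at1 ('Fx f) d th X + eps (dP d) * zx d th X * at1 ('Fz f) d th X.
Definition top_y f : family R := fun d th X =>
  at1 ('Fy f) d th X + eps (dP d) * zy d th X * at1 ('Fz f) d th X.

(** What the surface equation leaves once [E1] and the derivative of [zeta] are set apart: each term
    contains [r1], [r2], one of their derivatives, or [Qf]. *)
Definition top_rem1 : family R := fun d th X => let e := eps (dP d) in
  - rt1 d th X - e * (r1 d th X * top_x V1 d th X + r1 d th X * px r1 d th X
     + at1 ('F V1) d th X * px r1 d th X + r2 d th X * top_x V2 d th X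
     + r2 d th X * px r2 d th X + at1 ('F V2) d th X * px r2 d th X)
  + (e / mu (dP d) * 2^-1) * px (surf Qf) d th X
  - e * ((gam (dP d) * py r1 d th X - px r2 d th X) * at1 ('F V2) d th X).

Definition top_rem2 : family R := fun d th X => let e := eps (dP d) in let g := gam (dP d) in
  - rt2 d th X - e * g * (r1 d th X * top_y V1 d th X + r1 d th X * py r1 d th X
     + at1 ('F V1) d th X * py r1 d th X + r2 d th X * top_y V2 d th X
     + r2 d th X * py r2 d th X + at1 ('F V2) d th X * py r2 d th X)
  + (e / mu (dP d) * 2^-1) * (g * py (surf Qf) d th X)
  + e * ((g * py r1 d th X - px r2 d th X) * at1 ('F V1) d th X).

Lemma top_alg1 (e g m rs v1 v2 a1x a2x a1y V1x V1y V1z w zx' zy' zt' V1t r1' r2' r1x r2x r1y t1 Qx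
  U1 U2 U1x U2x U1y U1t : R) : m != 0 ->
  U1 = v1 + r1' -> U2 = v2 + r2' -> U1x = a1x + r1x -> U2x = a2x + r2x -> U1y = a1y + r1y ->
  U1t = V1t + e * zt' * V1z + t1 -> a1x = V1x + e * zx' * V1z -> a1y = V1y + e * zy' * V1z ->
  zt' = w / m - e * (v1 * zx' + g * (v2 * zy')) ->
  U1t + zx' + e / 2 * (2 * (U1 * U1x + U2 * U2x)) - e / (2 * m) * Qx
   + e * (- g * U1y + U2x) * - v2 + rs * - v2 = 0 ->
  V1t + e * (v1 * V1x + g * (v2 * V1y)) + e / m * (w * V1z) + - rs * v2 + zx'
  = - t1 - e * (r1' * a1x + r1' * r1x + v1 * r1x + r2' * a2x + r2' * r2x + v2 * r2x)
    + (e / m * 2^-1) * Qx - e * ((g * r1y - r2x) * v2).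
Proof.
move=> m0 -> -> -> -> -> -> -> -> -> H; apply/eqP; rewrite -subr_eq0 -[X in _ == X]H; apply/eqP.
by field.
Qed.

Lemma top_alg2 (e g m rs v1 v2 a2x a1y a2y V2x V2y V2z w zx' zy' zt' V2t r1' r2' r2x r1y r2y t2 Qy
  U1 U2 U2x U1y U2y U2t : R) : m != 0 ->
  U1 = v1 + r1' -> U2 = v2 + r2' -> U2x = a2x + r2x -> U1y = a1y + r1y -> U2y = a2y + r2y ->
  U2t = V2t + e * zt' * V2z + t2 -> a2x = V2x + e * zx' * V2z -> a2y = V2y + e * zy' * V2z ->
  zt' = w / m - e * (v1 * zx' + g * (v2 * zy')) ->
  U2t + g * zy' + e / 2 * (g * (2 * (U1 * U1y + U2 * U2y))) - e / (2 * m) * (g * Qy)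
   + e * (- g * U1y + U2x) * v1 + rs * v1 = 0 ->
  V2t + e * (v1 * V2x + g * (v2 * V2y)) + e / m * (w * V2z) + rs * v1 + g * zy'
  = - t2 - e * g * (r1' * a1y + r1' * r1y + v1 * r1y + r2' * a2y + r2' * r2y + v2 * r2y)
    + (e / m * 2^-1) * (g * Qy) + e * ((g * r1y - r2x) * v1).
Proof.
move=> m0 -> -> -> -> -> -> -> -> -> H; apply/eqP; rewrite -subr_eq0 -[X in _ == X]H; apply/eqP.
by field.
Qed.

Lemma mu_neq0 d : mu (dP d) != 0. Proof. by rewrite gt_eqF// mu_gt0. Qed.

Let H1 d p (Ip : dI d p.1) : U1f d p = topf V1 d p + rf (fun d => eps (dP d)) zxf d p := (Upar_top Ip).1.
Let H2 d p (Ip : dI d p.1) : U2f d p = topf V2 d p + rf eg zyf d p := (Upar_top Ip).2.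

Lemma Dt_U1 d (X : vec2 R) (th : R) : 'D_((1, (0, 0)) : sp2 R) (U1f d) (dt d, X)
  = at1 ('F (fdt V1)) d th X + eps (dP d) * zt d th X * at1 ('Fz V1) d th X + rt1 d th X.
Proof.
apply: (etrans (Dt_component sU1 sV1 szx H1 d X th)); rewrite derive_t_zx /rt1.
by rewrite (congr1 (fun F : family R => F d th X) zx_surf).
Qed.

Lemma Dt_U2 d (X : vec2 R) (th : R) : 'D_((1, (0, 0)) : sp2 R) (U2f d) (dt d, X)
  = at1 ('F (fdt V2)) d th X + eps (dP d) * zt d th X * at1 ('Fz V2) d th X + rt2 d th X.
Proof.
apply: (etrans (Dt_component sU2 sV2 szy H2 d X th)); rewrite derive_t_zy /rt2.
by rewrite (congr1 (fun F : family R => F d th X) zy_surf).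
Qed.

Lemma E1_top d th X : at1 (@E1 R) d th X + zx d th X = top_rem1 d th X.
Proof.
have [M _] := momentum_top d X th.
exact: (top_alg1 (mu_neq0 d) (H1 (p := (dt d, X)) (dI_dt d)) (H2 (p := (dt d, X)) (dI_dt d))
  (Dx_component sU1 sV1 szx H1 d X th) (Dx_component sU2 sV2 szy H2 d X th)
  (Dy_component sU1 sV1 szx H1 d X th) (Dt_U1 d X th) erefl erefl (kinematic_top d X th) M).
Qed.

Lemma E2_top d th X : at1 (@E2 R) d th X + gam (dP d) * zy d th X = top_rem2 d th X.
Proof.
have [_ M] := momentum_top d X th.
exact: (top_alg2 (mu_neq0 d) (H1 (p := (dt d, X)) (dI_dt d)) (H2 (p := (dt d, X)) (dI_dt d))
  (Dx_component sU2 sV2 szy H2 d X th) (Dy_component sU1 sV1 szx H1 d X th)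
  (Dy_component sU2 sV2 szy H2 d X th) (Dt_U2 d X th) erefl erefl (kinematic_top d X th) M).
Qed.

Hint Resolve O_r1 O_r2 O_Q : odb.
#[local] Opaque fN px py.
Lemma O_E1_top : O true 4 (fun d th X => at1 (@E1 R) d th X + zx d th X).
Proof. by apply: (O_ext E1_top); rewrite /top_rem1 /rt1 /top_x; O_tac. Qed.
Lemma O_E2_top : O true 4 (fun d th X => at1 (@E2 R) d th X + gam (dP d) * zy d th X).
Proof. by apply: (O_ext E2_top); rewrite /top_rem2 /rt2 /top_y /eg; O_tac. Qed.

End SurfaceMomentum.

#[local] Hint Resolve O_Wz O_Wxz O_Wyz O_Wtz O_W2 O_Wt2 O_Wx O_Wy O_Wxx O_Wxy O_Wyy O_Wtx O_Wty
  O_V1z O_V2z O_o1t O_o2t O_V1tz O_V2tz O_T1 O_T2 O_divT O_e1 O_e2 : odb.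

(** * The mean of the horizontal momentum *)

Section AveragedMomentum.
Variable R : realType.
Implicit Types (d : data R) (F G : family R) (f : ffield R) (g : sfield R).
Local Notation V1 := (@V1 R). Local Notation V2 := (@V2 R). Local Notation W := (@W R).
Local Notation o1 := (@o1 R). Local Notation o2 := (@o2 R). Local Notation o3 := (@o3 R).
Local Notation hf := (@hf R).
Let sW := @sW R. Let sV1 := @sV1 R. Let sV2 := @sV2 R.

Definition Vb1 : family R := avg ('F V1).
Definition Vb2 : family R := avg ('F V2).
Definition s1 : family R := osc ('F V1).
Definition s2 : family R := osc ('F V2).

Lemma O_Vb1 : O true 0 Vb1. Proof. by rewrite /Vb1; O_tac. Qed.
Lemma O_Vb2 : O true 0 Vb2. Proof. by rewrite /Vb2; O_tac. Qed.
Lemma O_s1 : O true 1 s1. Proof. exact: O_osc sV1 (@O_V1z R). Qed.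
Lemma O_s2 : O true 1 s2. Proof. exact: O_osc sV2 (@O_V2z R). Qed.
Hint Resolve O_Vb1 O_Vb2 O_s1 O_s2 : odb.

#[local] Opaque fN px py.

Lemma V1_split d th X : 'F V1 d th X = Vb1 d th X + s1 d th X.
Proof. exact: esym (subrKC _ _). Qed.
Lemma V2_split d th X : 'F V2 d th X = Vb2 d th X + s2 d th X.
Proof. exact: esym (subrKC _ _). Qed.

Lemma V1_splitf : 'F V1 = fun d th X => Vb1 d th X + s1 d th X.
Proof. by do 3 (apply/funext => ?); exact: V1_split. Qed.
Lemma V2_splitf : 'F V2 = fun d th X => Vb2 d th X + s2 d th X.
Proof. by do 3 (apply/funext => ?); exact: V2_split. Qed.

Lemma px_V1 d th X : px ('F V1) d th X = px Vb1 d th X + px s1 d th X.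
Proof.
apply: (etrans (congr1 (fun F : family R => px F d th X) V1_splitf)).
by apply: px_split; [exact: O_reg O_Vb1|exact: O_reg O_s1].
Qed.
Lemma py_V1 d th X : py ('F V1) d th X = py Vb1 d th X + py s1 d th X.
Proof.
apply: (etrans (congr1 (fun F : family R => py F d th X) V1_splitf)).
by apply: py_split; [exact: O_reg O_Vb1|exact: O_reg O_s1].
Qed.
Lemma px_V2 d th X : px ('F V2) d th X = px Vb2 d th X + px s2 d th X.
Proof.
apply: (etrans (congr1 (fun F : family R => px F d th X) V2_splitf)).
by apply: px_split; [exact: O_reg O_Vb2|exact: O_reg O_s2].
Qed.
Lemma py_V2 d th X : py ('F V2) d th X = py Vb2 d th X + py s2 d th X.
Proof.
apply: (etrans (congr1 (fun F : family R => py F d th X) V2_splitf)).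
by apply: py_split; [exact: O_reg O_Vb2|exact: O_reg O_s2].
Qed.

Definition divVb : family R := fun d th X => px Vb1 d th X + gam (dP d) * py Vb2 d th X.
(** The divergence of [V - Vbar] at fixed height: the mean depends on [X] only, so all the shear
    terms of [V] belong here. *)
Definition divs : family R := fun d th X =>
  (px s1 d th X - clamp th * (eps (dP d) * zx d th X) * 'Fz V1 d th X)
  + gam (dP d) * (py s2 d th X - clamp th * (eps (dP d) * zy d th X) * 'Fz V2 d th X).
Lemma O_divs : O true 1 divs. Proof. by rewrite /divs; O_tac. Qed.
Lemma O_divVb : O true 0 divVb. Proof. by rewrite /divVb; O_tac. Qed.
Hint Resolve O_divs O_divVb : odb.

Lemma wz_alg (m g w a b p1 p2 q1 q2 t1 t2 u1 u2 h : R) : w = - m * a + - m * g * b ->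
  a = p1 - q1 -> b = p2 - q2 -> p1 = t1 + u1 -> p2 = t2 + u2 ->
  h * w = - m * (h * (t1 + g * t2)) + - m * (h * ((u1 - q1) + g * (u2 - q2))).
Proof. by move=> -> -> -> -> ->; ring. Qed.

Lemma divVb_th d th X : divVb d th X = divVb d 0 X.
Proof.
Transparent px py.
by rewrite /divVb /px /py. Opaque px py. Qed.

(** Incompressibility integrated from the bottom, without remainder: it serves the bound on [Bf] and
    also the mass equation, which is to hold exactly. *)
Lemma W_split d th X : 'F W d th X = clamp th * (- mu (dP d) * (hf d 0 X * divVb d 0 X))
  + - mu (dP d) * prim (fun d th X => hf d th X * divs d th X) d th X.
Proof.
have Oh : O true 1 (fun d th X => hf d th X * divs d th X) by O_tac.
have Ov : O true 0 (fun d (_ : R) X => hf d 0 X * divVb d 0 X).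
  have O1 : O true 0 (fun d th X => hf d th X * divVb d th X) by O_tac.
  exact: (@O_reparam R _ _ _ (fun=> 0) (@cC R _ 0) O1).
apply: (etrans (W_prim d th X)).
apply: (@etrans _ _ (prim (fun d th X => - mu (dP d) * (hf d 0 X * divVb d 0 X)
   + - mu (dP d) * (hf d th X * divs d th X)) d th X)).
  apply: prim_ext => s; have [wz _ _ _ _] := jetW d s X.
  apply: (etrans (wz_alg _ wz (flat_x 0 0 0 d s X sV1) (flat_yE 0 0 0 d s X sV2) (px_V1 d s X) (py_V2 d s X))).
  by rewrite -[X in hf d s X]/X -(divVb_th d s X).
apply: etrans.
  apply: (@prim_add R (fun d th X => - mu (dP d) * (hf d 0 X * divVb d 0 X))).
    exact: O_reg (O_mul (O_scalar (order_opp (@order_mu R))) Ov).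
  exact: O_reg (O_mul (O_scalar (order_opp (@order_mu R))) Oh).
congr (_ + _).
  exact: (@prim_const R (fun d X => - mu (dP d) * (hf d 0 X * divVb d 0 X))).
by apply: (@prim_scale R (fun d _ => - mu (dP d))); exact: O_reg Oh.
Qed.

(** [eps * Bf] is the vertical velocity of the fluid relative to the moving levels, hence the factor
    of d_z in the transport written in flattened coordinates. *)
Definition Bf : family R := fun d th X =>
  'F W d th X / mu (dP d) - clamp th * zt d th X
  - clamp th * eps (dP d) * ('F V1 d th X * zx d th X + gam (dP d) * ('F V2 d th X * zy d th X)).

Lemma B_alg (w wt m c c1 D K K1 v1 v2 u1 u2 x y z e g : R) : m != 0 -> c1 = 1 ->
  w = c * (- m * D) + - m * K -> wt = c1 * (- m * D) + - m * K1 ->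
  z = wt / m - e * (u1 * x + g * (u2 * y)) ->
  w / m - c * z - c * e * (v1 * x + g * (v2 * y))
  = - K + c * K1 + c * e * ((u1 - v1) * x + g * ((u2 - v2) * y)).
Proof. by move=> m0 -> -> -> ->; field. Qed.

(** If [V] did not depend on [z], [w] would be linear in the level and the kinematic condition would
    make [Bf] vanish. What remains is linear in the deviation or has the factor [eps]. *)
Lemma O_B : O true 1 Bf.
Proof.
have Oh : O true 1 (prim (fun d th X => hf d th X * divs d th X)) by O_tac.
apply: (@O_ext _ _ _ _ (fun d th X => - prim (fun d th X => hf d th X * divs d th X) d th X
  + clamp th * at1 (prim (fun d th X => hf d th X * divs d th X)) d th X
  + clamp th * eps (dP d) * ((at1 ('F V1) d th X - 'F V1 d th X) * zx d th X
    + gam (dP d) * ((at1 ('F V2) d th X - 'F V2 d th X) * zy d th X)))).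
  move=> d th X.
  exact: (B_alg _ _ (mu_neq0 d) (@clamp1 R) (W_split d th X) (W_split d 1 X) (kinematic_top d X th)).
set K := prim _ in Oh *; O_tac.
Qed.
Hint Resolve O_B : odb.

Lemma J_momentum (A U S S' T T' Q : R -> R) (l C a b c k : R) :
  continuous A -> continuous U -> continuous S -> continuous S' -> continuous T ->
  continuous T' -> continuous Q ->
  J 0 1 S = 0 -> J 0 1 S' = 0 -> J 0 1 T = 0 -> J 0 1 T' = 0 ->
  J 0 1 (fun s => A s + l * U s + C + (a * S s + b * S' s + c * T s + k * T' s) + Q s)
  = J 0 1 A + l * J 0 1 U + C + J 0 1 Q.
Proof.
move=> cA cU cS cS' cT cT' cQ S0 S'0 T0 T'0.
have cZ (r : R) (K : R -> R) : continuous K -> continuous (fun s : R => r * K s).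
  by move=> cK; apply: cM => //; exact: cC.
have cL := cZ l U cU.
have cAU := cD cA cL.
have cAUC := cD cAU (@cC R _ C).
have c1 := cD (cZ a S cS) (cZ b S' cS').
have c2 := cD c1 (cZ c T cT).
have c3 := cD c2 (cZ k T' cT').
rewrite (@JD _ 0 1 _ Q (cD cAUC c3) cQ) (@JD _ 0 1 _ _ cAUC c3) (@JD _ 0 1 _ _ cAU (@cC R _ C)).
rewrite (@JD _ 0 1 _ _ cA cL) (@JD _ 0 1 _ _ c2 (cZ k T' cT')) (@JD _ 0 1 _ _ c1 (cZ c T cT)).
rewrite (@JD _ 0 1 _ _ (cZ a S cS) (cZ b S' cS')) !JZ// S0 S'0 T0 T'0 !mulr0 !addr0.
by rewrite J_cst ?ler01// subr0 mulr1.
Qed.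

Lemma avg_osc F d th X : reg F -> avg (osc F) d th X = 0.
Proof.
move=> rF; rewrite /osc /avg /avgf JB; [|exact: (@reg_cont1 R F d X rF)|exact: cC].
by rewrite J_cst ?ler01// subr0 mulr1 subrr.
Qed.

Lemma px_zero d th X : px (fun (_ : data R) (_ : R) (_ : vec2 R) => 0 : R) d th X = 0.
Proof. exact: (derive_cst (0 : R) (ex R)). Qed.
Lemma py_zero d th X : py (fun (_ : data R) (_ : R) (_ : vec2 R) => 0 : R) d th X = 0.
Proof. exact: (derive_cst (0 : R) (ey R)). Qed.

(** Averaging over levels commutes with [px], and the mean of a deviation is zero. *)
Lemma avg_px_osc k F d th X : reg F -> O true k (osc F) -> avg (px (osc F)) d th X = 0.
Proof.
move=> rF OF; have cs : continuous (fun q : R * R => q.2) by move=> ?; exact: cont_snd.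
have := @px_avgf R (fun _ s => s) cs (osc F) (O_reg OF) (O_reg (O_px OF)).
rewrite -[avgf _ _]/(avg (osc F)) -[avgf _ (px _)]/(avg (px (osc F))) => <-.
have -> : avg (osc F) = fun _ _ _ => 0 by do 3 (apply/funext => ?); exact: avg_osc.
exact: px_zero.
Qed.
Lemma avg_py_osc k F d th X : reg F -> O true k (osc F) -> avg (py (osc F)) d th X = 0.
Proof.
move=> rF OF; have cs : continuous (fun q : R * R => q.2) by move=> ?; exact: cont_snd.
have := @py_avgf R (fun _ s => s) cs (osc F) (O_reg OF) (O_reg (O_py OF)).
rewrite -[avgf _ _]/(avg (osc F)) -[avgf _ (py _)]/(avg (py (osc F))) => <-.
have -> : avg (osc F) = fun _ _ _ => 0 by do 3 (apply/funext => ?); exact: avg_osc.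
exact: py_zero.
Qed.

(* What is left of the averaged quadratic terms: a product of two deviations
   [V - Vbar], or of [d_z V] with [Bf], all of which are O(sqrt mu). *)
Definition quad1 : family R := fun d th X => eps (dP d) *
  (s1 d th X * px s1 d th X + gam (dP d) * (s2 d th X * py s1 d th X)) + eps (dP d) * 'Fz V1 d th X * Bf d th X.
Definition quad2 : family R := fun d th X => eps (dP d) *
  (s1 d th X * px s2 d th X + gam (dP d) * (s2 d th X * py s2 d th X)) + eps (dP d) * 'Fz V2 d th X * Bf d th X.
Lemma O_quad1 : O true 4 quad1. Proof. by rewrite /quad1; O_tac. Qed.
Lemma O_quad2 : O true 4 quad2. Proof. by rewrite /quad2; O_tac. Qed.

(** The split is made for averaging: the first line gives d_t Vbar, the Coriolis term and the
    transport by the mean; the second is linear in deviations and has mean zero; the third is the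
    quadratic remainder. *)
Lemma mom_split_alg (e g m l c t w v1 v2 x y z b1 b2 a1 a2 p q ps qs fx fy fz fp fq u : R) :
  v1 = b1 + a1 -> v2 = b2 + a2 -> fp = p + ps -> fq = q + qs ->
  fx = fp - c * (e * x) * fz -> fy = fq - c * (e * y) * fz ->
  t + e * (v1 * fx + g * (v2 * fy)) + e / m * (w * fz) + l * u
  = (t + c * (e * z) * fz) + l * u + e * (b1 * p + g * (b2 * q))
    + (e * b1 * ps + e * p * a1 + e * g * b2 * qs + e * g * q * a2)
    + (e * (a1 * ps + g * (a2 * qs)) + e * fz * (w / m - c * z - c * e * (v1 * x + g * (v2 * y)))).
Proof. by move=> -> -> -> -> -> ->; ring. Qed.

Lemma avg_E1 d th X : avg (@E1 R) d th X
  = T1 d th X + cor1 d * Vb2 d th X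
    + eps (dP d) * (Vb1 d th X * px Vb1 d th X + gam (dP d) * (Vb2 d th X * py Vb1 d th X))
    + avg quad1 d th X.
Proof.
pose e := eps (dP d); pose g := gam (dP d).
have rc F : reg F -> continuous (fun s => F d s X) by exact: reg_cont1.
apply: (@etrans _ _ (J 0 1 (fun s => slope V1 d s X + cor1 d * 'F V2 d s X
  + e * (Vb1 d 0 X * px Vb1 d 0 X + g * (Vb2 d 0 X * py Vb1 d 0 X))
  + (e * Vb1 d 0 X * px s1 d s X + e * px Vb1 d 0 X * s1 d s X
     + e * g * Vb2 d 0 X * py s1 d s X + e * g * py Vb1 d 0 X * s2 d s X) + quad1 d s X))).
  apply: J_eq => s _.
  exact: (@mom_split_alg e g (mu (dP d)) (cor1 d) (clamp s) ('F (fdt V1) d s X) ('F W d s X)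
    ('F V1 d s X) ('F V2 d s X) (zx d s X) (zy d s X) (zt d s X) (Vb1 d 0 X) (Vb2 d 0 X) (s1 d s X) (s2 d s X)
    (px Vb1 d 0 X) (py Vb1 d 0 X) (px s1 d s X) (py s1 d s X)
    ('Fx V1 d s X) ('Fy V1 d s X) ('Fz V1 d s X) (px ('F V1) d s X) (py ('F V1) d s X)
    ('F V2 d s X) (V1_split d s X) (V2_split d s X) (px_V1 d s X) (py_V1 d s X)
    (flat_x 0 0 0 d s X sV1) (flat_yE 0 0 0 d s X sV1)).
apply: (J_momentum _ _ _ _ _ _ (rc _ (O_reg (@O_slope1 R))) (rc _ (reg_flat sV2)) (rc _ (O_reg (O_px O_s1)))
  (rc _ (O_reg O_s1)) (rc _ (O_reg (O_py O_s1))) (rc _ (O_reg O_s2)) (rc _ (O_reg O_quad1))).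
- exact: (avg_px_osc d 0 X (reg_flat sV1) O_s1).
- exact: (avg_osc d 0 X (reg_flat sV1)).
- exact: (avg_py_osc d 0 X (reg_flat sV1) O_s1).
- exact: (avg_osc d 0 X (reg_flat sV2)).
Qed.

Lemma avg_E2 d th X : avg (@E2 R) d th X
  = T2 d th X + cor2 d * Vb1 d th X
    + eps (dP d) * (Vb1 d th X * px Vb2 d th X + gam (dP d) * (Vb2 d th X * py Vb2 d th X))
    + avg quad2 d th X.
Proof.
pose e := eps (dP d); pose g := gam (dP d).
have rc F : reg F -> continuous (fun s => F d s X) by exact: reg_cont1.
apply: (@etrans _ _ (J 0 1 (fun s => slope V2 d s X + cor2 d * 'F V1 d s X
  + e * (Vb1 d 0 X * px Vb2 d 0 X + g * (Vb2 d 0 X * py Vb2 d 0 X))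
  + (e * Vb1 d 0 X * px s2 d s X + e * px Vb2 d 0 X * s1 d s X
     + e * g * Vb2 d 0 X * py s2 d s X + e * g * py Vb2 d 0 X * s2 d s X) + quad2 d s X))).
  apply: J_eq => s _.
  exact: (@mom_split_alg e g (mu (dP d)) (cor2 d) (clamp s) ('F (fdt V2) d s X) ('F W d s X)
    ('F V1 d s X) ('F V2 d s X) (zx d s X) (zy d s X) (zt d s X) (Vb1 d 0 X) (Vb2 d 0 X) (s1 d s X) (s2 d s X)
    (px Vb2 d 0 X) (py Vb2 d 0 X) (px s2 d s X) (py s2 d s X)
    ('Fx V2 d s X) ('Fy V2 d s X) ('Fz V2 d s X) (px ('F V2) d s X) (py ('F V2) d s X)
    ('F V1 d s X) (V1_split d s X) (V2_split d s X) (px_V2 d s X) (py_V2 d s X)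
    (flat_x 0 0 0 d s X sV2) (flat_yE 0 0 0 d s X sV2)).
apply: (J_momentum _ _ _ _ _ _ (rc _ (O_reg (@O_slope2 R))) (rc _ (reg_flat sV1)) (rc _ (O_reg (O_px O_s2)))
  (rc _ (O_reg O_s1)) (rc _ (O_reg (O_py O_s2))) (rc _ (O_reg O_s2)) (rc _ (O_reg O_quad2))).
- exact: (avg_px_osc d 0 X (reg_flat sV2) O_s2).
- exact: (avg_osc d 0 X (reg_flat sV1)).
- exact: (avg_py_osc d 0 X (reg_flat sV2) O_s2).
- exact: (avg_osc d 0 X (reg_flat sV2)).
Qed.

End AveragedMomentum.

(** * Affine change of variable *)

Section Affine.
Variable R : realType.

Lemma is_derive_affine (a k s : R) : is_derive s 1 (fun s : R => a + s * k) k.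
Proof.
have -> : (fun s : R => a + s * k) = cst a + k *: (@id R) by apply/funext => t; rewrite mulrC.
have : is_derive s 1 (cst a + k *: (@id R)) (0 + k *: 1) by apply: is_deriveD; apply: is_deriveZ.
by rewrite add0r [_ *: 1]mulr1.
Qed.

Lemma J_affine (a k : R) (G : R -> R) : 0 < k -> continuous G ->
  J a (a + k) G = k * J 0 1 (fun s => G (a + s * k)).
Proof.
move=> k0 cG; pose F s := a + s * k.
have cF : continuous F.
  by move=> s; apply: differentiable_continuous; apply/derivable1_diffP; have [] := is_derive_affine a k s.
have F' : derive1 F = fun=> k.
  by apply/funext => s; rewrite derive1E; have [_ ->] := is_derive_affine a k s.
have cGF : continuous (fun s => G (F s)).
  by move=> s; exact: (@continuous_comp _ _ _ F G s (cF _) (cG _)).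
rewrite -JZ//; apply: EFin_inj; rewrite -(J_EFin a (a + k) cG) -J_EFin; last first.
  exact: (cM (@cC _ _ k) cGF).
have := @integration_by_substitution_increasing R F G 0 1 ler01.
have -> : F 0 = a by rewrite /F mul0r addr0.
have -> : F 1 = a + k by rewrite /F mul1r.
rewrite F' => ->.
- by apply: eq_integral => s _ /=; rewrite mulrC.
- by move=> x y _ _ xy; rewrite ltrD2l ltr_pM2r.
- by move=> x _; exact: cvg_cst.
- exact: is_cvg_cst.
- exact: is_cvg_cst.
- split; first by move=> s _; have [] := is_derive_affine a k s.
    exact/cvg_at_right_filter/cF.
  exact/cvg_at_left_filter/cF.
- exact: continuous_subspaceT.
Qed.

End Affine.

(** * The averaged velocity and its time derivative *)

Section Column.
Variable R : realType.
Implicit Types (d : data R) (f : ffield R).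

(** The time derivative of [Vbar] at an end point of the interval uses its formula on a full
    neighbourhood, where [q.1] may leave the interval. [column] retains what the formula requires at
    such a [q]. *)
Definition column f d (q : sp2 R) := [/\ 0 < h d q, forall s, differentiable (f d) (level d s q)
  & forall v, is_derive q v (h d) (eps (dP d) * 'D_v (zetaf d) q)].

Lemma cont_level_joint d s X : {for (s, (dt d, X)), continuous (fun p : R * sp2 R => level d p.1 p.2)}.
Proof.
have ch : {for (dt d, X), continuous (h d)}.
  have Fp : surface d (dt d, X) by split; [exact: dI_dt|].
  have c := @smooth_on_cont R _ (surface d) _ (zetaf d) (dt d, X) (@ssurf_zeta R d) Fp.
  by apply: cvgD; [exact: cvg_cst|apply: cvgM; [exact: cvg_cst|exact: c]].
have cs : {for (s, (dt d, X)), continuous (fun p : R * sp2 R => p.2)} by exact: cont_snd.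
have c1 : {for (s, (dt d, X)), continuous (fun p : R * sp2 R => p.2.1)}.
  exact: (@continuous_comp _ _ _ snd fst (s, (dt d, X)) cs (@cont_fst _ _ (dt d, X))).
have c2 : {for (s, (dt d, X)), continuous (fun p : R * sp2 R => p.2.2)}.
  exact: (@continuous_comp _ _ _ snd snd (s, (dt d, X)) cs (@cont_snd _ _ (dt d, X))).
have c3 : {for (s, (dt d, X)), continuous (fun p : R * sp2 R => -1 + clamp p.1 * h d p.2)}.
  apply: cvgD; first exact: cvg_cst.
  apply: cvgM.
    exact: (@continuous_comp _ _ _ fst (@clamp R) (s, (dt d, X)) (@cont_fst _ _ _) (@continuous_clamp R _)).
  exact: (@continuous_comp _ _ _ snd (h d) (s, (dt d, X)) cs ch).
exact: (cont_pair c1 (cont_pair c2 c3)).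
Qed.

(** The fields are smooth on an open set around the closed fluid, and compactness of the levels
    [[0, 1]] keeps the whole column over a nearby [q] inside it. *)
Lemma near_column f d (X : vec2 R) : sfluid f -> \forall q \near (dt d, X), column f d q.
Proof.
move=> sf; have [U [oU FU sU]] := sf d.
have [Z [oZ FZ sZ]] := @ssurf_zeta R d.
have Fp : surface d (dt d, X) by split; [exact: dI_dt|].
have nZ : \forall q \near (dt d, X), Z q by apply: open_nbhs_nbhs; split=> //; exact: FZ.
have ch : {for (dt d, X), continuous (h d)}.
  have c := @smooth_on_cont R _ (surface d) _ (zetaf d) (dt d, X) (@ssurf_zeta R d) Fp.
  by apply: cvgD; [exact: cvg_cst|apply: cvgM; [exact: cvg_cst|exact: c]].
have nh : \forall q \near (dt d, X), 0 < h d q.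
  exact: (ch [set z : R | 0 < z] (open_nbhs_nbhs (conj (@open_gt R 0) (h_gt0 (dI_dt d : dI d (dt d, X).1))))).
have nU : \forall q \near (dt d, X), forall s, 0 <= s <= 1 -> U (level d s q).
  apply: near_segment => s _.
  apply: (@cont_level_joint d s X U); apply: open_nbhs_nbhs; split=> //; apply: FU.
  exact: (level_fluid s (dI_dt d : dI d (dt d, X).1)).
apply: filterS (filterI nZ (filterI nh nU)) => q [Zq [hq Uq]]; split=> // [s|v].
  by rewrite -(level_clamp d s q); apply: (sU [::]); apply: Uq; exact: clamp_itv.
have dz : derivable (zetaf d) q v by apply: diff_derivable; exact: (sZ [::] q Zq).
have D := derivableP dz.
have : is_derive q v (cst 1 + eps (dP d) *: zetaf d) (0 + eps (dP d) *: 'D_v (zetaf d) q).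
  by apply: is_deriveD; apply: is_deriveZ.
by rewrite add0r.
Qed.

Lemma cont_column f d q : column f d q -> continuous (fun s => f d (level d s q)).
Proof.
move=> [_ df _] s; have cf := differentiable_continuous (df s).
have c1 : continuous (fun s : R => -1 + clamp s * h d q).
  by move=> t; apply: cvgD; [exact: cvg_cst|apply: cvgM; [exact: continuous_clamp|exact: cvg_cst]].
exact: (@continuous_comp _ _ _ (fun s => level d s q) (f d) s
  (cont_pair (@cont_cst _ _ _ _) (cont_pair (@cont_cst _ _ _ _) (c1 s))) cf).
Qed.

Lemma column_average f d q : column f d q ->
  (depth (dP d) (dS d) q)^-1 * J (-1) (eps (dP d) * zeta (dS d) q) (fun z => f d (q.1, (q.2, z)))
  = J 0 1 (fun s => f d (level d s q)).
Proof.
move=> cq; have [h0 _ _] := cq; pose k := h d q; have k0 : k != 0 by rewrite gt_eqF.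
pose g s := f d (level d s q); have cg : continuous g := cont_column cq.
(* [g] is constant in the level outside [[0, 1]], so [G] extends the integrand continuously to the
   whole line. *)
pose G z := g ((z + 1) / k).
have cG : continuous G.
  have ca : continuous (fun z : R => (z + 1) / k).
    by move=> z; apply: cvgM; [apply: cvgD; [exact: cvg_id|exact: cvg_cst]|exact: cvg_cst].
  have cc z := @continuous_comp R R R (fun z : R => (z + 1) / k) g z (ca z) (cg _).
  exact: cc.
have top : eps (dP d) * zeta (dS d) q = -1 + k by rewrite /k /h /depth addrA addNr add0r.
have -> : J (-1) (eps (dP d) * zeta (dS d) q) (fun z => f d (q.1, (q.2, z))) = J (-1) (-1 + k) G.
  rewrite top; apply: J_eq => z /andP[z0 z1]; rewrite /G /g /level clamp_id; last first.
    by rewrite divr_ge0 ?ler_pdivrMr ?(ltW h0)//=; move: z0 z1; clear; move: k => k *; lra.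
  by rewrite divfK// addrCA addNr addr0.
rewrite J_affine// mulKf//; apply: J_eq => s _; rewrite /G.
by congr g; rewrite addrAC addNr add0r mulfK.
Qed.

Lemma is_derive_column f d (X : vec2 R) (v : sp2 R) : sfluid f ->
  is_derive (dt d, X) v (fun q => J 0 1 (fun s => f d (level d s q)))
    (J 0 1 (fun s => 'D_((v.1, (v.2, 0)) : sp3 R) (f d) (level d s (dt d, X))
     + clamp s * (eps (dP d) * 'D_v (zetaf d) (dt d, X)) * dz3 (f d) (level d s (dt d, X)))).
Proof.
move=> sf; have nc := near_column d X sf.
have Ip : dI d (dt d, X).1 by exact: dI_dt.
have Fp : surface d (dt d, X) by split; [exact: dI_dt|].
pose D s q := 'D_((v.1, (v.2, 0)) : sp3 R) (f d) (level d s q)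
  + clamp s * (eps (dP d) * 'D_v (zetaf d) q) * dz3 (f d) (level d s q).
have cD s : {for (s, (dt d, X)), continuous (fun p : R * sp2 R => D p.1 p.2)}.
  have cw w : {for (s, (dt d, X)), continuous (fun p : R * sp2 R => 'D_w (f d) (level d p.1 p.2))}.
    have sD := smooth_on_derive w (sf d).
    exact: (@continuous_comp _ _ _ (fun p : R * sp2 R => level d p.1 p.2) ('D_w (f d)) (s, (dt d, X))
      (@cont_level_joint d s X) (smooth_on_cont sD (level_fluid s Ip))).
  have cz : {for (s, (dt d, X)), continuous (fun p : R * sp2 R => 'D_v (zetaf d) p.2)}.
    exact: (@continuous_comp _ _ _ snd ('D_v (zetaf d)) (s, (dt d, X)) (@cont_snd _ _ _)
      (smooth_on_cont (smooth_on_derive v (@ssurf_zeta R d)) Fp)).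
  have cc : {for (s, (dt d, X)), continuous (fun p : R * sp2 R => clamp p.1)}.
    exact: (@continuous_comp _ _ _ fst (@clamp R) (s, (dt d, X)) (@cont_fst _ _ _) (@continuous_clamp R _)).
  apply: cvgD; first exact: cw.
  by apply: cvgM; [apply: cvgM; [exact: cc|apply: cvgM; [exact: cvg_cst|exact: cz]]|exact: cw].
apply: (@J_is_derive R _ (fun s q => f d (level d s q)) D 0 1 (dt d, X) v ler01).
- apply: filterS nc => q [_ df dh] s _.
  rewrite /D -(derive_split _ _ _ (df s)); apply: (is_derive_comp (df s)).
  apply: is_derive_pair; first exact: is_derive_fst.
  apply: is_derive_pair; first exact: is_derive_snd.
  have : is_derive q v (cst (-1) + clamp s *: h d) (0 + clamp s *: (eps (dP d) * 'D_v (zetaf d) q)).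
    by apply: is_deriveD; apply: is_deriveZ.
  by rewrite add0r.
- by apply: filterS nc => q; exact: cont_column.
- move=> s.
  exact: (@continuous_comp _ _ _ (fun s : R => (s, (dt d, X))) (fun p : R * sp2 R => D p.1 p.2) s
    (cont_pair (@cont_id _ _) (@cont_cst _ _ _ _)) (cD s)).
- by move=> s _; exact: cD.
Qed.

Lemma Vbar_column d q : column (@V1 R) d q -> column (@V2 R) d q ->
  Vbar (dP d) (dS d) q = (J 0 1 (fun s => V1 d (level d s q)), J 0 1 (fun s => V2 d (level d s q))).
Proof. by move=> c1 c2; rewrite -(column_average c1) -(column_average c2). Qed.

Lemma Vbar_slice d (X : vec2 R) : Vbar (dP d) (dS d) (dt d, X) = (@Vb1 R d 0 X, @Vb2 R d 0 X).
Proof. exact: Vbar_column (nbhs_singleton (near_column d X (@sV1 R))) (nbhs_singleton (near_column d X (@sV2 R))). Qed.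

Lemma dt_Vbar d (X : vec2 R) : dt2 (Vbar (dP d) (dS d)) (dt d, X) = (@T1 R d 0 X, @T2 R d 0 X).
Proof.
have D1 := @is_derive_column (@V1 R) d X (1, (0, 0)) (@sV1 R).
have D2 := @is_derive_column (@V2 R) d X (1, (0, 0)) (@sV2 R).
have D := is_derive_pair D1 D2.
have VE : nbhs ((dt d, X) : sp2 R) [set q | (J 0 1 (fun s => V1 d (level d s q)), J 0 1 (fun s => V2 d (level d s q)))
    = Vbar (dP d) (dS d) q].
  by apply: filterS2 (near_column d X (@sV1 R)) (near_column d X (@sV2 R)) => q c1 c2; exact: esym (Vbar_column c1 c2).
have E := near_eq_is_derive VE D.
by case: E => _ E; exact: E.
Qed.

End Column.

(** * From the classes [O] to the norms of the theorem *)

Section Slices.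
Variable R : realType.
Implicit Types (d : data R) (A B F : family R).

(** Both sides are limits of the same quotients. Hence the spatial derivatives of a residual are
    determined by its values at the one time [dt d]. *)
Lemma slice_derive (W : normedModType R) (f : sp2 R -> W) t (X v : vec2 R) :
  'D_((0, v) : sp2 R) f (t, X) = 'D_v (fun Y => f (t, Y)) X.
Proof.
have Q : (fun k : R => k^-1 *: (f (k *: ((0, v) : sp2 R) + (t, X)) - f (t, X))) =
   (fun k : R => k^-1 *: (f (t, k *: v + X) - f (t, X))).
  apply/funext => k; congr (_ *: (f _ - _)).
  by apply: injective_projections => //=; rewrite [k *: 0]mulr0 add0r.
by rewrite /derive /= -Q.
Qed.

Lemma slice_dx f A d X : reg A -> (forall Y, f (dt d, Y) = A d 0 Y) ->
  dx2 f (dt d, X) = px A d 0 X.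
Proof. by move=> rA fA; rewrite /dx2 slice_derive; congr ('D_ _ _ X); apply/funext. Qed.
Lemma slice_dy f A d X : reg A -> (forall Y, f (dt d, Y) = A d 0 Y) ->
  dy2 f (dt d, X) = py A d 0 X.
Proof. by move=> rA fA; rewrite /dy2 slice_derive; congr ('D_ _ _ X); apply/funext. Qed.

Lemma slice_pair_dx (f : sp2 R -> vec2 R) A B d X : reg A -> reg B ->
  (forall Y, f (dt d, Y) = (A d 0 Y, B d 0 Y)) -> dx2 f (dt d, X) = (px A d 0 X, px B d 0 X).
Proof.
move=> rA rB fAB; rewrite /dx2 slice_derive.
have -> : (fun Y => f (dt d, Y)) = (fun Y => (A d 0 Y, B d 0 Y)) by apply/funext.
have [_ xA _] := rA d; have [_ xB _] := rB d.
by have [_ ->] := is_derive_pair (derivableP (xA 0 X)) (derivableP (xB 0 X)).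
Qed.
Lemma slice_pair_dy (f : sp2 R -> vec2 R) A B d X : reg A -> reg B ->
  (forall Y, f (dt d, Y) = (A d 0 Y, B d 0 Y)) -> dy2 f (dt d, X) = (py A d 0 X, py B d 0 X).
Proof.
move=> rA rB fAB; rewrite /dy2 slice_derive.
have -> : (fun Y => f (dt d, Y)) = (fun Y => (A d 0 Y, B d 0 Y)) by apply/funext.
have [_ _ yA] := rA d; have [_ _ yB] := rB d.
by have [_ ->] := is_derive_pair (derivableP (yA 0 X)) (derivableP (yB 0 X)).
Qed.

Definition jet (a b : nat) F := iter a (@px R) (iter b (@py R) F).

Lemma O_jet c k a b F : O c k F -> O c k (jet a b F).
Proof.
move=> OF; rewrite /jet.
have Ob : O c k (iter b (@py R) F) by elim: b => //= b; exact: O_py.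
by elim: a => //= a; exact: O_px.
Qed.

Lemma slice_jet c k (f : sp2 R -> vec2 R) A B d a b X : O c k A -> O c k B ->
  (forall Y, f (dt d, Y) = (A d 0 Y, B d 0 Y)) ->
  iter a dx2 (iter b dy2 f) (dt d, X) = (jet a b A d 0 X, jet a b B d 0 X).
Proof.
move=> OA OB fAB; rewrite /jet.
have H Y : iter b dy2 f (dt d, Y) = (iter b (@py R) A d 0 Y, iter b (@py R) B d 0 Y).
  elim: b Y => //= b IH Y; apply: slice_pair_dy => //.
    exact: O_reg (O_jet 0 b OA).
  exact: O_reg (O_jet 0 b OB).
elim: a X => //= a IH Y; apply: slice_pair_dx => //.
  exact: O_reg (O_jet a b OA).
exact: O_reg (O_jet a b OB).
Qed.

Lemma sum_ord_le n (p : pred 'I_n) (T : 'I_n -> \bar R) (K : R) : 0 <= K ->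
  (forall i, p i -> (T i <= K%:E)%E) -> (\sum_(i < n | p i) T i <= (n%:R * K)%:E)%E.
Proof.
move=> K0 TK; apply: (@le_trans _ _ (\sum_(i < n | p i) K%:E)%E); first exact: lee_sum.
rewrite sumEFin lee_fin sumr_const -[X in X <= _]mulr_natl ler_wpM2r// ler_nat.
by rewrite (leq_trans (max_card _))// card_ord.
Qed.

(** Finitely many [n] and [m] are merged by maxima; the induction runs over the code [a * s.+1 + b]
    of the pair [(a, b)]. *)
Lemma jets_bounded k s F : O true k F -> exists n m, forall d, bounded n d ->
  forall a b th, (a <= s)%N -> (b <= s)%N -> (N2 (jet a b F d th) <= (scale m k d ^+ 2)%:E)%E.
Proof.
move=> OF.
suff [n [m H]] : exists n m, forall d, bounded n d -> forall i th, (i < s.+1 * s.+1)%N ->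
    (N2 (jet (i %/ s.+1) (i %% s.+1) F d th) <= (scale m k d ^+ 2)%:E)%E.
  exists n, m => d /H Hd a b th la lb; have := Hd (a * s.+1 + b)%N th.
  rewrite divnMDl// divn_small// addn0 modnMDl modn_small//; apply.
  by rewrite (@leq_trans (a.+1 * s.+1))// ?leq_mul// mulSn addnC ltn_add2r.
elim: (s.+1 * s.+1)%N => [|j [n [m IH]]]; first by exists 0%N, 0%N.
have [n' [m' H]] := cls_bnd (O_jet (j %/ s.+1) (j %% s.+1) OF 0).
exists (maxn n n'), (maxn m m') => d bd i th; rewrite ltnS leq_eqVlt => /orP[/eqP ->|ij].
  apply: le_trans (H d (bounded_le (leq_maxr _ _) bd) th) _.
  by rewrite lee_fin lerXn2r ?nnegrE ?(ltW (scale_gt0 _ _ _))// scale_le// leq_maxr.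
apply: le_trans (IH d (bounded_le (leq_maxl _ _) bd) i th ij) _.
by rewrite lee_fin lerXn2r ?nnegrE ?(ltW (scale_gt0 _ _ _))// scale_le// leq_maxl.
Qed.

Lemma N2_pair (f g : vec2 R -> R) (K : R) : continuous f -> continuous g ->
  (N2 f <= K%:E)%E -> (N2 g <= K%:E)%E ->
  (\int[lebesgue_measure \x lebesgue_measure]_(X in [set: vec2 R]) (sq2 (f X, g X))%:E
   <= (2 * K)%:E)%E.
Proof.
move=> cf cg fK gK; rewrite /sq2 /=.
under eq_integral do rewrite EFinD.
rewrite ge0_integralD//=; try by move=> *; rewrite lee_fin sqr_ge0.
- rewrite mulr_natl mulr2n EFinD; exact: leeD fK gK.
- exact: measurable_sqr2.
- exact: measurable_sqr2.
Qed.

(** The norm has at most [s.+1] times [s.+1] terms, each with two components; powers of [kap] absorb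
    their number. *)
Lemma count_le (s : nat) (k K : R) : 0 <= K -> 2 <= k ->
  s.+1%:R * (s.+1%:R * (2 * K)) <= (k ^+ s.+1) ^+ 2 * K.
Proof.
move=> K0 k2; rewrite !mulrA ler_wpM2r//.
have sk : s.+1%:R * 2 <= k ^+ s.+1.
  elim: s => [|s IH]; first by rewrite mul1r expr1.
  rewrite exprS -[s.+2]addn1 natrD mulrDl mul1r.
  have k1 : 2 <= k ^+ s.+1 by apply: le_trans IH; rewrite ler_peMl// ler1n.
  by move: IH k1; move: (_ ^+ _) (_ * 2) => x y xy x2; nra.
have s1 : 1 <= s.+1%:R :> R by rewrite ler1n.
by move: sk s1; move: (k ^+ _) (s.+1%:R) => x y xy y1; rewrite expr2; nra.
Qed.

(** Order 4 in [nu] is order 2 in [mu], and [kap] is [size] of the four quantities on which the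
    constant may depend, so its powers are admissible nondecreasing constants. *)
Lemma isO_slice (Res : params R -> flow R -> sp2 R -> vec2 R) A B : O true 4 A -> O true 4 B ->
  (forall d X, Res (dP d) (dS d) (dt d, X) = (A d 0 X, B d 0 X)) -> isO_boussi sq2 2 Res.
Proof.
move=> OA OB RAB s.
have [n1 [m1 H1]] := jets_bounded s OA; have [n2 [m2 H2]] := jets_bounded s OB.
pose n := maxn n1 n2; pose m := maxn m1 m2.
exists n, (fun a b c k : R => size a b c k ^+ (m + s.+1)); split; first exact: size_nondecreasing.
move=> mu0 M hmin A' I P S m0 h0 iI nI rg sy bd t It.
pose d := Data A' m0 h0 iI nI rg sy It.
have bn : bounded n d := bd.
have nu4 : mu P ^+ 2 = nu d ^+ 4 by rewrite -[mu P]/(mu (dP d)) -(nu2 d) -exprM.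
have K0 := scale_gt0 m 4 d; set K := scale m 4 d in K0.
have T a b : (a <= s)%N -> (b <= s)%N ->
    (\int[lebesgue_measure \x lebesgue_measure]_(X in [set: vec2 R])
      (sq2 (iter a dx2 (iter b dy2 (Res P S)) (t, X)))%:E <= (2 * K ^+ 2)%:E)%E.
  move=> la lb.
  under eq_integral do rewrite (@slice_jet true 4 (Res P S) A B d a b _ OA OB (RAB d)).
  apply: N2_pair.
  - exact: (reg_cont (O_reg (O_jet a b OA))).
  - exact: (reg_cont (O_reg (O_jet a b OB))).
  - apply: le_trans (H1 d (bounded_le (leq_maxl _ _) bn) a b 0 la lb) _.
    by rewrite lee_fin lerXn2r ?nnegrE ?(ltW (scale_gt0 _ _ _))// scale_le// leq_maxl.
  - apply: le_trans (H2 d (bounded_le (leq_maxr _ _) bn) a b 0 la lb) _.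
    by rewrite lee_fin lerXn2r ?nnegrE ?(ltW (scale_gt0 _ _ _))// scale_le// leq_maxr.
have K2 : 0 <= K ^+ 2 by rewrite sqr_ge0.
have p0 : 0 <= 2 * K ^+ 2 by exact: mulr_ge0 (ler0n _ 2) K2.
apply: (@le_trans _ _ (sqrte ((kap d ^+ s.+1) ^+ 2 * K ^+ 2)%:E)).
  rewrite /Hnorm2 lee_sqrt; last by rewrite lee_fin mulr_ge0// sqr_ge0.
  apply: (@le_trans _ _ (s.+1%:R * (s.+1%:R * (2 * K ^+ 2)))%:E).
    apply: sum_ord_le => [|a _]; first exact: mulr_ge0 (ler0n _ _) p0.
    apply: sum_ord_le => [|b _]; first exact: p0.
    by apply: T; rewrite -ltnS.
  by rewrite lee_fin; apply: count_le => //; exact: kap_ge2.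
rewrite -exprMn /= sqrtr_sqr lee_fin ger0_norm; last first.
  by rewrite mulr_ge0 ?exprn_ge0 ?(ltW (kap_gt0 _))// ltW.
by rewrite nu4 /K /scale exprD mulrA (mulrC (kap d ^+ s.+1)).
Qed.

(** The residual vanishes on the whole slice, hence so do its spatial derivatives, and the constant
    0 works. *)
Lemma isO_zero (Res : params R -> flow R -> sp2 R -> R) :
  (forall d X, Res (dP d) (dS d) (dt d, X) = 0) -> isO_boussi sq1 2 Res.
Proof.
move=> R0 s; exists 0%N, (fun _ _ _ _ : R => 0); split; first by [].
move=> mu0 M hmin A' I P S m0 h0 iI nI rg sy bd t It.
pose d := Data A' m0 h0 iI nI rg sy It.
have r0 : reg (fun (_ : data R) (_ : R) (_ : vec2 R) => 0 : R).
  by move=> d'; split=> *; [exact: cvg_cst|exact: derivable_cst|exact: derivable_cst].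
have J0 a b X : iter a dx2 (iter b dy2 (Res P S)) (t, X) = 0.
  have Jb Y : iter b dy2 (Res P S) (t, Y) = 0.
    elim: b Y => [|b IH] Y; first exact: (R0 d Y).
    exact: (etrans (@slice_dy _ _ d Y r0 IH) (py_zero _ _ _)).
  elim: a X => [|a IH] Y; first exact: Jb.
  exact: (etrans (@slice_dx _ _ d Y r0 IH) (px_zero _ _ _)).
rewrite mul0r /Hnorm2 big1 ?sqrte0// => a _; rewrite big1// => b _.
by apply: integral0_eq => X _; rewrite J0 /sq1 expr0n.
Qed.

End Slices.

#[local] Hint Resolve O_T1 O_T2 O_divT O_Vb1 O_Vb2 O_quad1 O_quad2 O_E1_top O_E2_top O_avg_E1 O_avg_E2 : odb.

(** * The two Boussinesq residuals *)

Section Final.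
Variable R : realType.
Implicit Types (d : data R) (F G : family R) (f : ffield R) (g : sfield R).
Local Notation V1 := (@V1 R). Local Notation V2 := (@V2 R). Local Notation W := (@W R).
Local Notation o1 := (@o1 R). Local Notation o2 := (@o2 R). Local Notation o3 := (@o3 R).
Local Notation hf := (@hf R).
Local Notation Vb1 := (@Vb1 R). Local Notation Vb2 := (@Vb2 R).
Local Notation T1 := (@T1 R). Local Notation T2 := (@T2 R).
Local Notation divT := (@divT R).
Let sW := @sW R. Let sV1 := @sV1 R. Let sV2 := @sV2 R.

Definition residual1 : family R := fun d th X =>
  (T1 d th X - mu (dP d) / 3 * px divT d th X) + zx d th X
  + eps (dP d) * (Vb1 d th X * px Vb1 d th X + gam (dP d) * Vb2 d th X * py Vb1 d th X)
  + eps (dP d) / Ro (dP d) * - Vb2 d th X.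
Definition residual2 : family R := fun d th X =>
  (T2 d th X - mu (dP d) / 3 * (gam (dP d) * py divT d th X)) + gam (dP d) * zy d th X
  + eps (dP d) * (Vb1 d th X * px Vb2 d th X + gam (dP d) * Vb2 d th X * py Vb2 d th X)
  + eps (dP d) / Ro (dP d) * Vb1 d th X.

(** The surface value [b] cancels between the two brackets, each already of order 4: mean minus
    surface value minus dispersion, and surface value plus gradient of [zeta]. The mean [q] of the
    quadratic remainder is the third such term. *)
Lemma residual_alg (a b t m p z e g v x w y l u q c : R) : a = t + l * u + e * (v * x + g * (w * y)) + q ->
  l * u = c -> t - m * p + z + e * (v * x + g * w * y) + c = (a - b - m * p) + (b + z) - q.
Proof. by move=> -> <-; ring. Qed.

Lemma O_residual1 : O true 4 residual1.
Proof.
have OQ := O_avg (@O_quad1 R).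
have E d th X := @residual_alg _ (at1 (@E1 R) d th X) _ (mu (dP d) / 3) (px divT d th X) (zx d th X) _ _ _ _ _ _ _ _ _
  (eps (dP d) / Ro (dP d) * - Vb2 d th X) (avg_E1 d th X) ltac:(by rewrite /cor1 mulNr mulrN).
apply: (O_ext E).
exact: (O_weaken (O_add (O_add (@O_avg_E1 R) (@O_E1_top R)) (O_opp OQ))).
Qed.

Lemma O_residual2 : O true 4 residual2.
Proof.
have OQ := O_avg (@O_quad2 R).
have E d th X := @residual_alg _ (at1 (@E2 R) d th X) _ (mu (dP d) / 3) (gam (dP d) * py divT d th X)
  (gam (dP d) * zy d th X) _ _ _ _ _ _ _ _ _
  (eps (dP d) / Ro (dP d) * Vb1 d th X) (avg_E2 d th X) erefl.
apply: (O_ext E).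
exact: (O_weaken (O_add (O_add (@O_avg_E2 R) (@O_E2_top R)) (O_opp OQ))).
Qed.

Lemma momentum_slice d (X : vec2 R) :
  boussinesq_momentum (dP d) (zeta (dS d)) (Vbar (dP d) (dS d)) (dt d, X)
  = (residual1 d 0 X, residual2 d 0 X).
Proof.
have rV1 := O_reg (@O_Vb1 R). have rV2 := O_reg (@O_Vb2 R).
have rT1 := O_reg (@O_T1 R). have rT2 := O_reg (@O_T2 R). have rD := O_reg (@O_divT R).
have vx := slice_pair_dx X rV1 rV2 (Vbar_slice d).
have vy := slice_pair_dy X rV1 rV2 (Vbar_slice d).
have D Y : divg (gam (dP d)) (dt2 (Vbar (dP d) (dS d))) (dt d, Y) = divT d 0 Y.
  by rewrite /divg (slice_pair_dx Y rT1 rT2 (dt_Vbar d)) (slice_pair_dy Y rT1 rT2 (dt_Vbar d)).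
have rz := reg_surf (@ssurf_zeta R).
have zxE : dx2 (zeta (dS d)) (dt d, X) = zx d 0 X := @slice_dx R _ _ d X rz (fun=> erefl).
have zyE : dy2 (zeta (dS d)) (dt d, X) = zy d 0 X := @slice_dy R _ _ d X rz (fun=> erefl).
rewrite /boussinesq_momentum /grad /adv2 (slice_dx X rD D) (slice_dy X rD D) zxE zyE vx vy.
by rewrite (dt_Vbar d X) (Vbar_slice d X).
Qed.

(** Integration by parts against the level variable, whose boundary term vanishes at the bottom. *)
Lemma clamp_parts f d X : sfluid f ->
  J 0 1 (fun s => clamp s * (hf d s X * 'Fz f d s X)) = 'F f d 1 X - avg ('F f) d 0 X.
Proof.
move=> sf.
have cF : continuous (fun s => 'F f d s X) by exact: (reg_cont1 (reg_flat sf)).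
have cz : continuous (fun s => 'Fz f d s X) by exact: (reg_cont1 (reg_flat (sfluid_fN 0 0 1 sf))).
have ch : continuous (fun s => hf d s X * 'Fz f d s X) by exact: (cM (@cC _ _ (hf d 0 X)) cz).
have ci : continuous (fun s : R => s) by move=> s; exact: cvg_id.
have c1 := cM ci cF; have c2 := cM ci ch.
have P : J 0 1 (fun s => 'F f d s X + s * (hf d s X * 'Fz f d s X)) = 1 * 'F f d 1 X - 0 * 'F f d 0 X.
  apply: (@J_FTC R 0 1 (fun s => s * 'F f d s X) _ ler01 c1 (cD cF c2)) => s s01.
  have D := is_deriveM (is_derive_id s (1 : R)) (@is_derive_flatN R 0 0 0 f d X s sf s01).
  by apply: (is_derive_eq D); rewrite /GRing.scale /= mulr1 addrC.
rewrite mul1r mul0r subr0 (JD 0 1 cF c2) in P.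
rewrite (@J_eq _ 0 1 _ (fun s => s * (hf d s X * 'Fz f d s X))); last by move=> s s01; rewrite clamp_id.
by rewrite -P addrC addKr.
Qed.

Lemma px_h d th X : px hf d th X = eps (dP d) * zx d th X.
Proof.
rewrite (congr1 (fun F : family R => F d th X) (px_surf (@ssurf_zeta R))).
have Ip : dI d (dt d, X).1 by exact: dI_dt.
apply: (etrans (esym (slice_derive (h d) (dt d) X (ex R)))).
by have [_ ->] := @near_surface_h R d ((0, ex R) : sp2 R) (dt d, X) Ip.
Qed.
Lemma py_h d th X : py hf d th X = eps (dP d) * zy d th X.
Proof.
rewrite (congr1 (fun F : family R => F d th X) (py_surf (@ssurf_zeta R))).
have Ip : dI d (dt d, X).1 by exact: dI_dt.
apply: (etrans (esym (slice_derive (h d) (dt d) X (ey R)))).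
by have [_ ->] := @near_surface_h R d ((0, ey R) : sp2 R) (dt d, X) Ip.
Qed.

Lemma J_lin4 (A B C D : R -> R) (a b c k : R) :
  continuous A -> continuous B -> continuous C -> continuous D ->
  J 0 1 (fun s => a * A s + b * B s + c * C s + k * D s)
  = a * J 0 1 A + b * J 0 1 B + c * J 0 1 C + k * J 0 1 D.
Proof.
move=> cA cB cC' cD'.
have cZ (r : R) (K : R -> R) : continuous K -> continuous (fun s : R => r * K s).
  by move=> cK; exact: (cM (@cC _ _ r) cK).
have c1 := cD (cZ a A cA) (cZ b B cB); have c2 := cD c1 (cZ c C cC').
by rewrite (JD 0 1 c2 (cZ k D cD')) (JD 0 1 c1 (cZ c C cC')) (JD 0 1 (cZ a A cA) (cZ b B cB)) !JZ.
Qed.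

Lemma divs_alg (h p q c x y a b g : R) :
  h * ((p - c * x * a) + g * (q - c * y * b))
  = h * p + g * h * q + - x * (c * (h * a)) + - (g * y) * (c * (h * b)).
Proof. by ring. Qed.

(** Differentiation at fixed height does not commute with integration up to the surface: the [px]
    and [py] terms have mean zero, while the shear terms integrate by parts to surface values minus
    means. *)
Lemma prim_divs_top d X : prim (fun d th X => hf d th X * divs d th X) d 1 X
  = - (eps (dP d) * zx d 0 X) * ('F V1 d 1 X - Vb1 d 0 X)
    + - (gam (dP d) * (eps (dP d) * zy d 0 X)) * ('F V2 d 1 X - Vb2 d 0 X).
Proof.
have -> : prim (fun d th X => hf d th X * divs d th X) d 1 X
    = J 0 1 (fun s => hf d 0 X * px (@s1 R) d s X + gam (dP d) * hf d 0 X * py (@s2 R) d s X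
      + - (eps (dP d) * zx d 0 X) * (clamp s * (hf d s X * 'Fz V1 d s X))
      + - (gam (dP d) * (eps (dP d) * zy d 0 X)) * (clamp s * (hf d s X * 'Fz V2 d s X))).
  rewrite /prim clamp1 mul1r /avgf; apply: J_eq => s _; rewrite clamp1 mul1r.
  exact: divs_alg.
have rz f : sfluid f -> continuous (fun s => clamp s * (hf d s X * 'Fz f d s X)).
  move=> sf; have cz : continuous (fun s => 'Fz f d s X) by exact: (reg_cont1 (reg_flat (sfluid_fN 0 0 1 sf))).
  exact: (cM (@continuous_clamp R) (cM (@cC _ _ (hf d 0 X)) cz)).
have O1 := O_px (@O_s1 R); have O2 := O_py (@O_s2 R).
rewrite (J_lin4 _ _ _ _ (@reg_cont1 R _ d X (O_reg O1)) (@reg_cont1 R _ d X (O_reg O2)) (rz _ sV1) (rz _ sV2)).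
rewrite (clamp_parts d X sV1) (clamp_parts d X sV2).
have -> : J 0 1 (fun s => px (@s1 R) d s X) = 0 by exact: (avg_px_osc d 0 X (reg_flat sV1) (@O_s1 R)).
have -> : J 0 1 (fun s => py (@s2 R) d s X) = 0 by exact: (avg_py_osc d 0 X (reg_flat sV2) (@O_s2 R)).
by rewrite !mulr0 !add0r.
Qed.

Lemma mass_alg (w m c1 h p q K e x y v1 v2 b1 b2 z g : R) : m != 0 -> c1 = 1 ->
  w = c1 * (- m * (h * (p + g * q))) + - m * K ->
  K = - (e * x) * (v1 - b1) + - (g * (e * y)) * (v2 - b2) ->
  z = w / m - e * (v1 * x + g * (v2 * y)) ->
  z + (h * p + e * x * b1 + g * (h * q + e * y * b2)) = 0.
Proof. by move=> m0 -> -> -> ->; field. Qed.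

(** Depth-integrated incompressibility and the kinematic condition both produce surface values of
    [V]; these cancel, and the mean velocity alone is left. *)
Lemma mass_slice d (X : vec2 R) :
  boussinesq_mass (dP d) (zeta (dS d)) (Vbar (dP d) (dS d)) (dt d, X) = 0.
Proof.
have rh := O_reg (@O_h R); have rV1 := O_reg (@O_Vb1 R); have rV2 := O_reg (@O_Vb2 R).
have V Y : (1 + eps (dP d) * zeta (dS d) (dt d, Y)) *: Vbar (dP d) (dS d) (dt d, Y)
    = (hf d 0 Y * Vb1 d 0 Y, hf d 0 Y * Vb2 d 0 Y) by rewrite Vbar_slice.
have r1 := reg_mul rh rV1; have r2 := reg_mul rh rV2.
rewrite /boussinesq_mass /divg (slice_pair_dx X r1 r2 V) (slice_pair_dy X r1 r2 V) /=.
have -> : px (fun d th X => hf d th X * Vb1 d th X) d 0 X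
    = hf d 0 X * px Vb1 d 0 X + eps (dP d) * zx d 0 X * Vb1 d 0 X.
  by rewrite px_mul// px_h addrC.
have -> : py (fun d th X => hf d th X * Vb2 d th X) d 0 X
    = hf d 0 X * py Vb2 d 0 X + eps (dP d) * zy d 0 X * Vb2 d 0 X.
  by rewrite py_mul// py_h addrC.
exact: (mass_alg (mu_neq0 d) (@clamp1 R) (W_split d 1 X) (prim_divs_top d X) (kinematic_top d X 0)).
Qed.

End Final.

Theorem proposition2p5 (R : realType) :
  isO_boussi sq1 2
    (fun (P : params R) (S : flow R) =>
       boussinesq_mass P (zeta S) (Vbar P S)) /\
  isO_boussi sq2 2
    (fun (P : params R) (S : flow R) =>
       boussinesq_momentum P (zeta S) (Vbar P S)).
Proof.
split; first exact: isO_zero (@mass_slice R).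
exact: isO_slice (@O_residual1 R) (@O_residual2 R) (@momentum_slice R).
Qed.
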